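(* Let $\kappa>0$. For every $0<\varepsilon_1,\varepsilon_2<1$, $$\Theta_\kappa(\varepsilon_1,\varepsilon_2)\ \ge\ \Phi(\varepsilon_1,\varepsilon_2).$$ Consequently, $$\Theta_\kappa(\varepsilon_1,\varepsilon_2)=1\qquad\text{whenever }\varepsilon_1+\varepsilon_2\ge 1,$$ and hence $\varepsilon_c(\kappa)\le \tfrac12$.
   Context: Fourier transform on $L^2(\mathbb R)$: $\widehat f(\xi)=\mathcal F f(\xi)=\int_{\mathbb R}e^{-2\pi i x\xi}f(x)\,dx$, extended to a unitary operator on $L^2(\mathbb R)$. For $\kappa>0$ let $\rho_\kappa(x)=\min\{1,\kappa/|x|\}$ for $x\ne0$, $\rho_\kappa(0)=1$, and $I_x^{(\kappa)}=(x-\rho_\kappa(x),x+\rho_\kappa(x))$. A measurable set $E\subset\mathbb R$ is called $(\varepsilon,\kappa)$-Wolff thin if $|E\cap I_x^{(\kappa)}|\le 2\varepsilon\rho_\kappa(x)$ for all $x\in\mathbb R$ ($|\cdot|$ is Lebesgue measure). For measurable $E,F\subset\mathbb R$, $P_E$ is multiplication by $\mathbf 1_E$ on $L^2(\mathbb R)$ and $Q_F=\mathcal F^{-1}P_F\mathcal F$. For $0<\varepsilon_1,\varepsilon_2<1$, $$\Theta_\kappa(\varepsilon_1,\varepsilon_2)=\sup\{\|P_EQ_F\|_{L^2\to L^2}:\ E\text{ is }(\varepsilon_1,\kappa)\text{-Wolff thin},\ F\text{ is }(\varepsilon_2,\kappa)\text{-Wolff thin}\},$$ $\Theta_\kappa(\varepsilon)=\Theta_\kappa(\varepsilon,\varepsilon)$,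 and $\varepsilon_c(\kappa)=\sup\{\varepsilon\in(0,1):\Theta_\kappa(\varepsilon)<1\}$. For $a,b\in[0,1]$, $\Phi(a,b)=\sqrt{a(1-b)}+\sqrt{b(1-a)}$ if $a+b\le1$, and $\Phi(a,b)=1$ if $a+b\ge1$. *)

(* Defs.v *)
From HB Require Import structures.
From mathcomp Require Import all_boot all_order all_algebra.
From mathcomp Require Import complex.
From mathcomp Require Import all_classical all_reals all_analysis measurable_realfun.

Set Implicit Arguments.
Unset Strict Implicit.
Unset Printing Implicit Defensive.

Import Order.TTheory GRing.Theory Num.Theory.
Import numFieldNormedType.Exports.

Local Open Scope classical_set_scope.
Local Open Scope ring_scope.
Local Open Scope complex_scope.

Section FourierL2.
Variable R : realType.

Local Notation mu := (@lebesgue_measure R).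

Implicit Types (E F : set R) (f g : R -> R[i]).

Definition cLnorm (p : \bar R) f : \bar R :=
  Lnorm mu p (fun x => (Normc.normc (f x))%:E).

(* Elements of L^p(R; C) are handled through Borel measurable representatives;
   every a.e.-class of Lebesgue measurable functions contains one. *)
Definition cLfun (p : \bar R) : set (R -> R[i]) :=
  [set f | [/\ measurable_fun setT (fun x : R => complex.Re (f x)),
               measurable_fun setT (fun x : R => complex.Im (f x)) &
               (cLnorm p f < +oo)%E]].

Definition cintegral f : R[i] :=
  (\int[mu]_x complex.Re (f x)) +i* (\int[mu]_x complex.Im (f x)).

Definition expi (t : R) : R[i] := cos t +i* sin t.

Definition fourier_int f : R -> R[i] :=
  fun xi => cintegral (fun x => expi (- (2 * pi * x * xi)) * f x).

(* Operators on L^2(R) are represented by their graphs on representatives: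
   (f, g) \in T means that g represents T f. In relation_scope, T \; S applies
   S first, and T^-1 is the inverse graph. *)
Local Notation L2rel := (set ((R -> R[i]) * (R -> R[i]))).

(* The continuous extension to L^2 of the integral transform on L^1 `&` L^2,
   that is, the closure of its graph in L^2 x L^2. *)
Definition fourier : L2rel :=
  [set fg | [/\ cLfun 2%:E fg.1, cLfun 2%:E fg.2 &
    exists u : nat -> R -> R[i],
      [/\ forall n, (cLfun 1 `&` cLfun 2%:E) (u n),
          (fun n => cLnorm 2%:E (fun x => u n x - fg.1 x)) @ \oo --> 0%E &
          (fun n => cLnorm 2%:E (fun xi => fourier_int (u n) xi - fg.2 xi))
            @ \oo --> 0%E]]].

Definition Pop E : L2rel :=
  [set fg | [/\ cLfun 2%:E fg.1, cLfun 2%:E fg.2 &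
    {ae mu, forall x, fg.2 x = (\1_E x)%:C * fg.1 x}]].

Definition Qop F : L2rel := (fourier^-1 \; (Pop F \; fourier))%relation.

Definition opnorm (T : L2rel) : \bar R :=
  ereal_sup [set cLnorm 2%:E fg.2 | fg in
    T `&` [set fg | (cLnorm 2%:E fg.1 <= 1)%E]].

Definition lebesgue_measurable E : Prop :=
  (completed_algebra_gen mu).-sigma.-measurable E.

Definition rho (kappa x : R) : R :=
  if x == 0 then 1 else Num.min 1 (kappa / `|x|).

Definition Wolff_interval (kappa x : R) : set R :=
  `]x - rho kappa x, x + rho kappa x[%classic.

Definition Wolff_thin (eps kappa : R) E : Prop :=
  lebesgue_measurable E /\
  forall x, (completed_lebesgue_measure (E `&` Wolff_interval kappa x)
             <= (2 * eps * rho kappa x)%:E)%E.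

Definition Theta2 (kappa eps1 eps2 : R) : \bar R :=
  ereal_sup [set opnorm (Pop EF.1 \; Qop EF.2)%relation | EF in
    [set EF | Wolff_thin eps1 kappa EF.1 /\ Wolff_thin eps2 kappa EF.2]].

Definition Theta (kappa eps : R) : \bar R := Theta2 kappa eps eps.

Definition eps_c (kappa : R) : R :=
  sup [set eps | 0 < eps < 1 /\ (Theta kappa eps < 1)%E].

Definition Phi (a b : R) : R :=
  if a + b <= 1 then Num.sqrt (a * (1 - b)) + Num.sqrt (b * (1 - a)) else 1.

End FourierL2.

(* Main.v *)
(** Write C for the cosine transform, which on even real functions is the Fourier
    transform and its own inverse up to closure.  Replace E and F by periodic sets of
    very small period on successive annuli: by Fejer's lemma multiplication by 1_T then
    acts on a fixed function as multiplication by its density c, plus a remainder of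
    norm sqrt(c(1-c)) which oscillates so fast that its transform lives far from
    everything chosen before.  Starting from a bump f_0, set
      f_{i+1} = C((1_{T_i} - c_i) f_i) / sqrt(c_i(1-c_i)),
    cut off to the annulus that carries T_{i+1}, with T_i a layer of F (density b) for
    i even and of E (density a) for i odd.  The f_i are almost orthonormal, even after
    transforming, so 1_E and 1_F act on them like two free projections of traces a and
    b: the vectors C(1_F f_{2j}) and 1_E f_{2k+1} have norms sqrt b and sqrt a and a
    bidiagonal Gram matrix with entries a sqrt(b(1-b)) and b sqrt(a(1-a)).  Testing on
    the sums of n such vectors gives the norm
    sqrt(a(1-b)) + sqrt(b(1-a)) as n tends to infinity.

    Plancherel's theorem, which gives the upper bound 1, is obtained by Abel summation:
    the energy of the transform damped by exp(-a|xi|) is the average of the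
    autocorrelation against a Poisson kernel. *)

Require Import Defs.
From mathcomp Require Import all_boot all_order all_algebra.
From mathcomp Require Import complex.
From mathcomp Require Import all_classical all_reals all_analysis measurable_realfun.
From mathcomp Require Import ring lra.

Set Implicit Arguments.
Unset Strict Implicit.
Unset Printing Implicit Defensive.

Import Order.TTheory GRing.Theory Num.Theory.
Import numFieldNormedType.Exports.

Local Open Scope classical_set_scope.
Local Open Scope ring_scope.

(** * Integration over the real line *)

(** Thinness constrains all windows at once, yet kappa drops out: a layer lies in a bounded annulus,
    where [rho] is bounded below, and its period is chosen after the annulus, so that the window
    error is an arbitrarily small fraction of [rho]. That error has to fit into a positive slack;
    hence the construction uses densities a < eps1 and b < eps2, and the extremal values are reached
    by a limit at the very end. Layers of even index live on the frequency side, those of odd index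
    on the physical side. Only layers of equal parity need disjoint annuli, so f_{i+1} is pushed
    just past layer i-1. The error d tends to 0 with n fixed, and n to infinity afterwards. Error
    constants may therefore grow with n and degenerate as a density approaches 0 or 1. The limiting
    quotient for fixed n is (n a sqrt(b(1-b)) + (n-1) b sqrt(a(1-a))) / (n sqrt(a b)). Restricting
    to real even test functions makes the transform a real, symmetric isometry; complex functions
    matter only for the upper bound 1. *)

Section RealIntegral.
Variable R : realType.
Local Notation mu := (@lebesgue_measure R).
Implicit Types f g h : R -> R.

(* Both are locked so that unification never unfolds an integral. *)
Definition L1 f : Prop := locked (is_true (mu.-integrable setT (EFin \o f))).

Lemma L1P f : L1 f <-> mu.-integrable setT (EFin \o f).
Proof. by rewrite /L1 -lock. Qed.

Definition intg f : R := locked (\int[mu]_x f x).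

Lemma intgE f : intg f = \int[mu]_x f x.
Proof. by rewrite /intg -lock. Qed.

Lemma L1_meas f : L1 f -> measurable_fun setT f.
Proof. by move=> /L1P/measurable_int/measurable_EFinP. Qed.

Lemma EFin_intg f : L1 f -> (intg f)%:E = (\int[mu]_x (f x)%:E)%E.
Proof. by move=> /L1P fi; rewrite intgE /Rintegral fineK// integrable_fin_num. Qed.

Lemma L1_ext f g : f =1 g -> L1 f -> L1 g.
Proof. by move=> /funext ->. Qed.

Lemma intg_ext f g : f =1 g -> intg f = intg g.
Proof. by move=> /funext ->. Qed.

Lemma L1D f g : L1 f -> L1 g -> L1 (fun x => f x + g x).
Proof. by move=> /L1P fi /L1P gi; apply/L1P; exact: (integrableD _ fi gi). Qed.

Lemma L1B f g : L1 f -> L1 g -> L1 (fun x => f x - g x).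
Proof. by move=> /L1P fi /L1P gi; apply/L1P; exact: (integrableB _ fi gi). Qed.

Lemma L1Z k f : L1 f -> L1 (fun x => k * f x).
Proof. by move=> /L1P fi; apply/L1P; exact: (integrableZl _ k fi). Qed.

Lemma L10 : L1 (fun=> 0).
Proof. by apply/L1P; exact: integrable0. Qed.

Lemma L1_abs f : L1 f -> L1 (fun x => `|f x|).
Proof. by move=> /L1P fi; apply/L1P; exact: (integrable_norm fi). Qed.

Lemma L1_le f g : measurable_fun setT f -> (forall x, `|f x| <= g x) ->
  L1 g -> L1 f.
Proof.
move=> mf fg /L1P gi; apply/L1P; apply: le_integrable gi => //; first exact/measurable_EFinP.
by move=> x _ /=; rewrite lee_fin (le_trans (fg x))// ler_norm.
Qed.

Lemma L1Mb k f h : L1 f -> measurable_fun setT h -> (forall x, `|h x| <= k) ->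
  L1 (fun x => f x * h x).
Proof.
move=> fi mh hk; apply: (@L1_le _ (fun x => k * `|f x|)).
- by apply: measurable_funM => //; exact: L1_meas.
- by move=> x; rewrite normrM mulrC ler_wpM2r.
- exact/L1Z/L1_abs.
Qed.

Lemma intgD f g : L1 f -> L1 g -> intg (fun x => f x + g x) = intg f + intg g.
Proof. by move=> /L1P fi /L1P gi; rewrite !intgE RintegralD. Qed.

Lemma intgB f g : L1 f -> L1 g -> intg (fun x => f x - g x) = intg f - intg g.
Proof. by move=> /L1P fi /L1P gi; rewrite !intgE RintegralB. Qed.

Lemma intgZ k f : L1 f -> intg (fun x => k * f x) = k * intg f.
Proof. by move=> /L1P fi; rewrite !intgE RintegralZl. Qed.

Lemma intg0 : intg (fun=> 0) = 0.
Proof. by rewrite intgE Rintegral_cst// mul0r. Qed.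

Lemma intg_ge0 f : (forall x, 0 <= f x) -> 0 <= intg f.
Proof. by move=> f0; rewrite intgE; apply: Rintegral_ge0. Qed.

Lemma intg_le f g : L1 f -> L1 g -> (forall x, f x <= g x) -> intg f <= intg g.
Proof. by move=> /L1P fi /L1P gi fg; rewrite !intgE; apply: le_Rintegral. Qed.

Lemma intg_norm f : L1 f -> `|intg f| <= intg (fun x => `|f x|).
Proof. by move=> /L1P fi; rewrite !intgE; apply: le_normr_Rintegral. Qed.

Lemma intg_norm_le f g : L1 f -> L1 g -> (forall x, `|f x| <= g x) -> `|intg f| <= intg g.
Proof.
by move=> fi gi fg; apply: (le_trans (intg_norm fi)); apply: intg_le => //; exact: L1_abs.
Qed.

Lemma L1_sum (J : Type) (s : seq J) (F : J -> R -> R) :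
  (forall i, L1 (F i)) -> L1 (fun x => \sum_(i <- s) F i x).
Proof.
move=> Fi; elim: s => [|i s IH].
  by apply: L1_ext L10 => x; rewrite big_nil.
by apply: L1_ext (L1D (Fi i) IH) => x; rewrite big_cons.
Qed.

Lemma intg_sum (J : Type) (s : seq J) (F : J -> R -> R) :
  (forall i, L1 (F i)) -> intg (fun x => \sum_(i <- s) F i x) = \sum_(i <- s) intg (F i).
Proof.
move=> Fi; elim: s => [|i s IH].
  by rewrite big_nil -[RHS]intg0; apply: intg_ext => x; rewrite big_nil.
rewrite big_cons -IH -intgD//; last exact: L1_sum.
by apply: intg_ext => x; rewrite big_cons.
Qed.

Lemma L1_fin f : measurable_fun setT f -> (\int[mu]_x (`|f x|)%:E < +oo)%E -> L1 f.
Proof. by move=> mf fo; apply/L1P/integrableP; split => //; exact/measurable_EFinP. Qed.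

Lemma intg_dct (f_ : nat -> R -> R) f g :
  (forall n, measurable_fun setT (f_ n)) -> measurable_fun setT f ->
  {ae mu, forall x, f_ ^~ x @ \oo --> f x} ->
  L1 g -> (forall n x, `|f_ n x| <= g x) ->
  intg (f_ n) @[n --> \oo] --> intg f.
Proof.
move=> mf_ mf ff gi fg.
have [||||/= fi _ H] := @dominated_convergence _ _ _ mu setT measurableT
   (fun n => EFin \o f_ n) (EFin \o f) (EFin \o g) _ _ _ ((L1P g).1 gi) _.
- by move=> n; apply/measurable_EFinP; exact: mf_.
- by apply/measurable_EFinP; exact: mf.
- have [N [mN N0 NN]] := ff; exists N; split => // x /= Hx; apply: NN => /= h.
  by apply: Hx => _; apply/fine_cvgP; split => //=; exact: nearW.
- by apply/nearW => x n _ /=; rewrite lee_fin.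
have fi_ n : L1 (f_ n) by apply: L1_le (fg n) gi.
have {}fi : L1 f by apply/L1P.
move: H; rewrite -EFin_intg// => /fine_cvgP[_ /=].
by apply: cvg_trans; apply: near_eq_cvg; apply: nearW => n /=; rewrite intgE.
Qed.

Lemma measurable_affine (r t : R) : measurable_fun setT (fun x : R => r * x + t).
Proof. by apply: measurable_funD => //; exact: measurable_funM. Qed.

(** The push-forward of Lebesgue measure under x -> r x + t, multiplied by r, gives every half-open
    interval its length, so it is Lebesgue measure by uniqueness. *)
Lemma ge0_integral_affine (r t : R) (f : R -> \bar R) : 0 < r ->
  measurable_fun setT f -> (forall x, (0 <= f x)%E) ->
  (\int[mu]_x f x = r%:E * \int[mu]_x f (r * x + t)%R)%E.
Proof.
move=> r0 mf f0.
have mphi := measurable_affine r t.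
pose phi : R -> measurableTypeR R := fun x => r * x + t.
pose nu := mscale (NngNum (ltW r0)) (pushforward mu phi).
have munu A : measurable A -> mu A = nu mphi A.
  apply: lebesgue_measure_unique => _ [[a b]] _ <-.
  rewrite /nu /mscale /= /pushforward.
  rewrite [X in _ = (_ * mu X)%E](_ : _ = `](a - t) / r, (b - t) / r]%classic); last first.
    apply/seteqP; split => x; rewrite /phi /= !in_itv /=.
      by rewrite ltr_pdivrMr// ler_pdivlMr// ltrBlDr lerBrDr mulrC.
    by rewrite ltr_pdivrMr// ler_pdivlMr// ltrBlDr lerBrDr mulrC.
  rewrite !lebesgue_measure_itv /= !lte_fin ltr_pM2r ?invr_gt0// ltrD2r.
  case: ifPn => ab; last by rewrite mule0.
  rewrite -!EFinB -EFinM; congr (_%:E).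
  by field; rewrite gt_eqF.
transitivity (\int[nu mphi]_x f x)%E.
  by apply: eq_measure_integral => A mA _; exact: munu.
rewrite /nu ge0_integral_mscale//= ge0_integral_pushforward//.
Qed.

Lemma ge0_integral_opp (f : R -> \bar R) :
  measurable_fun setT f -> (forall x, (0 <= f x)%E) ->
  (\int[mu]_x f x = \int[mu]_x f (- x)%R)%E.
Proof.
move=> mf f0.
transitivity (\int[pushforward mu (-%R : _ -> measurableTypeR R)]_x f x)%E.
  apply: eq_measure_integral => A mA _; exact/esym/lebesgue_measureN.
by rewrite ge0_integral_pushforward.
Qed.

Lemma L1_affine (r t : R) f : 0 < r -> L1 f -> L1 (fun x => f (r * x + t)).
Proof.
move=> r0 /L1P/integrableP[mf]; rewrite (ge0_integral_affine t r0)//; last first.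
  exact: measurableT_comp.
move=> fo; apply: L1_fin.
  by apply: measurableT_comp (measurable_affine r t); exact/measurable_EFinP.
move: fo; set X := (X in (_ * X)%E) => fo.
rewrite ltNge leye_eq; apply: contraTN fo => /eqP Xy.
by rewrite /X Xy mulry gtr0_sg// mul1e.
Qed.

Lemma L1_opp f : L1 f -> L1 (fun x => f (- x)).
Proof.
move=> /L1P/integrableP[mf]; rewrite ge0_integral_opp//; last exact: measurableT_comp.
move=> fo; apply: L1_fin => //.
by apply: measurableT_comp; first exact/measurable_EFinP.
Qed.

Lemma L1_pos f : L1 f -> L1 f^\+.
Proof. by move=> /L1P fi; apply/L1P; exact: integrable_funrpos. Qed.

Lemma L1_neg f : L1 f -> L1 f^\-.
Proof. by move=> /L1P fi; apply/L1P; exact: integrable_funrneg. Qed.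

Lemma intg_posneg f : L1 f -> intg f = intg (f^\+) - intg (f^\-).
Proof.
move=> fi; rewrite -intgB.
- by apply: intg_ext => x; rewrite -[in LHS](funrposBneg f).
- exact: L1_pos.
- exact: L1_neg.
Qed.

Lemma intg_affine (r t : R) f : 0 < r -> L1 f -> intg (fun x => f (r * x + t)) = r^-1 * intg f.
Proof.
move=> r0 fi.
suff H g : (forall x, 0 <= g x) -> L1 g -> intg (fun x => g (r * x + t)) = r^-1 * intg g.
  have fa := L1_affine t r0 fi.
  have -> := intg_posneg fi; rewrite mulrBr -!H//; first last.
  - exact: L1_pos.
  - exact: L1_neg.
  by rewrite (intg_posneg fa).
move=> g0 gi; apply: EFin_inj; rewrite EFinM !EFin_intg//; last exact: L1_affine.
rewrite [in RHS](ge0_integral_affine t r0)//.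
  by rewrite muleA -EFinM mulVf ?gt_eqF// mul1e.
by apply/measurable_EFinP; exact: L1_meas.
Qed.

Lemma intg_opp f : L1 f -> intg (fun x => f (- x)) = intg f.
Proof.
move=> fi.
suff H g : (forall x, 0 <= g x) -> L1 g -> intg (fun x => g (- x)) = intg g.
  have fa := L1_opp fi.
  rewrite (intg_posneg fa) (intg_posneg fi) -(H f^\+)//; last exact: L1_pos.
  by rewrite -(H f^\-)//; exact: L1_neg.
move=> g0 gi; apply: EFin_inj; rewrite !EFin_intg//; last exact: L1_opp.
rewrite [in RHS]ge0_integral_opp//.
by apply/measurable_EFinP; exact: L1_meas.
Qed.

Lemma L1_translate t f : L1 f -> L1 (fun x => f (x + t)).
Proof.
by move=> /(L1_affine t ltr01); apply: L1_ext => x; rewrite mul1r.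
Qed.

Lemma intg_translate t f : L1 f -> intg (fun x => f (x + t)) = intg f.
Proof.
move=> /(intg_affine t ltr01); rewrite invr1 mul1r => <-.
by apply: intg_ext => x; rewrite mul1r.
Qed.

Lemma L1_itv (b0 b1 : bool) (u v : R) :
  L1 (\1_[set` Interval (BSide b0 u) (BSide b1 v)]).
Proof. by apply/L1P; exact: integrable_indic_itv. Qed.

End RealIntegral.

(** * Continuity of translation in L^1 *)

Section L1shift.
Variable R : realType.
Local Notation mu := (@lebesgue_measure R).
Implicit Types f g h phi : R -> R.

(** A continuous truncation: its product with a continuous function stays continuous and acquires
    the bounded support that [L1_shift_cts] requires. *)
Definition cutoff (N x : R) : R := Num.max 0 (Num.min 1 (N + 1 - `|x|)).

Lemma cutoff01 N x : 0 <= cutoff N x <= 1.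
Proof.
rewrite /cutoff; apply/andP; split; first by rewrite le_max lexx.
by rewrite ge_max ler01 ge_min lexx.
Qed.

Lemma cutoff_eq1 N x : `|x| <= N -> cutoff N x = 1.
Proof.
move=> xN; rewrite /cutoff.
have /min_idPl -> : 1 <= N + 1 - `|x| by lra.
by apply/max_idPr.
Qed.

Lemma cutoff_eq0 N x : N + 1 <= `|x| -> cutoff N x = 0.
Proof.
move=> xN; rewrite /cutoff.
have /min_idPr -> : N + 1 - `|x| <= 1 by lra.
by apply/max_idPl; lra.
Qed.

Lemma continuous_cutoff N : continuous (cutoff N).
Proof.
move=> x; rewrite /cutoff.
apply: (@continuous_max R R (fun=> 0) (fun x : R => Num.min 1 (N + 1 - `|x|))).
  exact: cvg_cst.
apply: (@continuous_min R R (fun=> 1) (fun x : R => N + 1 - `|x|)).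
  exact: cvg_cst.
by apply: continuousB; [exact: cvg_cst|exact: norm_continuous].
Qed.

Lemma cvg_shift_cts f x (t_ : nat -> R) : continuous f -> t_ @ \oo --> 0 ->
  (fun n => f (x + t_ n)) @ \oo --> f x.
Proof.
move=> cf t0; apply: (continuous_cvg _ (cf x)).
by rewrite -[X in _ --> X]addr0; apply: cvgD => //; exact: cvg_cst.
Qed.

Lemma L1_bounded_support f (M N : R) : measurable_fun setT f ->
  (forall x, `|f x| <= M) -> (forall x, N < `|x| -> f x = 0) -> L1 f.
Proof.
move=> mf fM f0.
have M0 : 0 <= M by apply: le_trans (fM 0).
apply: (@L1_le _ _ (fun x => M * \1_(`[- N, N]) x)) => //; last first.
  by apply: L1Z; apply: L1_itv.
move=> x; rewrite indicE; case: (boolP (x \in _)) => xN; first by rewrite mulr1.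
rewrite mulr0 f0 ?normr0// ltNge; apply: contra xN => xN.
by rewrite inE /= in_itv /= -ler_norml.
Qed.

(** By contradiction: failure yields shifts t_n -> 0 whose integrals all exceed e, whereas the
    integrands tend to 0 pointwise and, as |t_n| < 1, are dominated by a constant on a bounded
    interval. *)
Lemma L1_shift_cts f (N : R) : continuous f -> (forall x, N < `|x| -> f x = 0) ->
  forall e : R, 0 < e -> exists2 d : R, 0 < d &
    forall s : R, `|s| < d -> intg (fun x => `|f (x + s) - f x|) <= e.
Proof.
move=> cf f0 e e0.
have [M fM] : exists M : R, forall x, `|f x| <= M.
  have [|M [_ HM]] := @compact_bounded _ R (f @` `[- `|N|, `|N|]).
    apply: continuous_compact; last exact: segment_compact.
    exact: continuous_subspaceT.
  exists (`|M| + 1) => x; have [xN|xN] := leP `|x| `|N|.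
    apply: HM; first by rewrite ltr_pwDr// ler_norm.
    by exists x => //; rewrite /= in_itv /= -ler_norml.
  by rewrite f0 ?normr0// (le_lt_trans (ler_norm _) xN).
have mf : measurable_fun setT f by exact: continuous_measurable_fun.
have mfs s : measurable_fun setT (fun x : R => f (x + s)).
  by apply: measurableT_comp => //; exact: measurable_funD.
apply: contrapT => /forall2NP H.
have {}H n : exists s : R, `|s| < n.+1%:R^-1 /\ e < intg (fun x => `|f (x + s) - f x|).
  have [/negP|/existsNP[s /not_implyP[s1 /negP s2]]] := H (n.+1%:R^-1).
    by rewrite invr_gt0 ltr0Sn.
  by exists s; split => //; rewrite ltNge.
have {H}[t_ Ht] := choice H.
have t0 : t_ @ \oo --> 0.
  apply/cvgr0Pnorm_lt => k k0.
  have /cvgr0Pnorm_lt/(_ k k0) := @cvg_harmonic R.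
  apply: filterS => n; rewrite ger0_norm ?invr_ge0// => /(lt_trans _); apply.
  by have [] := Ht n.
pose G x := (M + M) * \1_(`[- (`|N| + 1), `|N| + 1]) x.
have : intg (fun x => `|f (x + t_ n) - f x|) @[n --> \oo] --> intg (fun=> 0 : R).
  apply: (@intg_dct _ _ _ G).
  - by move=> n; apply: measurableT_comp => //; exact: measurable_funB.
  - exact: measurable_cst.
  - apply/aeW => x; rewrite -[X in _ --> X](@normr0 _ R) -(subrr (f x)).
    apply: cvg_norm; apply: cvgB; last exact: cvg_cst.
    exact: cvg_shift_cts.
  - by apply: L1Z; apply: L1_itv.
  - move=> n x; rewrite normr_id /G indicE.
    case: (boolP (x \in _)) => xN.
      by rewrite mulr1 (le_trans (ler_normB _ _))// lerD.
    have {}xN : `|N| + 1 < `|x|.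
      by rewrite ltNge; apply: contra xN; rewrite inE /= in_itv /= ler_norml.
    have [tn _] := Ht n.
    have t1 : `|t_ n| < 1.
      by apply: (lt_le_trans tn); rewrite invf_le1// ler1n.
    have NN := ler_norm N.
    rewrite mulr0 !f0 ?subrr ?normr0//; first lra.
    have := lerB_normD x (t_ n); lra.
rewrite intg0 => /cvgr0Pnorm_lt/(_ e e0)[n _ /(_ n (leqnn n))] /=.
have [_] := Ht n; set J := intg _ => eJ; rewrite ger0_norm ?(ltW (lt_trans e0 eJ))//.
by move=> /(lt_trans eJ); rewrite ltxx.
Qed.

(** Approximation by [psi], continuous with bounded support. Of the five fifths of e, [f - psi]
    costs two (cutting the tail, approximating on the interval) and counts twice, translated and
    untranslated; the last fifth is the modulus of [psi]. *)
Lemma L1_shift f : L1 f ->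
  forall e : R, 0 < e -> exists2 d : R, 0 < d &
    forall s : R, `|s| < d -> intg (fun x => `|f (x + s) - f x|) <= e.
Proof.
move=> fi e e0.
have e5 : 0 < e / 5 by rewrite divr_gt0.
have mc N : measurable_fun setT (cutoff N).
  by apply: continuous_measurable_fun; exact: continuous_cutoff.
have [N HN] : exists N : nat, intg (fun x => `|f x| * (1 - cutoff N%:R x)) <= e / 5.
  have : intg (fun x => `|f x| * (1 - cutoff n%:R x)) @[n --> \oo] --> intg (fun=> 0 : R).
    apply: (@intg_dct _ _ _ (fun x => `|f x|)).
    - move=> n; apply: measurable_funM; last exact: measurable_funB.
      by apply: (@L1_meas _ (fun x => `|f x|)); exact: L1_abs.
    - exact: measurable_cst.
    - apply/aeW => x; apply: cvg_near_cst.
      near=> n; rewrite cutoff_eq1 ?subrr ?mulr0//.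
      by near: n; exact: nbhs_infty_ger.
    - exact: L1_abs.
    - move=> n x; have /andP[c0 c1] := cutoff01 n%:R x.
      rewrite normrM normr_id ler_piMr// ger0_norm; lra.
  rewrite intg0 => /cvgr0Pnorm_lt/(_ _ e5)[n _ /(_ n (leqnn n))] /= H.
  by exists n; apply/ltW/(le_lt_trans (ler_norm _) H).
pose E : set R := `[- (N%:R + 1), N%:R + 1]%classic.
have mE : measurable E by exact: measurable_itv.
have muE : (mu E < +oo)%E.
  by rewrite lebesgue_measure_itv /=; case: ifP => // _; rewrite -EFinB ltry.
have iEf : mu.-integrable E (EFin \o f) by apply: integrableS ((L1P f).1 fi).
have [g_ [cg gi Hg]] := approximation_continuous_integrable mE muE iEf.
have [g [cg' gi' Hg']] : exists g, [/\ continuous g, mu.-integrable E (EFin \o g) &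
   (\int[mu]_(z in E) `|(f z - g z)%:E| <= (e / 5)%:E)%E].
  have /fine_cvgP[fn /cvgr0Pnorm_lt/(_ _ e5) H] := Hg.
  have [n [fnn Hn]] := filter_ex (filterI fn H).
  exists (g_ n); split => //.
  by rewrite -[leLHS]fineK// lee_fin (le_trans (ler_norm _) (ltW _)).
pose psi x := g x * cutoff N%:R x.
have cpsi : continuous psi.
  by move=> x; apply: continuousM; [exact: cg'|exact: continuous_cutoff].
have psi0 x : N%:R + 1 < `|x| -> psi x = 0.
  by move=> xN; rewrite /psi cutoff_eq0 ?mulr0// ltW.
have [d d0 Hd] := L1_shift_cts cpsi psi0 e5.
have mpsi : measurable_fun setT psi by exact: continuous_measurable_fun.
have iE : L1 (fun x => `|f x - g x| * \1_E x).
  have /integrable_norm : mu.-integrable E (EFin \o (fun x => f x - g x)).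
    exact: (integrableB _ iEf gi').
  move=> /integrable_mkcond-/(_ mE) H; apply/L1P; move: H; congr integrable.
  by apply/funext => x /=; rewrite patchE indicE; case: ifPn; rewrite ?mulr1 ?mulr0.
have intgE : intg (fun x => `|f x - g x| * \1_E x) <= e / 5.
  rewrite -lee_fin EFin_intg//; apply: le_trans Hg'.
  rewrite [leRHS]integral_mkcond le_eqVlt; apply/orP; left; apply/eqP.
  apply: eq_integral => x _ /=.
  by rewrite patchE indicE; case: ifPn; rewrite ?mulr1 ?mulr0.
have ic : L1 (fun x => `|f x| * (1 - cutoff N%:R x)).
  apply: (@L1Mb _ 1); [exact: L1_abs|exact: measurable_funB|].
  by move=> x; have /andP[c0 c1] := cutoff01 N%:R x; rewrite ger0_norm; lra.
have fpsi x : `|f x - psi x| <= `|f x - g x| * \1_E x + `|f x| * (1 - cutoff N%:R x).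
  have /andP[c0 c1] := cutoff01 N%:R x.
  have -> : f x - psi x = (f x - g x) * cutoff N%:R x + f x * (1 - cutoff N%:R x).
    by rewrite /psi; ring.
  apply: (le_trans (ler_normD _ _)); rewrite !normrM; apply: lerD.
    apply: ler_wpM2l => //; rewrite ger0_norm// indicE.
    case: (boolP (x \in E)) => // xE; rewrite cutoff_eq0// leNgt.
    by apply: contra xE => /ltW; rewrite inE /E /= in_itv /= ler_norml.
  by rewrite ler_wpM2l// ger0_norm; lra.
have mfpsi : measurable_fun setT (fun x : R => f x - psi x).
  by apply: measurable_funB => //; exact: L1_meas.
have ifpsi : L1 (fun x => f x - psi x).
  by apply: (L1_le mfpsi fpsi); exact: L1D.
have Ifpsi : intg (fun x => `|f x - psi x|) <= e / 5 + e / 5.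
  apply: (@le_trans _ _ (intg (fun x => `|f x - g x| * \1_E x + `|f x| * (1 - cutoff N%:R x)))).
    by apply: intg_le => //; [exact: L1_abs|exact: L1D].
  by rewrite intgD// lerD.
have ipsi : L1 psi.
  by apply: L1_ext (L1B fi ifpsi) => x; ring.
exists d => // s sd.
pose D x := `|f x - psi x|.
have iD : L1 D by exact: L1_abs.
pose P x := `|psi (x + s) - psi x|.
have iP : L1 P by apply/L1_abs/L1B => //; exact: L1_translate.
apply: (@le_trans _ _ (intg (fun x => (D (x + s) + D x) + P x))).
  apply: intg_le.
  - by apply/L1_abs/L1B => //; exact: L1_translate.
  - by apply: L1D => //; apply: L1D => //; exact: L1_translate.
  - move=> x; have -> : f (x + s) - f x = (f (x + s) - psi (x + s)) - (f x - psi x) +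
      (psi (x + s) - psi x) by ring.
    apply: (le_trans (ler_normD _ _)); rewrite lerD2r.
    exact: (le_trans (ler_normB _ _)).
rewrite intgD//; last by apply: L1D => //; exact: L1_translate.
rewrite intgD//; last exact: L1_translate.
rewrite intg_translate//.
have := Hd s sd; rewrite -/P; rewrite -/D in Ifpsi; lra.
Unshelve. all: by end_near. Qed.

End L1shift.

(** * Fubini's theorem for iterated integrals *)

Section Fubini.
Variable R : realType.
Local Notation mu := (@lebesgue_measure R).
Implicit Types f g h phi : R -> R.

Lemma intg_fubini (F : R -> R -> R) (H : R -> R) :
  measurable_fun setT (fun z : R * R => F z.1 z.2) ->
  (forall y, L1 (F ^~ y)) ->
  (forall y, intg (fun x => `|F x y|) <= H y) -> L1 H ->
  (forall x, L1 (F x)) ->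
  [/\ L1 (fun x => intg (F x)), L1 (fun y => intg (F ^~ y)) &
      intg (fun x => intg (F x)) = intg (fun y => intg (F ^~ y))].
Proof.
move=> mF iy IH iH ix.
pose G (z : measurableTypeR R * measurableTypeR R) := (F z.1 z.2)%:E.
have mG : measurable_fun setT G by apply/measurable_EFinP; exact: mF.
have maG : measurable_fun setT (abse \o G).
  by apply: (measurableT_comp _ mG); exact: abse_measurable.
have iG : (mu \x mu)%E.-integrable setT G.
  apply/(integrable21ltyP mu mu mG).
  apply: (@le_lt_trans _ _ (\int[mu]_y (H y)%:E)%E); last first.
    by apply: integrable_lty => //; exact/L1P.
  apply: ge0_le_integral => //.
  - by move=> y _; apply: integral_ge0 => x _; exact: abse_ge0.
  - apply: (measurable_fun_fubini_tonelli_G (abse \o G)); [exact: maG|by move=> z; exact: abse_ge0].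
  - by apply/measurable_EFinP; exact: L1_meas.
  - move=> y _; rewrite /G /=.
    rewrite (_ : (\int[mu]_x _)%E = (intg (fun x => `|F x y|))%:E) ?lee_fin//.
    by rewrite EFin_intg//; exact: L1_abs.
have FE : (fun x => (intg (F x))%:E) = fubini_F mu G.
  by apply/funext => x; rewrite /fubini_F EFin_intg.
have GE : (fun y => (intg (F ^~ y))%:E) = fubini_G mu G.
  by apply/funext => x; rewrite /fubini_G EFin_intg.
have i1 : L1 (fun x => intg (F x)).
  by apply/L1P; rewrite /comp FE; exact: integrable_fubini_F.
have i2 : L1 (fun y => intg (F ^~ y)).
  apply: (L1_le _ _ iH) => [|y]; last exact: le_trans (intg_norm (iy y)) (IH y).
  apply/measurable_EFinP; rewrite /comp GE; exact: measurable_fubini_G iG.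
split; [exact: i1|exact: i2|].
apply: EFin_inj.
rewrite (EFin_intg i1) (EFin_intg i2).
rewrite FE GE.
have := Fubini iG.
rewrite /fubini_F /fubini_G.
exact.
Qed.

Lemma meas_fst (a : R -> R) : measurable_fun setT a ->
  measurable_fun setT (fun z : R * R => a z.1).
Proof. by move=> ma; apply: measurableT_comp ma _; exact: measurable_fst. Qed.

Lemma meas_snd (a : R -> R) : measurable_fun setT a ->
  measurable_fun setT (fun z : R * R => a z.2).
Proof. by move=> ma; apply: measurableT_comp ma _; exact: measurable_snd. Qed.

Lemma meas_comp2 (k : R -> R) (a : R * R -> R) : measurable_fun setT k ->
  measurable_fun setT a -> measurable_fun setT (fun z => k (a z)).
Proof. by move=> mk ma; apply: measurableT_comp. Qed.

Lemma intg_fubini_prod (k : R -> R -> R) (a b : R -> R) :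
  measurable_fun setT (fun z : R * R => k z.1 z.2) ->
  (forall x y, `|k x y| <= 1) -> L1 a -> L1 b ->
  [/\ L1 (fun x => intg (fun y => a x * k x y * b y)),
      L1 (fun y => intg (fun x => a x * k x y * b y)) &
      intg (fun x => intg (fun y => a x * k x y * b y)) =
      intg (fun y => intg (fun x => a x * k x y * b y))].
Proof.
move=> mk k1 ia ib.
have m1 x : measurable_fun setT (k x).
  by have := measurableT_comp mk (measurable_pair1 x).
have m2 y : measurable_fun setT (k ^~ y).
  by have := measurableT_comp mk (measurable_pair2 y).
have iy y : L1 (fun x => a x * k x y * b y).
  have := L1Z (b y) (L1Mb ia (m2 y) (k1 ^~ y)).
  by apply: L1_ext => x; rewrite mulrC.
apply: (@intg_fubini _ (fun y => intg (fun x => `|a x|) * `|b y|)) => //.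
- apply: measurable_funM; first apply: measurable_funM => //.
  + by apply: meas_fst; exact: L1_meas.
  + by apply: meas_snd; exact: L1_meas.
- move=> y; rewrite mulrC -intgZ; last exact: L1_abs.
  apply: intg_le; [exact: L1_abs|exact/L1Z/L1_abs|].
  move=> x; rewrite !normrM mulrC ler_wpM2l// ler_piMr//.
- exact/L1Z/L1_abs.
- move=> x; have := L1Z (a x) (L1Mb ib (m1 x) (k1 x)).
  by apply: L1_ext => y; ring.
Qed.

End Fubini.

(** * Fejer's lemma for periodic sets *)

Section Fejer.
Variable R : realType.
Implicit Types f g h phi q : R -> R.

Definition unit_itv : R -> R := \1_(`[0, 1[).

Lemma L1_unit_itv : L1 unit_itv.
Proof. exact: L1_itv. Qed.


Lemma unit_itvE t : unit_itv t = ((0 <= t < 1)%R%:R : R).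
Proof. by rewrite /unit_itv indicE; congr (_%:R); rewrite mem_setE in_itv. Qed.

Lemma indic_itvE (b0 b1 : bool) (u v t : R) :
  \1_[set` Interval (BSide b0 u) (BSide b1 v)] t =
  ((t \in Interval (BSide b0 u) (BSide b1 v))%:R : R).
Proof. by rewrite indicE mem_setE. Qed.

Lemma measurable_indic_itv (i : interval R) :
  measurable_fun setT (\1_[set` i] : R -> R).
Proof. exact: measurable_indic. Qed.

Lemma intg_itv (b0 b1 : bool) (u v : R) : u <= v ->
  intg (\1_[set` Interval (BSide b0 u) (BSide b1 v)]) = v - u.
Proof.
move=> uv; apply: EFin_inj; rewrite EFin_intg; last exact: L1_itv.
rewrite integral_indic//= setIT lebesgue_measure_itv /= lte_fin.
by move: uv; rewrite le_eqVlt => /predU1P[->|->]; rewrite ?ltxx ?subrr.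
Qed.

(** Averaging over the phase: [q (r * x + t)] has mean zero in t over a unit interval, while passing
    from q(r x) to q(r x + t) amounts to translating phi by t / r. The integral is thus an average
    over t in [0, 1) of integrals of (phi(x + t/r) - phi(x)) q(r x + t). Only the translation
    modulus of phi enters, which permits an explicit rate in [comb_density]. *)
Lemma fejer_bound phi q (r e : R) : 0 < r -> L1 phi ->
  measurable_fun setT q -> (forall x, `|q x| <= 1) ->
  (forall y, intg (fun t => q (y + t) * unit_itv t) = 0) ->
  (forall t : R, 0 <= t < 1 -> intg (fun x => `|phi (x + t / r) - phi x|) <= e) ->
  `|intg (fun x => phi x * q (r * x))| <= e.
Proof.
move=> r0 iphi mq q1 q0 He.
have mqa t : measurable_fun setT (fun x : R => q (r * x + t)).
  by apply: measurableT_comp mq _; exact: measurable_affine.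
have iu : L1 unit_itv := L1_unit_itv.
have mk : measurable_fun setT (fun z : R * R => q (r * z.1 + z.2)).
  apply: measurableT_comp mq _; apply: measurable_funD.
    exact: (meas_fst (measurable_funM (measurable_cst r) (@measurable_id _ _ _))).
  exact: measurable_snd.
have [_ iJ E] := intg_fubini_prod mk (fun x y => q1 (r * x + y)) iphi iu.
set J := fun t => _ in iJ E.
have J0 : intg J = 0.
  rewrite -E -[RHS](intg0 R); apply: intg_ext => x.
  rewrite (_ : (fun y => _) = (fun y => phi x * (q (r * x + y) * unit_itv y))).
    have iq : L1 (fun t => q (r * x + t) * unit_itv t).
      apply: L1_ext (L1Mb iu (_ : measurable_fun setT (fun t => q (r * x + t))) _) => [t||t].
      - exact: mulrC.
      - apply: measurableT_comp mq _; exact: measurable_funD.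
      - exact: q1.
    by rewrite (intgZ _ iq) (q0 (r * x)) (mulr0 (phi x)).
  by apply/funext => y; rewrite mulrA.
set K := intg _.
clear E.
have I1 : intg unit_itv = 1 by rewrite intg_itv// subr0.
have iKJ : L1 (fun t => K * unit_itv t - J t) by apply: L1B => //; exact: L1Z.
have EK : K = intg (fun t => K * unit_itv t - J t).
  by rewrite intgB ?J0 ?subr0 ?intgZ ?I1 ?mulr1//; exact: L1Z.
have Ee : e = intg (fun t => e * unit_itv t) by rewrite intgZ// I1 mulr1.
have iKe : L1 (fun t => e * unit_itv t) by exact: L1Z.
have KJ t : `|K * unit_itv t - J t| <= e * unit_itv t.
  rewrite /J /= unit_itvE; case: (boolP (0 <= t < 1)) => t01 /=; last first.
    have -> : intg (fun x => phi x * q (r * x + t) * 0%:R) = 0.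
      by rewrite -[RHS](intg0 R); apply: intg_ext => x; rewrite mulr0.
    by rewrite mulr0 mulr0 subr0 normr0.
  rewrite !mulr1; under intg_ext do rewrite mulr1.
  have -> : K = intg (fun x => phi (x + t / r) * q (r * x + t)).
    rewrite /K -(intg_translate (t / r)); last first.
      apply: (L1Mb iphi _ (fun x => q1 _)).
      by have := mqa 0; under eq_fun do rewrite addr0.
    by apply: intg_ext => x; congr (_ * q _); field; rewrite (gt_eqF r0).
  have iphis : L1 (fun x => phi (x + t / r)) by exact: L1_translate.
rewrite -intgB; last 2 first.
    exact: (L1Mb iphis (mqa t) (fun x => q1 _)).
    exact: (L1Mb iphi (mqa t) (fun x => q1 _)).
  apply: le_trans (He t t01); apply: intg_norm_le.
  - apply: L1B; first exact: (L1Mb iphis (mqa t) (fun x => q1 _)).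
    exact: (L1Mb iphi (mqa t) (fun x => q1 _)).
  - exact/L1_abs/L1B.
  - by move=> x; rewrite -mulrBl normrM ler_piMr.
rewrite EK [leRHS]Ee; exact: (intg_norm_le iKJ iKe KJ).
Qed.

Lemma fejer phi q e : L1 phi -> 0 < e ->
  measurable_fun setT q -> (forall x, `|q x| <= 1) ->
  (forall y, intg (fun t => q (y + t) * unit_itv t) = 0) ->
  \forall m \near \oo, `|intg (fun x => phi x * q (m.+1%:R * x))| <= e.
Proof.
move=> iphi e0 mq q1 q0.
have [d d0 Hd] := L1_shift iphi e0.
near=> m; apply: fejer_bound => // t /andP[t0 t1].
apply: Hd; rewrite ger0_norm ?divr_ge0// ltr_pdivrMr//.
apply: (lt_trans t1); rewrite mulrC -ltr_pdivrMr//.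
apply: (@lt_trans _ _ m%:R); last by rewrite ltr_nat.
by near: m; exact: nbhs_infty_gtr.
Unshelve. all: by end_near. Qed.

(** Up to an integer translation 0 <= y < 1; then [y, y + 1) is cut at 1 and the second piece is
    moved back by one period. *)
Lemma periodic_unit_integral q : measurable_fun setT q ->
  (forall x, `|q x| <= 1) -> (forall x, q (x + 1) = q x) ->
  forall y, intg (fun t => q (y + t) * unit_itv t) = intg (fun t => q t * unit_itv t).
Proof.
move=> mq q1 qp.
have qpn n x : q (x + n%:R) = q x.
  by elim: n => [|n IH]; rewrite ?addr0// -natr1 addrA qp IH.
have qpz (z : int) x : q (x + z%:~R) = q x.
  case: z => n; first exact: qpn.
  by rewrite NegzE mulrNz -(qpn n.+1 (x - _)) subrK.
have iq b0 b1 u v : L1 (fun t => q t * \1_[set` Interval (BSide b0 u) (BSide b1 v)] t).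
  by apply: L1_ext (L1Mb (L1_itv _ _ _ _) mq q1) => t; rewrite mulrC.
suff H y : 0 <= y < 1 ->
    intg (fun t => q (y + t) * unit_itv t) = intg (fun t => q t * unit_itv t).
  move=> y; pose z := Num.floor y.
  have zy : 0 <= y - z%:~R < 1.
    rewrite subr_ge0 floor_le_tmp// ltrBlDr addrC.
    by have := floorD1_gt y; rewrite intrD1.
  rewrite -(H _ zy); apply: intg_ext => t; congr (_ * _).
  by rewrite -(qpz z (y - z%:~R + t)); congr q; ring.
move=> /andP[y0 y1].
transitivity (intg (fun t => q t * \1_(`[y, y + 1[) t)).
  rewrite -(intg_translate y (iq _ _ _ _)); apply: intg_ext => t; rewrite addrC; congr (_ * _).
  rewrite ?unit_itvE !indic_itvE !in_itv /=; congr ((_ : bool)%:R); apply/idP/idP => /andP[? ?]; apply/andP; split; lra.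
transitivity (intg (fun t => q t * \1_(`[y, 1[) t) + intg (fun t => q t * \1_(`[1, y + 1[) t)).
  rewrite -intgD//; apply: intg_ext => t; rewrite -mulrDr; congr (_ * _).
  rewrite ?unit_itvE !indic_itvE !in_itv /=.
  case: (leP y t) => yt; case: (leP 1 t) => t1; case: (ltP t (y + 1)) => ty; rewrite ?addr0 ?add0r//; lra.
rewrite -(intg_translate 1 (iq _ _ 1 (y + 1))).
rewrite [X in _ + intg X](_ : _ = (fun t => q t * \1_(`[0, y[) t)); last first.
  apply/funext => t; rewrite qp; congr (_ * _).
  rewrite ?unit_itvE !indic_itvE !in_itv /=; congr ((_ : bool)%:R); apply/idP/idP => /andP[? ?]; apply/andP; split; lra.
rewrite -intgD//; apply: intg_ext => t; rewrite -mulrDr; congr (_ * _).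
rewrite ?unit_itvE !indic_itvE !in_itv /=.
case: (leP y t) => yt; case: (leP 0 t) => t0; case: (ltP t 1) => ty; rewrite ?addr0 ?add0r//; lra.
Qed.

(* The even 1-periodic set of density c. *)
Definition comb (c : R) : set R := [set x | cos (pi * c) < cos (2 * pi * x)].

Lemma measurable_comb c : measurable (comb c).
Proof.
rewrite /comb (_ : [set x | _] = setT `&` (fun x => cos (2 * pi * x)) @^-1` `]cos (pi * c), +oo[).
  have : measurable_fun setT (fun x : R => cos (2 * pi * x)).
    apply: continuous_measurable_fun => x.
    apply: (@continuous_comp _ _ _ (fun x => 2 * pi * x) cos); last exact: continuous_cos.
    exact: mulrl_continuous.
  by apply => //; exact: measurable_itv.
by rewrite setTI; apply/seteqP; split => x /=; rewrite in_itv /= andbT.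
Qed.

Definition combq c x : R := \1_(comb c) x - c.

Lemma indic_combE c x : \1_(comb c) x = (cos (pi * c) < cos (2 * pi * x))%R%:R :> R.
Proof. by rewrite indicE; congr (nat_of_bool _)%:R; apply/idP/idP; rewrite inE. Qed.

Lemma comb_oppE c x : \1_(comb c) (- x) = \1_(comb c) x :> R.
Proof. by rewrite !indic_combE mulrN cosN. Qed.

Lemma measurable_combq c : measurable_fun setT (combq c).
Proof. by apply: measurable_funB => //; apply: measurable_indic; exact: measurable_comb. Qed.

Lemma combq_le1 (c x : R) : 0 < c < 1 -> `|combq c x| <= 1.
Proof.
move=> /andP[c0 c1]; rewrite /combq indicE.
by case: (_ \in _); rewrite /= ler_norml; lra.
Qed.

Lemma combq_mean0 (c y : R) : 0 < c < 1 -> intg (fun t => combq c (y + t) * unit_itv t) = 0.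
Proof.
move=> c01; have /andP[c0 c1] := c01.
have per x : combq c (x + 1) = combq c x.
  rewrite /combq !indic_combE mulrDr mulr1.
  by rewrite (_ : 2 * pi = pi *+ 2) ?cosD2pi// mulr2n; ring.
have H := periodic_unit_integral (measurable_combq c) (fun x => combq_le1 x c01) per.
(* The period is started at -1/2, so that the argument of the cosine ranges over [-pi, pi): there
   the comb is the set |x| < c / 2, an interval of length c. *)
rewrite H -(H (- 2^-1)).
have iu : L1 unit_itv := L1_unit_itv.
pose J : R -> R := \1_(`](1 - c) / 2, (1 + c) / 2[).
have iJ : L1 J by exact: L1_itv.
transitivity (intg (fun t => J t - c * unit_itv t)); last first.
  rewrite intgB//; last exact: L1Z.
  rewrite intgZ// !intg_itv//; lra.
apply: intg_ext => t; rewrite unit_itvE /combq mulrBl; congr (_ - _).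
rewrite /J indic_itvE in_itv /=; case: (boolP (0 <= t < 1)) => t01; last first.
  rewrite mulr0 (_ : (_ < t < _) = false)//; apply/negP => /andP[ta tb]; case/negP: t01; apply/andP; split; lra.
have /andP[t0 t1] := t01.
rewrite mulr1 indic_combE -(cos_norm (2 * pi * _)).
have pi0 := @pi_gt0 R.
have n1 : `|- 2^-1 + t| <= 2^-1 by rewrite ler_norml; apply/andP; split; lra.
have pi2 : 0 <= 2 * pi :> R by rewrite mulr_ge0// ltW.
rewrite ltr_cos ?in_itv/=; last 2 first.
- rewrite normr_ge0 /= normrM (ger0_norm pi2).
  by have := ler_wpM2l pi2 n1; lra.
- by rewrite mulr_ge0 ?(ltW pi0) ?(ltW c0)//= ler_piMr ?ltW.
rewrite normrM (ger0_norm pi2) mulrAC [pi * c]mulrC ltr_pM2r//.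
rewrite mulrC -ltr_pdivlMr// ltr_norml.
by congr ((_ : bool)%:R); apply/idP/idP; move=> /andP[? ?]; apply/andP; split; lra.
Qed.

End Fejer.

(** * Square integrable functions and oscillatory transforms *)

Section L2.
Variable R : realType.
Implicit Types f g h u v : R -> R.

Definition L2 f : Prop := measurable_fun setT f /\ L1 (fun x => f x ^+ 2).

Definition ip f g : R := intg (fun x => f x * g x).

Lemma ipxx f : ip f f = intg (fun x => f x ^+ 2).
Proof. by []. Qed.

Lemma ip_ge0 f : 0 <= ip f f.
Proof. by apply: intg_ge0 => x; rewrite -expr2 sqr_ge0. Qed.

Lemma ipC f g : ip f g = ip g f.
Proof. by apply: intg_ext => x; rewrite mulrC. Qed.

Lemma L2_mul f g : L2 f -> L2 g -> L1 (fun x => f x * g x).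
Proof.
move=> [mf f2] [mg g2]; apply: (@L1_le _ _ (fun x => f x ^+ 2 + g x ^+ 2)).
- exact: measurable_funM.
- move=> x; have h1 := sqr_ge0 (f x - g x); have h2 := sqr_ge0 (f x + g x).
  rewrite ler_norml; apply/andP; split; nra.
- exact: L1D.
Qed.

Lemma L2_ext f g : f =1 g -> L2 f -> L2 g.
Proof. by move=> /funext ->. Qed.

Lemma L2_le f g : measurable_fun setT f -> (forall x, `|f x| <= `|g x|) -> L2 g -> L2 f.
Proof.
move=> mf fg [mg g2]; split => //; apply: (L1_le _ _ g2).
  exact: measurable_funX.
by move=> x; rewrite normrX -(real_normK (num_real (g x))) lerXn2r ?nnegrE.
Qed.

Lemma L2D f g : L2 f -> L2 g -> L2 (fun x => f x + g x).
Proof.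
move=> lf lg; split; first by apply: measurable_funD; case: lf lg => ? _ [].
have fg := L2_mul lf lg; case: lf lg => [mf f2] [mg g2].
by apply: L1_ext (L1D (L1D f2 g2) (L1Z 2 fg)) => x; ring.
Qed.

Lemma L2Z k f : L2 f -> L2 (fun x => k * f x).
Proof.
move=> [mf f2]; split; first exact: measurable_funM.
by apply: L1_ext (L1Z (k ^+ 2) f2) => x; ring.
Qed.

Lemma L2B f g : L2 f -> L2 g -> L2 (fun x => f x - g x).
Proof.
move=> lf /(L2Z (-1)) lg; apply: L2_ext (L2D lf lg) => x; ring.
Qed.

Lemma L20 : L2 (fun=> 0).
Proof.
split; first exact: measurable_cst.
by apply: L1_ext (L10 R) => x; rewrite expr0n.
Qed.

Lemma L2_sum (J : Type) (s : seq J) (F : J -> R -> R) :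
  (forall i, L2 (F i)) -> L2 (fun x => \sum_(i <- s) F i x).
Proof.
move=> Fi; elim: s => [|i s IH].
  by apply: L2_ext L20 => x; rewrite big_nil.
by apply: L2_ext (L2D (Fi i) IH) => x; rewrite big_cons.
Qed.

Lemma L2Mb k f h : L2 f -> measurable_fun setT h -> (forall x, `|h x| <= k) ->
  L2 (fun x => f x * h x).
Proof.
move=> /[dup] -[mf _] /(L2Z k) lf mh hk; apply: L2_le lf; first exact: measurable_funM.
by move=> x; rewrite !normrM mulrC ler_wpM2r// (le_trans (hk x))// ler_norm.
Qed.

Lemma ipDl f g h : L2 f -> L2 g -> L2 h ->
  ip (fun x => f x + g x) h = ip f h + ip g h.
Proof.
move=> lf lg lh; rewrite /ip -intgD; [|exact: L2_mul|exact: L2_mul].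
by apply: intg_ext => x; rewrite mulrDl.
Qed.

Lemma ipBl f g h : L2 f -> L2 g -> L2 h ->
  ip (fun x => f x - g x) h = ip f h - ip g h.
Proof.
move=> lf lg lh; rewrite /ip -intgB; [|exact: L2_mul|exact: L2_mul].
by apply: intg_ext => x; rewrite mulrBl.
Qed.

Lemma ipZl k f h : L2 f -> L2 h -> ip (fun x => k * f x) h = k * ip f h.
Proof.
move=> lf lh; rewrite /ip -intgZ; last exact: L2_mul.
by apply: intg_ext => x; rewrite mulrA.
Qed.

Lemma ip_suml (J : Type) (s : seq J) (F : J -> R -> R) h :
  (forall i, L2 (F i)) -> L2 h ->
  ip (fun x => \sum_(i <- s) F i x) h = \sum_(i <- s) ip (F i) h.
Proof.
move=> lF lh; rewrite /ip -intg_sum; last by move=> i; exact: L2_mul.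
by apply: intg_ext => x; rewrite mulr_suml.
Qed.

Lemma ipDr f g h : L2 f -> L2 g -> L2 h ->
  ip h (fun x => f x + g x) = ip h f + ip h g.
Proof. by move=> lf lg lh; rewrite ipC ipDl// !(ipC h). Qed.

Lemma ipBr f g h : L2 f -> L2 g -> L2 h ->
  ip h (fun x => f x - g x) = ip h f - ip h g.
Proof. by move=> lf lg lh; rewrite ipC ipBl// !(ipC h). Qed.

Lemma ipZr k f h : L2 f -> L2 h -> ip h (fun x => k * f x) = k * ip h f.
Proof. by move=> lf lh; rewrite ipC ipZl// ipC. Qed.

Lemma ip_sumr (J : Type) (s : seq J) (F : J -> R -> R) h :
  (forall i, L2 (F i)) -> L2 h ->
  ip h (fun x => \sum_(i <- s) F i x) = \sum_(i <- s) ip h (F i).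
Proof.
by move=> lF lh; rewrite ipC ip_suml//; apply: eq_bigr => i _; rewrite ipC.
Qed.

Lemma ipBB f g : L2 f -> L2 g ->
  ip (fun x => f x - g x) (fun x => f x - g x) = ip f f - 2 * ip f g + ip g g.
Proof.
move=> lf lg; have lfg := L2B lf lg.
rewrite ipBl// !ipBr// (ipC g f); ring.
Qed.

Lemma cauchy_schwarz f g : L2 f -> L2 g -> ip f g ^+ 2 <= ip f f * ip g g.
Proof.
move=> lf lg.
have key (s t : R) : 0 <= s ^+ 2 * ip f f - 2 * s * t * ip f g + t ^+ 2 * ip g g.
  have ls := L2Z s lf; have lt := L2Z t lg.
  suff -> : s ^+ 2 * ip f f - 2 * s * t * ip f g + t ^+ 2 * ip g g =
    ip (fun x => s * f x - t * g x) (fun x => s * f x - t * g x) by exact: ip_ge0.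
  rewrite ipBB// !ipZl// !ipZr//; ring.
have a0 := ip_ge0 f; have b0 := ip_ge0 g.
(* If g has norm zero, the coefficients (ip f g, ip f f + 1) turn the form into -(ip f f + 2) (ip f
   g)^2, which forces ip f g = 0; otherwise (ip g g, ip f g) gives the discriminant. *)
have [B0|B0] := eqVneq (ip g g) 0.
  have h1 := key (ip f g) (ip f f + 1); rewrite B0 in h1 *.
  have := sqr_ge0 (ip f g); nra.
have h2 := key (ip g g) (ip f g).
have b1 : 0 < ip g g by rewrite lt_def B0.
rewrite -subr_ge0 -(pmulr_rge0 _ b1); move: h2; congr (0 <= _); ring.
Qed.

Lemma ip_norm_le f g : L2 f -> L2 g -> `|ip f g| <= Num.sqrt (ip f f) * Num.sqrt (ip g g).
Proof.
move=> lf lg; rewrite -sqrtrM ?ip_ge0// -sqrtr_sqr ler_sqrt ?mulr_ge0 ?ip_ge0//.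
exact: cauchy_schwarz.
Qed.

End L2.

(** * Cosine and sine transforms of integrable functions *)

Section Transform.
Variable R : realType.
Variable k : R -> R.
Hypothesis ck : continuous k.
Hypothesis k1 : forall x, `|k x| <= 1.
Implicit Types f g h u v : R -> R.

(** The kernel is a parameter so that cosine and sine, both continuous and bounded by 1, share one
    theory. *)
Definition osc u (xi : R) : R := intg (fun x => u x * k (2 * pi * x * xi)).

Lemma measurable_kernel1 xi : measurable_fun setT (fun x : R => k (2 * pi * x * xi)).
Proof.
apply: continuous_measurable_fun => x.
apply: (@continuous_comp _ _ _ (fun x : R => 2 * pi * x * xi) k); last exact: ck.
apply: continuousM; last exact: cvg_cst.
exact: mulrl_continuous.
Qed.

Lemma measurable_kernel : measurable_fun setT (fun z : R * R => k (2 * pi * z.1 * z.2)).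
Proof.
apply: meas_comp2; first exact: continuous_measurable_fun.
apply: measurable_funM; last exact: measurable_snd.
apply: measurable_funM; last exact: measurable_fst.
exact: measurable_cst.
Qed.

Lemma L1_osc u xi : L1 u -> L1 (fun x => u x * k (2 * pi * x * xi)).
Proof. by move=> iu; apply: (L1Mb iu (measurable_kernel1 xi) (fun x => k1 _)). Qed.

Lemma osc_bound u xi : L1 u -> `|osc u xi| <= intg (fun x => `|u x|).
Proof.
move=> iu; apply: intg_norm_le; [exact: L1_osc|exact: L1_abs|].
by move=> x; rewrite normrM ler_piMr.
Qed.

Lemma oscD u v xi : L1 u -> L1 v -> osc (fun x => u x + v x) xi = osc u xi + osc v xi.
Proof.
move=> iu iv; rewrite /osc -intgD; [|exact: L1_osc|exact: L1_osc].
by apply: intg_ext => x; rewrite mulrDl.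
Qed.

Lemma oscB u v xi : L1 u -> L1 v -> osc (fun x => u x - v x) xi = osc u xi - osc v xi.
Proof.
move=> iu iv; rewrite /osc -intgB; [|exact: L1_osc|exact: L1_osc].
by apply: intg_ext => x; rewrite mulrBl.
Qed.

Lemma oscZ c u xi : L1 u -> osc (fun x => c * u x) xi = c * osc u xi.
Proof.
move=> iu; rewrite /osc -intgZ; last exact: L1_osc.
by apply: intg_ext => x; rewrite mulrA.
Qed.

Lemma continuous_osc u : L1 u -> continuous (osc u).
Proof.
move=> iu xi; apply/(@cvg_nbhsP _ R^o) => t_ txi.
apply: (@intg_dct _ _ _ (fun x => `|u x|)).
- by move=> n; exact: (L1_meas (L1_osc (t_ n) iu)).
- exact: (L1_meas (L1_osc xi iu)).
- apply/aeW => x; apply: cvgM; first exact: cvg_cst.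
  have H : (fun n => 2 * pi * x * t_ n) @ \oo --> 2 * pi * x * (xi : R).
    by apply: cvgM => //; exact: cvg_cst.
  by apply: cvg_comp H _; exact: ck.
- exact: L1_abs.
- by move=> n x; rewrite normrM ler_piMr.
Qed.

Lemma measurable_osc u : L1 u -> measurable_fun setT (osc u).
Proof. by move=> iu; apply: continuous_measurable_fun; exact: continuous_osc. Qed.

(** Fubini: the kernel is bounded, and symmetric in x and xi. *)
Lemma ip_osc u v : L1 u -> L1 v -> ip (osc u) v = ip u (osc v).
Proof.
move=> iu iv.
have [_ _ E] := intg_fubini_prod measurable_kernel (fun x y => k1 (2 * pi * x * y)) iu iv.
rewrite /ip -[RHS](_ : intg (fun x => intg (fun y => u x * k (2 * pi * x * y) * v y)) = _).
  rewrite E; apply: intg_ext => y; rewrite mulrC /osc -intgZ; last exact: L1_osc.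
  by apply: intg_ext => x; rewrite mulrC.
apply: intg_ext => x; rewrite /osc -intgZ; last exact: L1_osc.
by apply: intg_ext => y; rewrite -mulrA mulrAC [v y * _]mulrC mulrA mulrAC.
Qed.

End Transform.

(** * Plancherel's theorem by Abel summation *)

Section Poisson.
Variable R : realType.
Local Notation mu := (@lebesgue_measure R).

(** The integrand carries 1 + cos rather than cos in order to be nonnegative, as the improper
    integral by antiderivatives requires. The cosine alone is recovered in [intg_expw_cos] by
    subtracting the pure exponential, which is half the case b = 0. *)
Lemma derive_poisson (a b x : R) : a != 0 -> a ^+ 2 + b ^+ 2 != 0 ->
  is_derive x 1 (fun x : R => - a^-1 * expR (- (a * x)) +
      (a ^+ 2 + b ^+ 2)^-1 * (expR (- (a * x)) * (b * sin (b * x) - a * cos (b * x))))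
    ((1 + cos (b * x)) * expR (- (a * x))).
Proof.
move=> a0 ab0.
have da : is_derive x 1 (fun x : R => - (a * x)) (- a).
  by apply: is_derive_eq; rewrite /GRing.scale/= mulr1.
have db : is_derive x 1 (fun x : R => b * x) b.
  by apply: is_derive_eq; rewrite /GRing.scale/= mulr1.
have de : is_derive x 1 (fun x : R => expR (- (a * x))) (expR (- (a * x)) * - a).
  by apply: is_derive_eq; rewrite /GRing.scale/=.
have dsn : is_derive x 1 (fun x : R => sin (b * x)) (cos (b * x) * b).
  by apply: is_derive_eq; rewrite /GRing.scale/=.
have dc : is_derive x 1 (fun x : R => cos (b * x)) (- sin (b * x) * b).
  by apply: is_derive_eq; rewrite /GRing.scale/=.
apply: is_derive_eq; rewrite /GRing.scale/=.
by field; rewrite ab0.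
Qed.


Lemma expR_decay (a : R) : 0 < a -> expR (- (a * x)) @[x --> +oo] --> (0 : R).
Proof.
move=> a0; have H : (fun x : R => a * x) @ +oo --> +oo.
  apply/cvgryPge => A; apply: filterS (nbhs_pinfty_ge (num_real (A / a))) => x.
  by rewrite ler_pdivrMr// mulrC.
exact: (@cvg_comp _ _ _ (fun x : R => a * x) (fun y : R => expR (- y)) _ _ _ H (@cvgr_expR R)).
Qed.

Lemma cvg_poisson (a b : R) : 0 < a ->
  (- a^-1 * expR (- (a * x)) +
      (a ^+ 2 + b ^+ 2)^-1 * (expR (- (a * x)) * (b * sin (b * x) - a * cos (b * x))))
    @[x --> +oo] --> (0 : R).
Proof.
move=> a0.
rewrite -[X in _ --> X](addr0 0); apply: cvgD.
  rewrite -(mulr0 (- a^-1)); apply: cvgM; [exact: cvg_cst|exact: expR_decay].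
rewrite -(mulr0 (a ^+ 2 + b ^+ 2)^-1); apply: cvgM; first exact: cvg_cst.
pose M := `|b| + `|a|.
have M0 : (fun x : R => M * expR (- (a * x))) @ +oo --> 0.
  by rewrite -(mulr0 M); apply: cvgM; [exact: cvg_cst|exact: expR_decay].
apply: (@squeeze_cvgr _ _ _ _ (fun x : R => - (M * expR (- (a * x)))) (fun x : R => M * expR (- (a * x)))).
- apply: nearW => x; rewrite -ler_norml normrM ger0_norm ?expR_ge0// mulrC.
  apply: ler_wpM2r; first exact: expR_ge0.
  apply: (le_trans (ler_normB _ _)); rewrite !normrM /M.
  by apply: lerD; rewrite ler_piMr// ?sin_max ?cos_max.
- by rewrite -oppr0; exact: cvgN.
- exact: M0.
Qed.

Definition expw (a x : R) : R := expR (- (a * `|x|)).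

Lemma continuous_expw a : continuous (expw a).
Proof.
move=> x; apply: (@continuous_comp _ _ _ (fun x : R => - (a * `|x|)) expR); last exact: continuous_expR.
apply: continuousN; apply: continuousM; first exact: cvg_cst.
exact: norm_continuous.
Qed.

Lemma continuous_cosM (b : R) : continuous (fun x : R => cos (b * x)).
Proof.
move=> x; apply: (@continuous_comp _ _ _ (fun x : R => b * x) cos); last exact: continuous_cos.
exact: mulrl_continuous.
Qed.

Lemma integral_expw_cos1 (a b : R) : 0 < a ->
  L1 (fun x => (1 + cos (b * x)) * expw a x) /\
  intg (fun x => (1 + cos (b * x)) * expw a x) = 2 * (a^-1 + a / (a ^+ 2 + b ^+ 2)).
Proof.
move=> a0; set f := fun x => _.
have f0 x : 0 <= f x.
  by apply: mulr_ge0; [have := cos_geN1 (b * x); lra|exact: expR_ge0].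
have cf : continuous f.
  move=> x; apply: (@continuousM R R (fun x : R => 1 + cos (b * x)) (expw a)); last exact: continuous_expw.
  apply: (@continuousD R R R (fun=> 1) (fun x : R => cos (b * x))); first exact: cvg_cst.
  exact: continuous_cosM.
have mf : measurable_fun setT f by exact: continuous_measurable_fun.
have fe x : f x = (f \o -%R) x.
  by rewrite /f /expw /= mulrN cosN normrN.
have an0 : a != 0 by rewrite gt_eqF.
have ab0 : a ^+ 2 + b ^+ 2 != 0.
  by rewrite gt_eqF// ltr_wpDr ?sqr_ge0// exprn_gt0.
pose F : R -> R := (fun x : R => - a^-1 * expR (- (a * x)) +
      (a ^+ 2 + b ^+ 2)^-1 * (expR (- (a * x)) * (b * sin (b * x) - a * cos (b * x)))).
have dF (x : R) : is_derive x 1 F ((1 + cos (b * x)) * expR (- (a * x))).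
  exact: derive_poisson.
have E : (\int[mu]_x (f x)%:E = (2 * (a^-1 + a / (a ^+ 2 + b ^+ 2)))%:E)%E.
  rewrite (ge0_symfun_integralT f0 cf fe) EFinM; congr (_ * _)%E.
  rewrite -set_itvcy (@ge0_continuous_FTC2y _ f F 0 0).
  - rewrite /F !mulr0 oppr0 expR0 sin0 cos0 sub0e -EFinN; congr EFin; field; by rewrite ab0.
  - by [].
  - exact: continuous_subspaceT.
  - exact: cvg_poisson.
  - by move=> x _; have [] := dF x.
  - apply: cvg_at_right_filter; apply: differentiable_continuous.
    by apply/derivable1_diffP; have [] := dF 0.
  - move=> x; rewrite in_itv /= andbT => x0; rewrite derive1E; have [_ ->] := dF x.
    by rewrite /f /expw gtr0_norm.
have L : L1 f.
  apply: L1_fin => //; under eq_integral do rewrite ger0_norm//.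
  by rewrite E ltry.
by split => //; apply: EFin_inj; rewrite EFin_intg.
Qed.

Lemma L1_expw a : 0 < a -> L1 (expw a).
Proof.
move=> a0; have [/(L1Z 2^-1) L _] := integral_expw_cos1 0 a0.
by apply: L1_ext L => x; rewrite mul0r cos0; field.
Qed.

Lemma intg_expw a : 0 < a -> intg (expw a) = 2 / a.
Proof.
move=> a0; have [L E] := integral_expw_cos1 0 a0.
have an0 : a != 0 by rewrite gt_eqF.
rewrite (_ : expw a = fun x => 2^-1 * ((1 + cos (0 * x)) * expw a x)).
  rewrite intgZ// E expr0n addr0; field; by rewrite ?an0 ?ab0.
by apply/funext => x; rewrite mul0r cos0; field.
Qed.

Lemma L1_expw_cos a b : 0 < a -> L1 (fun x => expw a x * cos (b * x)).
Proof.
move=> a0; apply: (L1Mb (k := 1)) (L1_expw a0) _ _.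
  by apply: continuous_measurable_fun; exact: continuous_cosM.
by move=> x; exact: cos_max.
Qed.

Lemma intg_expw_cos a b : 0 < a ->
  intg (fun x => expw a x * cos (b * x)) = 2 * a / (a ^+ 2 + b ^+ 2).
Proof.
move=> a0; have [L E] := integral_expw_cos1 b a0.
have an0 : a != 0 by rewrite gt_eqF.
have ab0 : a ^+ 2 + b ^+ 2 != 0.
  by rewrite gt_eqF// ltr_wpDr ?sqr_ge0// exprn_gt0.
rewrite (_ : (fun x => _) = fun x => ((1 + cos (b * x)) * expw a x) - expw a x).
  rewrite (intgB L (L1_expw a0)) E intg_expw//; field; by rewrite ?an0 ?ab0.
by apply/funext => x; ring.
Qed.

(** The standard Cauchy law, of which every Poisson kernel is a dilate ([poisson_scale]). *)
Definition cauchy_density (s : R) : R := (pi * (1 + s ^+ 2))^-1.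

Lemma cauchy_density_ge0 s : 0 <= cauchy_density s.
Proof. by rewrite invr_ge0 mulr_ge0 ?pi_ge0// addr_ge0 ?sqr_ge0. Qed.

Lemma cauchy_densityP : L1 cauchy_density /\ intg cauchy_density = 1.
Proof.
have piN0 : pi != 0 :> R by rewrite gt_eqF// pi_gt0.
pose f (x : R) : R := (oneDsqr x)^-1.
have f0 x : 0 <= f x by rewrite invr_ge0 /oneDsqr addr_ge0 ?sqr_ge0.
have cf : continuous f by exact: continuous_oneDsqrV.
have mf : measurable_fun setT f by exact: continuous_measurable_fun.
have fe x : f x = (f \o -%R) x by rewrite /f /oneDsqr /= sqrrN.
have E : (\int[mu]_x (f x)%:E = pi%:E)%E.
  rewrite (ge0_symfun_integralT f0 cf fe) -set_itvcy integral0y_oneDsqr -EFinM.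
  by congr EFin; field.
have L : L1 f.
  apply: L1_fin => //; under eq_integral do rewrite ger0_norm//.
  by rewrite E ltry.
have If : intg f = pi by apply: EFin_inj; rewrite EFin_intg.
have -> : cauchy_density = fun x => pi^-1 * f x.
  by apply/funext => x; rewrite /cauchy_density /f /oneDsqr invfM.
split; first exact: L1Z.
by rewrite intgZ// If mulVf.
Qed.

End Poisson.

(** * Autocorrelation, damped energy and Plancherel's theorem *)

Section Plancherel.
Variable R : realType.
Local Notation mu := (@lebesgue_measure R).
Implicit Types u v : R -> R.

Local Notation C := (osc (@cos R)).
Local Notation S := (osc (@sin R)).

Lemma L2_translate t u : L2 u -> L2 (fun x => u (x + t)).
Proof.
move=> [mu_ u2]; split; last exact: (L1_translate t u2).
by apply: measurableT_comp => //; exact: measurable_funD.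
Qed.

Lemma sqrB_ge0_le (a b : R) : 0 <= a -> 0 <= b -> (a - b) ^+ 2 <= `|a ^+ 2 - b ^+ 2|.
Proof.
move=> a0 b0; rewrite subr_sqr normrM -real_normK ?num_real// expr2.
by apply: ler_wpM2l => //; rewrite [leRHS]ger0_norm ?addr_ge0// ler_norml; lra.
Qed.

(* On nonnegative functions |a - b|^2 <= |a^2 - b^2|, so that the L^2 modulus of
   continuity is controlled by the L^1 modulus of the square. *)
Lemma L2_shift u : L2 u -> forall e : R, 0 < e -> exists2 d : R, 0 < d &
  forall s : R, `|s| < d -> intg (fun x => (u (x + s) - u x) ^+ 2) <= e.
Proof.
move=> [mf u2] e e0.
pose p x := (`|u x| + u x) / 2; pose n x := (`|u x| - u x) / 2.
have p0 x : 0 <= p x by have := ler_norm (- u x); rewrite normrN /p; lra.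
have n0 x : 0 <= n x by have := ler_norm (u x); rewrite /n; lra.
have mabs : measurable_fun setT (fun x : R => `|u x|) by exact: measurableT_comp.
have mp : measurable_fun setT p.
  by apply: measurable_funM => //; exact: measurable_funD.
have mn : measurable_fun setT n.
  by apply: measurable_funM => //; exact: measurable_funB.
have p2 : L1 (fun x => p x ^+ 2).
  apply: (L1_le _ _ u2) => [|x]; first exact: measurable_funX.
  rewrite ger0_norm ?sqr_ge0// -(real_normK (num_real (u x))) lerXn2r ?nnegrE//.
  by have := ler_norm (u x); rewrite /p; lra.
have n2 : L1 (fun x => n x ^+ 2).
  apply: (L1_le _ _ u2) => [|x]; first exact: measurable_funX.
  rewrite ger0_norm ?sqr_ge0// -(real_normK (num_real (u x))) lerXn2r ?nnegrE//.
  by have := ler_norm (- u x); rewrite normrN /n; lra.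
have e4 : 0 < e / 4 by lra.
have [d1 d10 H1] := L1_shift p2 e4; have [d2 d20 H2] := L1_shift n2 e4.
exists (Num.min d1 d2); first by rewrite lt_min d10.
move=> s; rewrite lt_min => /andP[s1 s2].
have {}H1 := H1 s s1; have {}H2 := H2 s s2.
have i1 : L1 (fun x => `|p (x + s) ^+ 2 - p x ^+ 2|).
  by apply: L1_abs; apply: L1B => //; exact: (L1_translate s p2).
have i2 : L1 (fun x => `|n (x + s) ^+ 2 - n x ^+ 2|).
  by apply: L1_abs; apply: L1B => //; exact: (L1_translate s n2).
have lu : L2 u by [].
apply: (@le_trans _ _ (intg (fun x => 2 * `|p (x + s) ^+ 2 - p x ^+ 2| +
                                     2 * `|n (x + s) ^+ 2 - n x ^+ 2|))).
  apply: intg_le.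
  - by have [] := L2B (L2_translate s lu) lu.
  - by apply: L1D; exact: L1Z.
  - move=> x; have := sqrB_ge0_le (p0 (x + s)) (p0 x); have := sqrB_ge0_le (n0 (x + s)) (n0 x).
    have -> : u (x + s) - u x = (p (x + s) - p x) - (n (x + s) - n x).
      by rewrite /p /n; lra.
    have := sqr_ge0 ((p (x + s) - p x) + (n (x + s) - n x)); nra.
rewrite intgD; [|exact: L1Z|exact: L1Z]; rewrite !intgZ//; lra.
Qed.

Definition autocorr u (t : R) : R := ip u (fun x => u (x + t)).

Lemma autocorr_le u t : L2 u -> `|autocorr u t| <= ip u u.
Proof.
move=> lu; apply: (le_trans (ip_norm_le lu (L2_translate t lu))).
rewrite [X in _ * Num.sqrt X](_ : _ = ip u u); first by rewrite -expr2 sqr_sqrtr ?ip_ge0.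
rewrite !ipxx; exact: (intg_translate t lu.2).
Qed.

(** The defect [ip u u - autocorr u t] is half the squared L^2 distance between u and its translate
    by t. *)
Lemma autocorr_cts0 u (t_ : nat -> R) : L2 u -> t_ @ \oo --> 0 ->
  (fun n => autocorr u (t_ n)) @ \oo --> ip u u.
Proof.
move=> lu t0; apply/cvgrPdist_le => e e0.
have [d d0 Hd] := L2_shift lu e0.
have /cvgr0Pnorm_lt/(_ d d0) := t0; apply: filterS => n /Hd.
have lt := L2_translate (t_ n) lu.
rewrite -(ipxx (fun x => u (x + t_ n) - u x)) ipBB//.
have -> : ip (fun x => u (x + t_ n)) (fun x => u (x + t_ n)) = ip u u.
  rewrite !ipxx; exact: (intg_translate (t_ n) lu.2).
rewrite (ipC _ u) -/(autocorr u _) => H.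
have /(le_trans (ler_norm _)) := autocorr_le (t_ n) lu => H'.
rewrite ger0_norm; lra.
Qed.

(** For real u, the squared modulus of the Fourier transform C u - i S u. *)
Definition spectral_density u xi : R := C u xi ^+ 2 + S u xi ^+ 2.

Lemma spectral_density_ge0 u xi : 0 <= spectral_density u xi.
Proof. by rewrite addr_ge0 ?sqr_ge0. Qed.

Let kc (x : R) := @cos_max R x.
Let ks (x : R) := @sin_max R x.

(** The Poisson kernel of the upper half-plane at height a / (2 pi), introduced as the transform of
    the damping weight. *)
Definition poisson (a t : R) : R := intg (fun xi => expw a xi * cos (2 * pi * t * xi)).

Lemma poissonE (a t : R) : 0 < a -> poisson a t = 2 * a / (a ^+ 2 + (2 * pi * t) ^+ 2).
Proof. by move=> a0; rewrite /poisson intg_expw_cos. Qed.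

Lemma poisson_scale (a s : R) : 0 < a ->
  poisson a (a / (2 * pi) * s + 0) = (a / (2 * pi))^-1 * cauchy_density s.
Proof.
move=> a0; rewrite poissonE// /cauchy_density.
have an0 : a != 0 by rewrite gt_eqF.
have pin0 : pi != 0 :> R by rewrite gt_eqF// pi_gt0.
have s0 : 1 + s ^+ 2 != 0 by rewrite gt_eqF// ltr_wpDr ?sqr_ge0.
move: (@pi R) pin0 => p pin0.
have -> : a ^+ 2 + (2 * p * (a / (2 * p) * s + 0)) ^+ 2 = a ^+ 2 * (1 + s ^+ 2).
  by field.
by field; rewrite an0 pin0 s0.
Qed.

Lemma L1_poisson (a : R) : 0 < a -> L1 (poisson a).
Proof.
move=> a0; have r0 : 0 < 2 * pi / a :> R by rewrite divr_gt0// mulr_gt0// pi_gt0.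
have [L _] := cauchy_densityP R.
have := L1Z (a / (2 * pi))^-1 (L1_affine 0 r0 L).
apply: L1_ext => t; rewrite -poisson_scale// addr0.
have an0 : a != 0 by rewrite gt_eqF.
have pin0 : pi != 0 :> R by rewrite gt_eqF// pi_gt0.
congr poisson; move: (@pi R) pin0 => p pin0.
by field; rewrite an0 pin0.
Qed.

Lemma poisson_ge0 (a t : R) : 0 < a -> 0 <= poisson a t.
Proof.
move=> a0; rewrite poissonE// divr_ge0 ?addr_ge0 ?sqr_ge0//.
by rewrite mulr_ge0// ltW.
Qed.

Lemma measurable_expw (a : R) : measurable_fun setT (expw a).
Proof. by apply: continuous_measurable_fun; exact: continuous_expw. Qed.

(** The weight makes all integrals absolutely convergent, so Fubini applies. Self-adjointness moves
    C and S off one factor; the addition formula for the cosine merges the two transforms into a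
    kernel in y - x, whose xi-integral is the Poisson kernel; integrating over x for fixed t = y - x
    leaves the autocorrelation. *)
Lemma abel_energy u (a : R) : L1 u -> L2 u -> 0 < a ->
  [/\ L1 (fun xi => spectral_density u xi * expw a xi),
      L1 (fun t => autocorr u t * poisson a t) &
      intg (fun xi => spectral_density u xi * expw a xi) = intg (fun t => autocorr u t * poisson a t)].
Proof.
move=> iu lu a0.
have iw := L1_expw a0; have mw := measurable_expw a.
have cc := @continuous_cos R; have cs := @continuous_sin R.
pose N := intg (fun x => `|u x|).
have mC := measurable_osc cc kc iu; have mS := measurable_osc cs ks iu.
have iCw : L1 (fun xi => expw a xi * C u xi).
  exact: (L1Mb iw mC (fun xi => osc_bound cc kc xi iu)).
have iSw : L1 (fun xi => expw a xi * S u xi).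
  exact: (L1Mb iw mS (fun xi => osc_bound cs ks xi iu)).
have iCCw : L1 (fun xi => C u xi * (expw a xi * C u xi)).
  by apply: L1_ext (L1Mb iCw mC (fun xi => osc_bound cc kc xi iu)) => xi; rewrite mulrC.
have iSSw : L1 (fun xi => S u xi * (expw a xi * S u xi)).
  by apply: L1_ext (L1Mb iSw mS (fun xi => osc_bound cs ks xi iu)) => xi; rewrite mulrC.
have iD : L1 (fun xi => spectral_density u xi * expw a xi).
  by apply: L1_ext (L1D iCCw iSSw) => xi; rewrite /spectral_density; ring.
suff [L E] : L1 (fun t => autocorr u t * poisson a t) /\
    intg (fun xi => spectral_density u xi * expw a xi) = intg (fun t => autocorr u t * poisson a t).
  by split.
have -> : intg (fun xi => spectral_density u xi * expw a xi) =
    ip (C u) (fun xi => expw a xi * C u xi) + ip (S u) (fun xi => expw a xi * S u xi).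
  by rewrite /ip -intgD//; apply: intg_ext => xi; rewrite /spectral_density; ring.
rewrite (ip_osc cc kc iu iCw) (ip_osc cs ks iu iSw).
pose inner x := intg (fun t => u (x + t) * poisson a t).
have ib x : L1 (fun y => u y * poisson a (y - x)).
  apply: (L1Mb iu (k := 2 / a)) => [|y].
    by apply: L1_meas (L1_translate (- x) (L1_poisson a0)).
  rewrite -(intg_expw a0); apply: intg_norm_le => //; first exact: L1_expw_cos.
  by move=> xi; rewrite normrM (ger0_norm (expR_ge0 _)) ler_piMr ?expR_ge0.
have innerE x : C (fun xi => expw a xi * C u xi) x + S (fun xi => expw a xi * S u xi) x
    = inner x.
  pose k (xi y : R) := cos (2 * pi * (y - x) * xi).
  have mk : measurable_fun setT (fun z : R * R => k z.1 z.2).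
    apply: (meas_comp2 (a := fun z : R * R => 2 * pi * (z.2 - x) * z.1)).
      exact: continuous_measurable_fun.
    apply: measurable_funM; last exact: measurable_fst.
    apply: measurable_funM; first exact: measurable_cst.
    by apply: measurable_funB; [exact: measurable_snd|exact: measurable_cst].
  have [_ _ E] := intg_fubini_prod mk (fun xi y => kc _) iw iu.
  transitivity (intg (fun xi => intg (fun y => expw a xi * k xi y * u y))).
    rewrite {2 4}/osc -intgD; last 2 first.
      exact: (L1_osc cc kc x iCw).
      exact: (L1_osc cs ks x iSw).
    apply: intg_ext => xi; rewrite /osc.
    have h1 := L1_osc cc kc xi iu; have h2 := L1_osc cs ks xi iu.
    have -> : intg (fun y => expw a xi * k xi y * u y) =
      intg (fun y => (expw a xi * cos (2 * pi * xi * x)) * (u y * cos (2 * pi * y * xi)) +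
       (expw a xi * sin (2 * pi * xi * x)) * (u y * sin (2 * pi * y * xi))).
      apply: intg_ext => y; rewrite /k.
      have -> : 2 * pi * (y - x) * xi = 2 * pi * y * xi - 2 * pi * xi * x by ring.
      by rewrite cosB; ring.
    rewrite intgD; [|exact: L1Z|exact: L1Z].
    by rewrite !intgZ//; ring.
  rewrite E /inner; clear E.
  rewrite -[RHS](_ : intg (fun y => u y * poisson a (y - x)) = _).
    apply: intg_ext => y; rewrite /poisson -intgZ; last exact: L1_expw_cos.
    by apply: intg_ext => xi; rewrite /k mulrC.
  rewrite -(intg_translate x (ib x)); apply: intg_ext => t.
  by rewrite addrK addrC.
have iinner x : L1 (fun t => u (x + t) * poisson a t).
  by apply: L1_ext (L1_translate x (ib x)) => t; rewrite addrK addrC.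
have iuC : L1 (fun x => u x * C (fun xi => expw a xi * C u xi) x).
  exact: (L1Mb iu (measurable_osc cc kc iCw) (fun x => osc_bound cc kc x iCw)).
have iuS : L1 (fun x => u x * S (fun xi => expw a xi * S u xi) x).
  exact: (L1Mb iu (measurable_osc cs ks iSw) (fun x => osc_bound cs ks x iSw)).
have -> : ip u (C (fun xi => expw a xi * C u xi)) + ip u (S (fun xi => expw a xi * S u xi)) =
    intg (fun x => intg (fun t => u x * (u (x + t) * poisson a t))).
  rewrite /ip -intgD//; apply: intg_ext => x.
  by rewrite -mulrDr innerE /inner intgZ.
have mp : measurable_fun setT (poisson a) by exact: L1_meas (L1_poisson a0).
(* Majorant for the last use of Fubini: the autocorrelation of |u| is at most [ip u u] as well. *)
pose v x := `|u x|.
have lv : L2 v.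
  by apply: (L2_le _ _ lu) => [|x]; [exact: (measurableT_comp _ lu.1)|rewrite normr_id].
have vv : ip v v = ip u u.
  by rewrite !ipxx; apply: intg_ext => x; rewrite real_normK ?num_real.
have iut t := L2_mul lu (L2_translate t lu).
have ivt t := L2_mul lv (L2_translate t lv).
have [] := @intg_fubini _ (fun x t => u x * (u (x + t) * poisson a t))
   (fun t => ip u u * poisson a t).
- apply: measurable_funM; first exact: meas_fst lu.1.
  apply: measurable_funM; last exact: meas_snd mp.
  apply: (meas_comp2 (a := fun z : R * R => z.1 + z.2)); first exact: lu.1.
  by apply: measurable_funD; [exact: measurable_fst|exact: measurable_snd].
- by move=> t; apply: L1_ext (L1Z (poisson a t) (iut t)) => x; ring.
- move=> t; rewrite (_ : intg _ = poisson a t * autocorr v t).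
    rewrite mulrC ler_wpM2r ?poisson_ge0// -vv.
    exact: le_trans (ler_norm _) (autocorr_le t lv).
  rewrite /autocorr /ip -intgZ; last exact: ivt.
  apply: intg_ext => x; rewrite !normrM (ger0_norm (poisson_ge0 t a0)) /v; ring.
- exact: L1Z (L1_poisson a0).
- by move=> x; exact: L1Z.
- have FE t : intg (fun x => u x * (u (x + t) * poisson a t)) = autocorr u t * poisson a t.
    rewrite mulrC /autocorr /ip -intgZ; last exact: iut.
    by apply: intg_ext => x; ring.
  by move=> _ iF ->; split; [exact: L1_ext FE iF|exact: intg_ext].
Qed.

(** Let a -> 0 in [abel_energy]. The Poisson averages tend to the autocorrelation at 0, which is
    [ip u u], and the damped energies increase to the full energy. Monotone convergence serves on
    that side because finiteness of the energy is part of the conclusion. *)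
Lemma plancherel u : L1 u -> L2 u ->
  [/\ L2 (C u), L2 (S u) & ip (C u) (C u) + ip (S u) (S u) = ip u u].
Proof.
move=> iu lu.
have cc := @continuous_cos R; have cs := @continuous_sin R.
have mC := measurable_osc cc kc iu; have mS := measurable_osc cs ks iu.
have mD : measurable_fun setT (spectral_density u).
  by apply: measurable_funD; exact: measurable_funX.
pose e_ (n : nat) : R := n.+1%:R^-1.
have e0 n : 0 < e_ n by rewrite invr_gt0.
(* The factor 2 pi makes the dilation [a_ n / (2 * pi)] of the Cauchy law equal to [e_ n]. *)
pose a_ n : R := 2 * pi * e_ n.
have a0 n : 0 < a_ n by rewrite !mulr_gt0// pi_gt0.
(* Measurability is read off the product with the Poisson kernel for a = 1, by multiplying with the
   reciprocal of that kernel. *)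
have mA : measurable_fun setT (autocorr u).
  have [_ /L1_meas mAp _] := abel_energy iu lu (@ltr01 R).
  have -> : autocorr u = fun t => autocorr u t * poisson 1 t * ((1 + (2 * pi * t) ^+ 2) / 2).
    apply/funext => t; rewrite poissonE// expr1n; field.
    by rewrite gt_eqF// ltr_wpDr ?sqr_ge0.
  apply: measurable_funM => //; apply: measurable_funM => //.
  by apply: measurable_funD => //; apply: measurable_funX; exact: measurable_funM.
have A1 n : intg (fun xi => spectral_density u xi * expw (a_ n) xi) =
    intg (fun s => autocorr u (e_ n * s) * cauchy_density s).
  have [_ iAp ->] := abel_energy iu lu (a0 n).
  have pi0 := @pi_gt0 R.
  have ae : a_ n / (2 * pi) = e_ n.
    by rewrite /a_ mulrC mulKf// gt_eqF// mulr_gt0.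
  have := intg_affine 0 (e0 n) iAp; rewrite -ae => H.
  rewrite -[LHS](mulKf (_ : (a_ n / (2 * pi))^-1 != 0)) ?invrK; last first.
    by rewrite invr_eq0 ae gt_eqF.
  rewrite -H -intgZ; last by have := L1_affine 0 (e0 n) iAp; rewrite -ae.
  apply: intg_ext => s; rewrite poisson_scale// addr0.
  have : a_ n / (2 * pi) != 0 by rewrite ae gt_eqF.
  move: (a_ n / (2 * pi)) => r r0.
  by rewrite mulrCA (mulrA r) divff// mul1r.
have lim1 : intg (fun xi => spectral_density u xi * expw (a_ n) xi) @[n --> \oo] --> ip u u.
  under eq_fun do rewrite A1.
  have [Lc Ic] := cauchy_densityP R.
  rewrite -[ip u u]mulr1 -Ic -intgZ//.
  apply: (intg_dct _ _ _ (L1Z (ip u u) Lc)).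
  - move=> n; apply: measurable_funM; last exact: L1_meas Lc.
    apply: measurableT_comp mA _; exact: measurable_funM.
  - exact: L1_meas (L1Z _ Lc).
  - apply/aeW => s; apply: cvgM; last exact: cvg_cst.
    apply: autocorr_cts0 => //; rewrite -(mul0r s); apply: cvgM; last exact: cvg_cst.
    exact: cvg_harmonic.
  - move=> n s; rewrite normrM (ger0_norm (cauchy_density_ge0 s)).
    by apply: ler_wpM2r; [exact: cauchy_density_ge0|exact: autocorr_le].
have lim2 : (\int[mu]_xi (spectral_density u xi * expw (a_ n) xi)%:E @[n --> \oo] -->
     \int[mu]_xi (spectral_density u xi)%:E)%E.
  have H x : (spectral_density u x)%:E = (limn (fun n => (spectral_density u x * expw (a_ n) x)%:E)).
    apply/esym/cvg_lim => //; apply/fine_cvgP; split; first exact: nearW.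
    rewrite -[X in _ --> X]mulr1; apply: cvgM; first exact: cvg_cst.
    rewrite -expR0; apply: continuous_cvg; first exact: continuous_expR.
    rewrite -oppr0; apply: cvgN; rewrite -(mul0r `|x|); apply: cvgM; last exact: cvg_cst.
    rewrite -(mulr0 (2 * pi)); apply: cvgM; first exact: cvg_cst.
    exact: cvg_harmonic.
  under [X in _ --> X]eq_integral do rewrite H.
  apply: cvg_monotone_convergence => //.
  - move=> n; apply/measurable_EFinP; apply: measurable_funM => //.
    exact: measurable_expw.
  - by move=> n x _; rewrite lee_fin mulr_ge0 ?spectral_density_ge0// expR_ge0.
  - move=> x _ m n mn; rewrite lee_fin ler_wpM2l ?spectral_density_ge0// ler_expR lerN2.
    rewrite ler_wpM2r// ler_wpM2l ?mulr_ge0 ?pi_ge0//.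
    by rewrite lef_pV2 ?posrE// ler_nat.
have E : (\int[mu]_xi (spectral_density u xi)%:E = (ip u u)%:E)%E.
  apply: (cvg_unique _ lim2) => //.
  have EE n : (\int[mu]_xi (spectral_density u xi * expw (a_ n) xi)%:E =
      (intg (fun xi => spectral_density u xi * expw (a_ n) xi))%:E)%E.
    by have [L _ _] := abel_energy iu lu (a0 n); rewrite (EFin_intg L).
  rewrite (funext EE); apply/fine_cvgP; split; [exact: nearW|exact: lim1].
have LD : L1 (spectral_density u).
  apply: L1_fin => //; under eq_integral do rewrite ger0_norm ?spectral_density_ge0//.
  by rewrite E ltry.
have LC : L2 (C u).
  split => //; apply: L1_le LD; first exact: measurable_funX.
  by move=> x; rewrite ger0_norm ?sqr_ge0// lerDl sqr_ge0.
have LS : L2 (S u).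
  split => //; apply: L1_le LD; first exact: measurable_funX.
  by move=> x; rewrite ger0_norm ?sqr_ge0// lerDr sqr_ge0.
split => //; rewrite !ipxx -intgD; [|exact: LC.2|exact: LS.2].
by apply: EFin_inj; rewrite EFin_intg.
Qed.

End Plancherel.

(** * The Fourier transform of complex functions *)

Section ComplexL2.
Local Open Scope complex_scope.
Variable R : realType.
Local Notation mu := (@lebesgue_measure R).
Implicit Types f g h : R -> R[i].

Local Notation C := (osc (@cos R)).
Local Notation S := (osc (@sin R)).
Let kc (x : R) := @cos_max R x.
Let ks (x : R) := @sin_max R x.
Let cc := @continuous_cos R.
Let cs := @continuous_sin R.

Definition re f (x : R) : R := complex.Re (f x).
Definition im f (x : R) : R := complex.Im (f x).

Definition cL2 f : Prop := L2 (re f) /\ L2 (im f).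
Definition cL1 f : Prop := L1 (re f) /\ L1 (im f).

(** The real part of the Hermitian product: it has the same norm and still satisfies
    Cauchy-Schwarz. *)
Definition cip f g : R := ip (re f) (re g) + ip (im f) (im g).
Definition cN f : R := Num.sqrt (cip f f).

Lemma cip_ge0 f : 0 <= cip f f.
Proof. by rewrite addr_ge0 ?ip_ge0. Qed.

Lemma sqr_normc (z : R[i]) : Normc.normc z ^+ 2 = complex.Re z ^+ 2 + complex.Im z ^+ 2.
Proof. by case: z => a b /=; rewrite sqr_sqrtr// addr_ge0 ?sqr_ge0. Qed.

Lemma normc_ge0 (z : R[i]) : 0 <= Normc.normc z.
Proof. by case: z => a b /=; exact: sqrtr_ge0. Qed.

Lemma cLnorm2E f : cLnorm 2%:E f =
  ((\int[mu]_x (re f x ^+ 2 + im f x ^+ 2)%:E) `^ 2^-1)%E.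
Proof.
rewrite /cLnorm unlock; congr (_ `^ _)%E; apply: eq_integral => x _.
rewrite /= ger0_norm ?normc_ge0// -sqr_normc.
by rewrite -powR_mulrn ?normc_ge0.
Qed.

Lemma measurable_sqr2 f : measurable_fun setT (re f) -> measurable_fun setT (im f) ->
  measurable_fun setT (fun x => re f x ^+ 2 + im f x ^+ 2).
Proof. by move=> mr mi; apply: measurable_funD; exact: measurable_funX. Qed.

Lemma cLfun2P f : cLfun 2%:E f <-> cL2 f.
Proof.
split.
- move=> [mr mi]; rewrite cLnorm2E => H.
  have L : L1 (fun x => re f x ^+ 2 + im f x ^+ 2).
    apply: L1_fin; first exact: measurable_sqr2.
    under eq_integral do rewrite ger0_norm ?addr_ge0 ?sqr_ge0//.
    by apply: lty_poweRy H; rewrite invr_neq0.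
  split; split => //.
    apply: (L1_le _ _ L) => [|x]; first exact: measurable_funX.
    by rewrite ger0_norm ?sqr_ge0// lerDl sqr_ge0.
  apply: (L1_le _ _ L) => [|x]; first exact: measurable_funX.
  by rewrite ger0_norm ?sqr_ge0// lerDr sqr_ge0.
- move=> [[mr r2] [mi i2]]; split => //; rewrite cLnorm2E.
  by rewrite -EFin_intg ?poweR_EFin ?ltry//; exact: L1D.
Qed.

Lemma cLnorm2_cN f : cL2 f -> cLnorm 2%:E f = (cN f)%:E.
Proof.
move=> [[mr r2] [mi i2]]; rewrite cLnorm2E -EFin_intg; last exact: L1D.
rewrite poweR_EFin powR12_sqrt ?intg_ge0//; last first.
  by move=> x; rewrite addr_ge0 ?sqr_ge0.
by rewrite intgD.
Qed.

Lemma cLfun1P f : cLfun 1 f <-> cL1 f.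
Proof.
have nE x : `|Normc.normc (f x)| = Num.sqrt (re f x ^+ 2 + im f x ^+ 2).
  by rewrite ger0_norm ?normc_ge0// /re /im; case: (f x).
split.
- move=> [mr mi]; rewrite /cLnorm Lnorm1 => H.
  have mn : measurable_fun setT (fun x => Num.sqrt (re f x ^+ 2 + im f x ^+ 2)).
    apply: measurableT_comp (measurable_sqr2 mr mi).
    by apply: continuous_measurable_fun; exact: sqrt_continuous.
  have L : L1 (fun x => Num.sqrt (re f x ^+ 2 + im f x ^+ 2)).
    apply: L1_fin => //.
    by under eq_integral do rewrite ger0_norm ?sqrtr_ge0// -nE.
  split; apply: (L1_le _ _ L) => // x.
    by rewrite -sqrtr_sqr ler_sqrt ?lerDl ?addr_ge0 ?sqr_ge0.
  by rewrite -sqrtr_sqr ler_sqrt ?lerDr ?addr_ge0 ?sqr_ge0.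
- move=> [Lr Li]; split; [exact: L1_meas|exact: L1_meas|].
  rewrite /cLnorm Lnorm1.
  have : L1 (fun x => Num.sqrt (re f x ^+ 2 + im f x ^+ 2)).
    apply: (L1_le _ _ (L1D (L1_abs Lr) (L1_abs Li))) => [|x].
      apply: measurableT_comp (measurable_sqr2 (L1_meas Lr) (L1_meas Li)).
      by apply: continuous_measurable_fun; exact: sqrt_continuous.
    rewrite ger0_norm ?sqrtr_ge0// -[leRHS]ger0_norm ?addr_ge0// -sqrtr_sqr.
    rewrite ler_sqrt ?sqr_ge0// -(real_normK (num_real (re f x))).
    rewrite -(real_normK (num_real (im f x))) sqrrD.
    by have := normr_ge0 (re f x); have := normr_ge0 (im f x); nra.
  move=> /L1P/integrableP[_] /=.
  by under eq_integral do rewrite ger0_norm ?sqrtr_ge0// -nE.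
Qed.

Lemma cip_le f g : cL2 f -> cL2 g -> `|cip f g| <= cN f * cN g.
Proof.
move=> [fr fi] [gr gi]; rewrite /cN -sqrtrM ?cip_ge0// -sqrtr_sqr ler_sqrt; last first.
  by rewrite mulr_ge0 ?cip_ge0.
rewrite /cip.
have h1 := cauchy_schwarz fr gr; have h2 := cauchy_schwarz fi gi.
have a0 := ip_ge0 (re f); have b0 := ip_ge0 (re g).
have c0 := ip_ge0 (im f); have d0 := ip_ge0 (im g).
have h : 2 * (ip (re f) (re g) * ip (im f) (im g)) <=
    ip (re f) (re f) * ip (im g) (im g) + ip (im f) (im f) * ip (re g) (re g).
  set a := ip (re f) (re f) in h1 a0 *; set b := ip (re g) (re g) in h1 b0 *.
  set c := ip (im f) (im f) in h2 c0 *; set d := ip (im g) (im g) in h2 d0 *.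
  set x := ip (re f) (re g) in h1 *; set y := ip (im f) (im g) in h2 *.
  apply: le_trans (ler_norm _) _.
  rewrite -(ler_pXn2r (n := 2)) ?nnegrE ?addr_ge0 ?mulr_ge0//.
  rewrite real_normK ?num_real//.
  have : x ^+ 2 * y ^+ 2 <= (a * b) * (c * d) by apply: ler_pM => //; exact: sqr_ge0.
  have := sqr_ge0 (a * d - c * b); nra.
by rewrite sqrrD; lra.
Qed.

Definition cB f g : R -> R[i] := fun x => f x - g x.

Lemma re_cB f g : re (cB f g) = (fun x => re f x - re g x).
Proof. by apply/funext => x; rewrite /re /cB; case: (f x) (g x) => ? ? []. Qed.

Lemma im_cB f g : im (cB f g) = (fun x => im f x - im g x).
Proof. by apply/funext => x; rewrite /im /cB; case: (f x) (g x) => ? ? []. Qed.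

Lemma cL2B f g : cL2 f -> cL2 g -> cL2 (cB f g).
Proof.
by move=> [fr fi] [gr gi]; split; rewrite ?re_cB ?im_cB; exact: L2B.
Qed.

Lemma cN_triangle f g : cL2 f -> cL2 g -> `|cN f - cN g| <= cN (cB f g).
Proof.
move=> lf lg; have lfg := cL2B lf lg.
have E : cip (cB f g) (cB f g) = cip f f - 2 * cip f g + cip g g.
  rewrite /cip re_cB im_cB.
  rewrite (ipBB lf.1 lg.1) (ipBB lf.2 lg.2); ring.
have H := cip_le lf lg.
rewrite -(ler_pXn2r (n := 2)) ?nnegrE ?sqrtr_ge0// real_normK ?num_real//.
rewrite [leRHS]sqr_sqrtr ?cip_ge0// E sqrrB !sqr_sqrtr ?cip_ge0//.
by have := le_trans (ler_norm _) H; lra.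
Qed.

Lemma ip_even_odd (u v : R -> R) : (forall x, u (- x) = u x) -> (forall x, v (- x) = - v x) ->
  L2 u -> L2 v -> ip u v = 0.
Proof.
move=> ue vo lu lv; have := intg_opp (L2_mul lu lv).
rewrite (intg_ext (g := fun x => -1 * (u x * v x))) => [|x]; last by rewrite ue vo; ring.
by rewrite intgZ -/(ip u v); [lra|exact: L2_mul].
Qed.

Lemma osc_cosN (u : R -> R) x : C u (- x) = C u x.
Proof. by apply: intg_ext => y; rewrite mulrN cosN. Qed.

Lemma osc_sinN (u : R -> R) x : L1 u -> S u (- x) = - S u x.
Proof.
move=> iu; rewrite -[RHS]mulN1r /osc -intgZ; last exact: L1_osc.
by apply: intg_ext => y; rewrite mulrN sinN; ring.
Qed.

Lemma osc_sin_even (u : R -> R) x : L1 u -> (forall x, u (- x) = u x) -> S u x = 0.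
Proof.
move=> iu ue; have := osc_sinN x iu; rewrite {1}/osc.
have i := L1_osc cs ks x iu.
rewrite -(intg_opp (L1_osc cs ks (- x) iu)).
rewrite (intg_ext (g := fun y => u y * sin (2 * pi * y * x))) => [|y]; last first.
  by rewrite ue !(mulrN, mulNr) opprK.
rewrite -/(osc _ _ _); lra.
Qed.

Lemma re_fourier_int f : cL1 f ->
  re (fourier_int f) = (fun xi => C (re f) xi + S (im f) xi).
Proof.
move=> [fr fi]; apply/funext => xi; rewrite /re /fourier_int /cintegral /= -intgE /osc.
rewrite -intgD; [|exact: L1_osc|exact: L1_osc].
apply: intg_ext => x; rewrite /re /im /expi cosN sinN; case: (f x) => a b /=; ring.
Qed.

Lemma im_fourier_int f : cL1 f ->
  im (fourier_int f) = (fun xi => C (im f) xi - S (re f) xi).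
Proof.
move=> [fr fi]; apply/funext => xi; rewrite /im /fourier_int /cintegral /= -intgE /osc.
rewrite -intgB; [|exact: L1_osc|exact: L1_osc].
apply: intg_ext => x; rewrite /re /im /expi cosN sinN; case: (f x) => a b /=; ring.
Qed.

(** The cross terms pair a cosine transform, which is even, with a sine transform, which is odd, and
    vanish; [plancherel] for the real and the imaginary part remains. *)
Lemma cplancherel f : cL1 f -> cL2 f ->
  cL2 (fourier_int f) /\ cN (fourier_int f) = cN f.
Proof.
move=> f1 f2; have [r1 i1] := f1; have [r2 i2] := f2.
have [Cr Sr Er] := plancherel r1 r2; have [Ci Si Ei] := plancherel i1 i2.
split.
  by split; rewrite ?re_fourier_int ?im_fourier_int//; [exact: L2D|exact: L2B].
congr Num.sqrt; rewrite /cip re_fourier_int// im_fourier_int//.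
rewrite ipBB// ipDl ?ipDr//; try exact: L2D.
rewrite (ip_even_odd (osc_cosN (im f)) (fun x => osc_sinN x r1) Ci Sr).
rewrite (ipC (S (im f))) (ip_even_odd (osc_cosN (re f)) (fun x => osc_sinN x i1) Cr Si).
rewrite -Er -Ei.
move: (ip (C (re f)) (C (re f))) (ip (S (re f)) (S (re f))) => p1 p2.
move: (ip (C (im f)) (C (im f))) (ip (S (im f)) (S (im f))) => p3 p4.
ring.
Qed.

(** Both norms are limits of one sequence, since each approximant [u n] has the same norm as its
    transform. *)
Lemma fourier_isometry f g : fourier (f, g) -> cLnorm 2%:E f = cLnorm 2%:E g.
Proof.
move=> [/= /cLfun2P lf /cLfun2P lg [u [uL uf ug]]].
rewrite !cLnorm2_cN//; congr EFin.
have u1 n : cL1 (u n) by apply/cLfun1P; have [] := uL n.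
have u2 n : cL2 (u n) by apply/cLfun2P; have [] := uL n.
have {}uf : (fun n => cN (cB (u n) f)) @ \oo --> 0.
  move: uf; rewrite (_ : (fun n => _) = fun n => (cN (cB (u n) f))%:E); last first.
    by apply/funext => n; rewrite -cLnorm2_cN//; exact: cL2B.
  by move=> /fine_cvgP[].
have {}ug : (fun n => cN (cB (fourier_int (u n)) g)) @ \oo --> 0.
  move: ug; rewrite (_ : (fun n => _) = fun n => (cN (cB (fourier_int (u n)) g))%:E); last first.
    apply/funext => n; rewrite -cLnorm2_cN//; apply: cL2B => //.
    by have [] := cplancherel (u1 n) (u2 n).
  by move=> /fine_cvgP[].
have cf : (fun n => cN (u n)) @ \oo --> cN f.
  apply/cvgrPdist_le => e e0; have /cvgr0Pnorm_le/(_ e e0) := uf; apply: filterS => n.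
  rewrite ger0_norm ?sqrtr_ge0// distrC; apply: le_trans; exact: cN_triangle.
have cg : (fun n => cN (u n)) @ \oo --> cN g.
  apply/cvgrPdist_le => e e0; have /cvgr0Pnorm_le/(_ e e0) := ug; apply: filterS => n.
  have [l <-] := cplancherel (u1 n) (u2 n).
  rewrite ger0_norm ?sqrtr_ge0// distrC; apply: le_trans; exact: cN_triangle.
exact: (cvg_unique _ cf cg).
Qed.

Lemma Pop_contraction (E : set R) f g : Pop E (f, g) -> (cLnorm 2%:E g <= cLnorm 2%:E f)%E.
Proof.
move=> [/= /cLfun2P lf /cLfun2P lg H].
rewrite !cLnorm2E; apply: gt0_ler_poweR; rewrite ?in_itv/= ?leey ?andbT ?integral_ge0//.
- by move=> x _; rewrite lee_fin addr_ge0 ?sqr_ge0.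
- by move=> x _; rewrite lee_fin addr_ge0 ?sqr_ge0.
apply: ae_ge0_le_integral => //.
- by move=> x _; rewrite lee_fin addr_ge0 ?sqr_ge0.
- by apply/measurable_EFinP; apply: measurable_sqr2; [exact: lg.1.1|exact: lg.2.1].
- by move=> x _; rewrite lee_fin addr_ge0 ?sqr_ge0.
- by apply/measurable_EFinP; apply: measurable_sqr2; [exact: lf.1.1|exact: lf.2.1].
- have [N [mN N0 NN]] := H; exists N; split => // x /= Hx; apply: NN => /= h.
  apply: Hx => _; rewrite lee_fin /re /im h indicE.
  case: (_ \in _) => /=; case: (f x) => a b /=; rewrite !(mul1r, mul0r) ?subr0 ?add0r ?addr0//.
  by rewrite expr0n /= addr0 addr_ge0 ?sqr_ge0.
Qed.

Lemma opnorm_le1 (E F : set R) : (opnorm (Pop E \; Qop F)%relation <= 1)%E.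
Proof.
apply: ge_ereal_sup => _ [[f h] [[z [g2 [g1 Ff Fg] Fz] PE] /= f1] <-] /=.
apply: (le_trans (Pop_contraction PE)); apply: le_trans f1.
rewrite /= in Ff Fg Fz.
rewrite (fourier_isometry Fz) (fourier_isometry Ff); exact: Pop_contraction Fg.
Qed.

Lemma Theta2_le1 (kappa e1 e2 : R) : (Theta2 kappa e1 e2 <= 1)%E.
Proof. by apply: ge_ereal_sup => _ [[E F] _ <-]; exact: opnorm_le1. Qed.

End ComplexL2.

(** * Even functions *)

Section EvenTransform.
Local Open Scope complex_scope.
Variable R : realType.
Implicit Types f g h u v G y : R -> R.

Local Notation C := (osc (@cos R)).
Local Notation S := (osc (@sin R)).
Let kc (x : R) := @cos_max R x.
Let ks (x : R) := @sin_max R x.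
Let cc := @continuous_cos R.
Let cs := @continuous_sin R.

Definition even f : Prop := forall x, f (- x) = f x.

Lemma even_isometry u : L1 u -> L2 u -> even u -> L2 (C u) /\ ip (C u) (C u) = ip u u.
Proof.
move=> u1 u2 ue; have [L _ E] := plancherel u1 u2; split=> //.
have S0 : S u = fun=> 0 by apply/funext => x; exact: osc_sin_even.
move: E; rewrite S0 (_ : ip (fun=> 0) _ = 0) ?addr0//.
by rewrite /ip -[RHS](intg0 R); apply: intg_ext => x; rewrite mulr0.
Qed.

Lemma ip_osc_cos u v : L1 u -> L1 v -> ip (C u) v = ip u (C v).
Proof. exact: ip_osc. Qed.

(** Polarisation of [even_isometry], applied to u - v. *)
Lemma even_parseval u v : L1 u -> L2 u -> even u -> L1 v -> L2 v -> even v ->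
  ip (C u) (C v) = ip u v.
Proof.
move=> u1 u2 ue v1 v2 ve.
have [Lu Eu] := even_isometry u1 u2 ue; have [Lv Ev] := even_isometry v1 v2 ve.
have we : even (fun x => u x - v x) by move=> x; rewrite ue ve.
have [_ E] := even_isometry (L1B u1 v1) (L2B u2 v2) we.
move: E; rewrite (_ : C (fun x => u x - v x) = fun x => C u x - C v x); last first.
  by apply/funext => x; rewrite oscB.
rewrite !ipBB// Eu Ev; move: (ip (C u) (C v)) (ip u v) (ip u u) (ip v v) => p q a b; clear; lra.
Qed.

Definition rc f : R -> R[i] := fun x => (f x)%:C.

Lemma re_rc f : re (rc f) = f. Proof. by []. Qed.
Lemma im_rc f : im (rc f) = fun=> 0. Proof. by []. Qed.

Lemma cL2_rc f : L2 f -> cL2 (rc f).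
Proof. by move=> lf; split; rewrite ?im_rc; [|exact: L20]. Qed.

Lemma cL1_rc f : L1 f -> cL1 (rc f).
Proof. by move=> lf; split; rewrite ?im_rc; [|exact: L10]. Qed.

Lemma ip0l f : ip (fun=> 0) f = 0.
Proof. by rewrite /ip -[RHS](intg0 R); apply: intg_ext => x; rewrite mul0r. Qed.

Lemma cN_rc f : cN (rc f) = Num.sqrt (ip f f).
Proof. by rewrite /cN /cip re_rc im_rc ip0l addr0. Qed.

Lemma osc0 k x : osc k (fun=> 0) x = 0 :> R.
Proof. by rewrite /osc -[RHS](intg0 R); apply: intg_ext => y; rewrite mul0r. Qed.

Lemma fourier_int_rc u : L1 u -> even u -> fourier_int (rc u) = rc (C u).
Proof.
move=> u1 ue; apply/funext => xi.
have h1 := re_fourier_int (cL1_rc u1); have h2 := im_fourier_int (cL1_rc u1).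
rewrite /rc; case E : (fourier_int _ xi) => [a b].
have : re (fourier_int (rc u)) xi = a by rewrite /re E.
have : im (fourier_int (rc u)) xi = b by rewrite /im E.
by rewrite h1 h2 /= im_rc re_rc !osc0 osc_sin_even// addr0 subrr => <- <-.
Qed.

Lemma cB_rc f g : (fun x => rc f x - rc g x) = rc (fun x => f x - g x).
Proof. by apply/funext => x; rewrite /rc rmorphB. Qed.

(** As C G need not be integrable, its truncations v_n to [-n, n] are the approximants. Since ip (C
    v_n) G = ip v_n (C G) = ip v_n v_n, the squared distances from v_n to C G and from C v_n to G
    are both ip G G - ip v_n v_n, which tends to 0. Inversion thus follows without any pointwise
    statement. *)
Lemma fourier_even G : L1 G -> L2 G -> even G -> fourier (rc (C G), rc G).
Proof.
move=> G1 G2 Ge; have [LC EC] := even_isometry G1 G2 Ge.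
split => /=; [exact/cLfun2P/cL2_rc|exact/cLfun2P/cL2_rc|].
pose chi (n : nat) : R -> R := \1_(`[(- n%:R), n%:R]).
have chiE n x : chi n x = (`|x| <= n%:R)%R%:R by rewrite /chi indic_itvE in_itv /= -ler_norml.
have chi01 n x : `|chi n x| <= 1 by rewrite chiE; case: (`|x| <= n%:R); rewrite ?normr1 ?normr0.
have mchi n : measurable_fun setT (chi n) by exact: measurable_indic_itv.
have mC := measurable_osc cc kc G1.
pose v n x := C G x * chi n x.
have v2 n : L2 (v n) by exact: (L2Mb LC (mchi n) (chi01 n)).
have v1 n : L1 (v n).
  apply: L1_ext (L1Mb (L1_itv _ _ _ _) mC (fun x => osc_bound cc kc x G1)) => x.
  exact: mulrC.
have ve n : even (v n) by move=> x; rewrite /v osc_cosN !chiE normrN.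
have vv n : ip (v n) (v n) = ip (C G) (v n).
  apply: intg_ext => x; rewrite /v chiE; case: (`|x| <= n%:R) => /=; ring.
have lim : ip (C G) (v n) @[n --> \oo] --> ip G G.
  rewrite -EC; apply: (intg_dct _ _ _ LC.2).
  - by move=> n; apply: measurable_funM => //; exact: (v2 n).1.
  - exact: measurable_funM.
  - apply/aeW => x; apply: cvg_near_cst; near=> n.
    rewrite /v chiE (_ : (_ <= _) = true) ?mulr1//.
    by near: n; exact: nbhs_infty_ger.
  - move=> n x; rewrite /v normrM normrM mulrA -normrM -expr2 ger0_norm ?sqr_ge0//.
    by rewrite ler_piMr ?sqr_ge0.
exists (fun n => rc (v n)); split.
- by move=> n; split; [exact/cLfun1P/cL1_rc|exact/cLfun2P/cL2_rc].
- rewrite (_ : (fun n => _) = fun n => (Num.sqrt (ip G G - ip (C G) (v n)))%:E).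
    apply/fine_cvgP; split; first exact: nearW.
    rewrite -(sqrtr0 R); apply: continuous_cvg; first exact: sqrt_continuous.
    by rewrite -(subrr (ip G G)); apply: cvgB => //; exact: cvg_cst.
  apply/funext => n; rewrite cB_rc cLnorm2_cN; last exact/cL2_rc/L2B.
  rewrite cN_rc ipBB// EC vv (ipC (v n)); congr (Num.sqrt _)%:E.
  move: (ip (C G) (v n)) (ip G G) => p q; ring.
- rewrite (_ : (fun n => _) = fun n => (Num.sqrt (ip G G - ip (C G) (v n)))%:E).
    apply/fine_cvgP; split; first exact: nearW.
    rewrite -(sqrtr0 R); apply: continuous_cvg; first exact: sqrt_continuous.
    by rewrite -(subrr (ip G G)); apply: cvgB => //; exact: cvg_cst.
  apply/funext => n; have [Lv Ev] := even_isometry (v1 n) (v2 n) (ve n).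
  rewrite fourier_int_rc// cB_rc cLnorm2_cN; last exact/cL2_rc/L2B.
  rewrite cN_rc ipBB// Ev (ip_osc_cos (v1 n) G1) (ipC (v n)) vv; congr (Num.sqrt _)%:E.
  move: (ip (C G) (v n)) (ip G G) => p q; ring.
Unshelve. all: by end_near. Qed.

(** The test function is C G, normalised: its transform is a multiple of G, which P_F fixes, so Q_F
    fixes the test function; its image under P_E is then paired with y by Cauchy-Schwarz. *)
Lemma opnorm_ge (E F : set R) G y : measurable E ->
  L1 G -> L2 G -> even G -> (forall x, ~ F x -> G x = 0) ->
  L2 y -> (forall x, ~ E x -> y x = 0) -> 0 < ip G G -> 0 < ip y y ->
  ((ip (C G) y / (Num.sqrt (ip G G) * Num.sqrt (ip y y)))%:E
     <= opnorm (Pop E \; Qop F)%relation)%E.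
Proof.
move=> mE G1 G2 Ge GF y2 yE G0 y0.
pose s := (Num.sqrt (ip G G))^-1.
have s0 : 0 < s by rewrite invr_gt0 sqrtr_gt0.
pose H x := s * G x.
have H1 : L1 H by exact: L1Z.
have H2 : L2 H by exact: L2Z.
have He : even H by move=> x; rewrite /H Ge.
have HF x : ~ F x -> H x = 0 by move=> /GF; rewrite /H => ->; rewrite mulr0.
have [LC EC] := even_isometry H1 H2 He.
have HH : ip H H = 1.
  by rewrite ipZl// ipZr// mulrA -expr2 /s exprVn sqr_sqrtr ?(ltW G0)// mulVf// gt_eqF.
have mE1 : measurable_fun setT (\1_E : R -> R) by exact: measurable_indic.
pose h x := C H x * \1_E x.
have h2 : L2 h.
  apply: (L2Mb LC mE1 (k := 1)) => x.
  by rewrite indicE; case: (_ \in _); rewrite ?normr1 ?normr0.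
apply: (@le_trans _ _ (cLnorm 2%:E (rc h))); last first.
  apply: ereal_sup_ubound; exists (rc (C H), rc h) => //; split; last first.
    by rewrite /= cLnorm2_cN ?cN_rc ?EC ?HH ?sqrtr1//; exact: cL2_rc.
  exists (rc (C H)) => /=.
    exists (rc H) => /=; last exact: fourier_even.
    exists (rc H) => /=; first exact: fourier_even.
    split; [exact/cLfun2P/cL2_rc|exact/cLfun2P/cL2_rc|].
    apply/aeW => x; rewrite /rc indicE /=.
    have [Fx|Fx] := pselect (F x); first by rewrite mem_set// mul1r.
    by rewrite memNset// HF// mul0r.
  split; [exact/cLfun2P/cL2_rc|exact/cLfun2P/cL2_rc|].
  by apply/aeW => x; rewrite /rc /h /= mulrC rmorphM.
rewrite cLnorm2_cN; last exact: cL2_rc.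
rewrite cN_rc lee_fin invfM mulrA ler_pdivrMr ?sqrtr_gt0//.
apply: le_trans (ip_norm_le h2 y2); apply: le_trans (ler_norm _).
rewrite le_eqVlt; apply/orP; left; apply/eqP.
have [LG _] := even_isometry G1 G2 Ge.
rewrite -/s mulrC -ipZl//; apply: intg_ext => x; rewrite /h /H oscZ//.
have [Ex|Ex] := pselect (E x); first by rewrite indicE mem_set// mulr1.
by rewrite yE// !mulr0.
Qed.

End EvenTransform.

(** * One step of the construction *)

Section Step.
Variable R : realType.
Implicit Types f g h u v phi : R -> R.

Local Notation C := (osc (@cos R)).
Let kc (x : R) := @cos_max R x.
Let cc := @continuous_cos R.

(** The two indicators differ only within distance s to the left of the two end points. *)
Lemma intg_itv_shift (u v s : R) : 0 <= s ->
  intg (fun x => `|\1_(`]u, v[) (x + s) - \1_(`]u, v[) x|) <= 2 * s.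
Proof.
move=> s0.
have i1 := L1_itv true false (u - s) u; have i2 := L1_itv true false (v - s) v.
have i0 := L1_itv false true u v.
apply: (@le_trans _ _ (intg (fun x => \1_(`[u - s, u]) x + \1_(`[v - s, v]) x))).
  apply: intg_le => //.
  - by apply/L1_abs/L1B => //; exact: L1_translate.
  - exact: L1D.
  - move=> x; rewrite !indic_itvE !in_itv /=.
    have [A|A] := boolP (u < x + s < v); have [B|B] := boolP (u < x < v);
      rewrite /= ?subrr ?normr0 ?addr_ge0// ?subr0 ?sub0r ?normrN normr1.
    + have {A} /andP[A1 A2] := A; have xu : x <= u.
        by rewrite leNgt; apply: contra B => ux; rewrite ux /=; lra.
      by rewrite (_ : u - s <= x <= u) ?lerDl//; apply/andP; split; lra.
    + have {B} /andP[B1 B2] := B; have xv : v <= x + s.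
        by rewrite leNgt; apply: contra A => ux; rewrite ux andbT /=; lra.
      by rewrite (_ : v - s <= x <= v) ?lerDr//; apply/andP; split; lra.
rewrite intgD// !intg_itv; lra.
Qed.

(** Half-open, so that two successive layers on one side, which share a radius, are disjoint. *)
Definition ann (X X' : R) : set R := [set x | (X <= `|x| < X')%R].

Lemma indic_annE X X' x : \1_(ann X X') x = (X <= `|x| < X')%R%:R :> R.
Proof. by rewrite indicE; congr (nat_of_bool _)%:R; apply/idP/idP; rewrite inE. Qed.

Lemma measurable_ann X X' : measurable (ann X X').
Proof.
have -> : ann X X' = (fun x : R => `|x|) @^-1` `[X, X'[.
  by apply/seteqP; split => x /=; rewrite /ann /= in_itv.
rewrite -[X in measurable X]setTI.
have mn : measurable_fun setT (fun x : R => `|x|).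
  by apply: continuous_measurable_fun; exact: norm_continuous.
by apply: mn => //; exact: measurable_itv.
Qed.

Lemma ann_itvE (X X' u v x : R) : 0 <= X -> X <= X' ->
  \1_(ann X X') x * \1_(`]u, v[) x =
  \1_(`](Num.max u (- X')), (Num.min v X')[) x -
  \1_(`](Num.max u (- X)), (Num.min v X)[) x :> R.
Proof.
move=> X0 XX; rewrite indic_annE !indic_itvE !in_itv /= !gt_max !lt_min.
have E Z : ((u < x) && (- Z < x)) && ((x < v) && (x < Z)) = (u < x < v) && (`|x| < Z).
  by rewrite ltr_norml andbACA.
rewrite !E; have [h1|h1] := leP X `|x|; last by rewrite (lt_le_trans h1 XX) mul0r subrr.
by case: (u < x < v); case: (`|x| < X'); rewrite /= ?mulr1 ?mulr0 ?mul0r subr0.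
Qed.

(** Annulus and window meet in a difference of two intervals, each of translation modulus 2 s, so
    [fejer_bound] yields 4 / m.+1. The rate does not depend on the window, as it must not: one
    period has to serve all windows. *)
Lemma comb_density (c X X' u v : R) (m : nat) : 0 <= X -> X <= X' -> 0 < c < 1 ->
  intg (fun x => \1_(comb c) (m.+1%:R * x) * (\1_(ann X X') x * \1_(`]u, v[) x)) <=
  c * intg (fun x => \1_(ann X X') x * \1_(`]u, v[) x) + 4 / m.+1%:R.
Proof.
move=> X0 XX c01.
set phi := fun x => \1_(ann X X') x * \1_(`]u, v[) x.
have phiE := ann_itvE u v _ X0 XX.
pose a := Num.max u (- X'); pose b := Num.min v X'.
pose a' := Num.max u (- X); pose b' := Num.min v X.
have m0 : 0 < m.+1%:R :> R by [].
have iphi : L1 phi.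
  apply: (L1_ext (f := fun x => \1_(`]a, b[) x - \1_(`]a', b'[) x)).
    by move=> x; rewrite /phi phiE.
  by apply: L1B; exact: L1_itv.
have mq : measurable_fun setT (fun x : R => combq c (m.+1%:R * x)).
  apply: measurableT_comp; first exact: measurable_combq.
  exact: measurable_funM.
have B : `|intg (fun x => phi x * combq c (m.+1%:R * x))| <= 4 / m.+1%:R.
  apply: fejer_bound => //.
  - exact: measurable_combq.
  - by move=> x; exact: combq_le1.
  - by move=> y; exact: combq_mean0.
  - move=> t /andP[t0 t1].
    have : t / m.+1%:R <= m.+1%:R^-1 by rewrite ler_piMl ?invr_ge0// ltW.
    have : 0 <= t / m.+1%:R by rewrite divr_ge0.
    move: (t / _) => s s0 s1.
    have i1 : L1 (fun x => `|\1_(`]a, b[) (x + s) - \1_(`]a, b[) x|).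
      by apply/L1_abs/L1B; [apply: L1_translate|]; exact: L1_itv.
    have i2 : L1 (fun x => `|\1_(`]a', b'[) (x + s) - \1_(`]a', b'[) x|).
      by apply/L1_abs/L1B; [apply: L1_translate|]; exact: L1_itv.
    apply: (@le_trans _ _ (intg (fun x => `|\1_(`]a, b[) (x + s) - \1_(`]a, b[) x| +
       `|\1_(`]a', b'[) (x + s) - \1_(`]a', b'[) x|))).
      apply: intg_le; [by apply/L1_abs/L1B => //; exact: L1_translate|exact: L1D|].
      move=> x; rewrite /phi !phiE -/a -/b -/a' -/b'.
      apply: le_trans (ler_normB _ _); rewrite le_eqVlt; apply/orP; left; apply/eqP.
      by congr (`|_|); ring.
    rewrite intgD//; have := intg_itv_shift a b s0; have := intg_itv_shift a' b' s0.
    move: (intg _) (intg _) s1; move: (m.+1%:R^-1) => w p q; lra.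
have -> : intg (fun x => \1_(comb c) (m.+1%:R * x) * phi x) =
   c * intg phi + intg (fun x => phi x * combq c (m.+1%:R * x)).
  rewrite -intgZ// -intgD; [|exact: L1Z|].
    by apply: intg_ext => x; rewrite /combq; ring.
  by apply: (L1Mb iphi mq (k := 1)) => x; exact: combq_le1.
by rewrite lerD2l; exact: le_trans (ler_norm _) B.
Qed.

Definition tame f : Prop :=
  [/\ measurable_fun setT f, even f & exists M : R, forall x, `|f x| <= M].

Definition supported f (X X' : R) : Prop := forall x, ~~ (X <= `|x| < X') -> f x = 0.

Lemma L1_tame f X X' : tame f -> supported f X X' -> L1 f.
Proof.
move=> [mf _ [M fM]] sf; apply: (L1_bounded_support (N := X') mf fM) => x xX.
by apply: sf; rewrite negb_and -!leNgt (ltW xX) orbT.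
Qed.

Lemma L2_tame f X X' : tame f -> supported f X X' -> L2 f.
Proof.
move=> bf sf; have f1 := L1_tame bf sf; case: bf => mf _ [M fM]; split => //.
by apply: L1_ext (L1Mb f1 mf fM) => x; rewrite expr2.
Qed.

Lemma measurable_le_norm (Y : R) : measurable_fun setT (fun x : R => (Y <= `|x|)%R%:R : R).
Proof.
have -> : (fun x : R => (Y <= `|x|)%R%:R : R) = \1_([set x : R | Y <= `|x|]).
  by apply/funext => x; rewrite indicE; congr (nat_of_bool _)%:R; apply/idP/idP; rewrite inE.
apply: measurable_indic.
rewrite (_ : [set x : R | _] = setT `&` (fun x : R => `|x|) @^-1` `[Y, +oo[).
  have mn : measurable_fun setT (fun x : R => `|x|).
    by apply: continuous_measurable_fun; exact: norm_continuous.
  by apply: mn => //; exact: measurable_itv.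
by rewrite setTI; apply/seteqP; split => x /=; rewrite in_itv /= andbT.
Qed.

Lemma exists_tail h (Y e : R) : L2 h -> 0 < e -> exists2 Y' : R, Y < Y' &
  intg (fun x => (Y' <= `|x|)%R%:R * h x ^+ 2) <= e.
Proof.
move=> [mh h2] e0.
have : intg (fun x => (Y + n.+1%:R <= `|x|)%R%:R * h x ^+ 2) @[n --> \oo] --> intg (fun=> 0 : R).
  apply: (intg_dct _ _ _ h2).
  - move=> n; apply: measurable_funM; [exact: measurable_le_norm|exact: measurable_funX].
  - exact: measurable_cst.
  - apply/aeW => x; apply: cvg_near_cst; near=> n.
    have H : `|x| - Y < n%:R by near: n; exact: nbhs_infty_gtr.
    rewrite (_ : (Y + _ <= _) = false) ?mul0r//; apply/negbTE; rewrite -ltNge.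
    by rewrite -natr1; lra.
  - move=> n x; rewrite normrM (ger0_norm (sqr_ge0 (h x))) ler_piMl ?sqr_ge0//.
    by case: (Y + n.+1%:R <= `|x|); rewrite ?normr1 ?normr0.
rewrite intg0 => /cvgr0Pnorm_le/(_ e e0)[n _ /(_ n (leqnn n))] /= H.
by exists (Y + n.+1%:R); [rewrite ltrDl|exact: le_trans (ler_norm _) H].
Unshelve. all: by end_near. Qed.

(** In use, the part of the transform that is lost when it is cut off to the annulus of g; the
    square root is the norm of the fluctuation for f of norm 1, up to small errors. *)
Definition residual (T : set R) (c : R) f g : R -> R :=
  fun x => C (fun t => (\1_T t - c) * f t) x - Num.sqrt (c * (1 - c)) * g x.

(** At each fixed frequency the transform tends to 0 by [fejer]; it is bounded by the L^1 norm of f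
    and the ball is bounded, so dominated convergence applies. *)
Lemma small_on_ball f (c Y e : R) : 0 < c < 1 -> 0 <= Y -> 0 < e -> L1 f ->
  \forall m \near \oo,
    intg (fun xi => \1_(`[(- Y), Y]) xi * C (fun x => f x * combq c (m.+1%:R * x)) xi ^+ 2) <= e.
Proof.
move=> c01 Y0 e0 f1.
pose N := intg (fun x => `|f x|).
have mq m : measurable_fun setT (fun x : R => combq c (m.+1%:R * x)).
  by apply: measurableT_comp; [exact: measurable_combq|exact: measurable_funM].
have q1 m x : `|combq c (m.+1%:R * x)| <= 1 by exact: combq_le1.
have i1 m : L1 (fun x => f x * combq c (m.+1%:R * x)) by exact: (L1Mb f1 (mq m) (q1 m)).
have bN m xi : `|C (fun x => f x * combq c (m.+1%:R * x)) xi| <= N.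
  apply: le_trans (osc_bound cc kc _ (i1 m)) _; apply: intg_le; [exact: L1_abs|exact: L1_abs|].
  by move=> x; rewrite normrM ler_piMr.
have : intg (fun xi => \1_(`[(- Y), Y]) xi * C (fun x => f x * combq c (m.+1%:R * x)) xi ^+ 2)
    @[m --> \oo] --> intg (fun=> 0 : R).
  apply: (intg_dct _ _ _ (L1Z (N ^+ 2) (L1_itv true false (- Y) Y))).
  - move=> m; apply: measurable_funM; first exact: measurable_indic_itv.
    by apply: measurable_funX; exact: measurable_osc.
  - exact: measurable_cst.
  - apply/aeW => xi; have H : C (fun x => f x * combq c (m.+1%:R * x)) xi @[m --> \oo] --> (0 : R).
      apply/cvgr0Pnorm_le => d d0.
      have ifc := L1_osc cc kc xi f1.
      have := fejer ifc d0 (measurable_combq c) (fun x => combq_le1 x c01)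
        (fun y => combq_mean0 y c01).
      by apply: filterS => m; rewrite /osc; congr (`|_| <= _); apply: intg_ext => x; ring.
    rewrite [X in _ --> X](_ : 0 = \1_(`[(- Y), Y]) xi * (0 * 0) :> R); last by rewrite !mulr0.
    apply: cvgM; first exact: cvg_cst.
    exact: (cvgM H H).
  - move=> m xi; have a0 : 0 <= \1_(`[(- Y), Y]) xi :> R by rewrite indicE; case: (_ \in _).
    rewrite normrM (ger0_norm a0) mulrC normrX ler_wpM2r//.
    by rewrite lerXn2r ?nnegrE//; apply: le_trans (bN 0%N 0).
rewrite intg0 => /cvgr0Pnorm_le/(_ e e0); apply: filterS => m.
exact: le_trans (ler_norm _).
Qed.

(** The period comes first, fine enough for three purposes: density in every window, the squared
    norm of 1_T f, and little energy of the transform below Y. Only then is Y' chosen, beyond the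
    bulk of that transform. *)
Lemma step (c X X' Y d eta : R) f : 0 < c < 1 -> 0 <= X -> X <= X' -> 0 <= Y ->
  0 < d -> 0 < eta -> tame f -> supported f X X' ->
  exists (T : set R) (Y' : R) (g : R -> R),
  [/\ [/\ measurable T, (forall x, \1_T (- x) = \1_T x :> R), T `<=` ann X X' &
        forall u v : R, intg (fun x => \1_T x * \1_(`]u, v[) x) <=
          c * intg (fun x => \1_(ann X X') x * \1_(`]u, v[) x) + eta],
      [/\ Y < Y', tame g & supported g Y Y'] &
      [/\ `|ip (fun x => \1_T x * f x) (fun x => \1_T x * f x) - c * ip f f| <= d,
          `|ip g g - ip f f| <= d &
          L2 (residual T c f g) /\ ip (residual T c f g) (residual T c f g) <= d]].
Proof.
move=> c01 X0 XX Y0 d0 eta0 bf sf.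
have f1 := L1_tame bf sf; have f2 := L2_tame bf sf.
have /andP[c0 c1] := c01.
pose r2 := c * (1 - c); have r20 : 0 < r2 by rewrite mulr_gt0// subr_gt0.
have r21 : r2 <= 1 / 4 by have := sqr_ge0 (c - 1 / 2); rewrite /r2; nra.
(* The norm of g appears after division by [r2], hence this factor; the errors e from the
   oscillating term and 2 e from the residual stay below 4 e = r2 d. *)
pose e := r2 * d / 4.
have e0 : 0 < e by rewrite divr_gt0// mulr_gt0.
have ed : 4 * e <= d.
  by rewrite /e; have : r2 * d <= 1 / 4 * d; [rewrite ler_pM2r|lra].
have [m [mA mB mC]] : exists m : nat,
   [/\ `|intg (fun x => f x ^+ 2 * combq c (m.+1%:R * x))| <= e,
      intg (fun xi => \1_(`[(- Y), Y]) xi * C (fun x => f x * combq c (m.+1%:R * x)) xi ^+ 2) <= e &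
      4 / m.+1%:R <= eta].
  have HA := fejer f2.2 e0 (measurable_combq c) (fun x => combq_le1 x c01)
      (fun y => combq_mean0 y c01).
  have HB := small_on_ball c01 Y0 e0 f1.
  have HC : \forall m \near \oo, 4 / m.+1%:R <= eta.
    near=> m; rewrite ler_pdivrMr// mulrC -ler_pdivrMr//.
    apply: (@le_trans _ _ m%:R); last by rewrite ler_nat.
    by near: m; exact: nbhs_infty_ger.
  have [m [[hA hB] hC]] := filter_ex (filterI (filterI HA HB) HC).
  by exists m.
have mq : measurable_fun setT (fun x : R => combq c (m.+1%:R * x)).
  by apply: measurableT_comp; [exact: measurable_combq|exact: measurable_funM].
have q1 x : `|combq c (m.+1%:R * x)| <= 1 by exact: combq_le1.
pose T := ann X X' `&` [set x | comb c (m.+1%:R * x)].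
have mcomb : measurable [set x : R | comb c (m.+1%:R * x)].
  rewrite -[X in measurable X]setTI; apply: (@measurable_funM _ _ _ setT (fun=> m.+1%:R) id) => //.
  exact: measurable_comb.
have mT : measurable_fun setT (\1_T : R -> R).
  by apply: measurable_indic; apply: measurableI => //; exact: measurable_ann.
have TE x : \1_T x = \1_(ann X X') x * \1_(comb c) (m.+1%:R * x) :> R.
  by rewrite /T indicI.
(* Since f already lives on the annulus, T acts on it as the full periodic comb. *)
have Tf x : \1_T x * f x = \1_(comb c) (m.+1%:R * x) * f x.
  rewrite TE indic_annE; case: (boolP (X <= `|x| < X')) => xX; first by rewrite mul1r.
  by rewrite (sf x xX) !mulr0.
pose F x := f x * combq c (m.+1%:R * x).
have FE : (fun t => (\1_T t - c) * f t) = F.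
  by apply/funext => t; rewrite mulrBl Tf /F /combq; ring.
have F1 : L1 F by exact: (L1Mb f1 mq q1).
have F2 : L2 F by exact: (L2Mb f2 mq q1).
have Fe : even F.
  by move=> x; rewrite /F /combq mulrN comb_oppE; case: bf => _ -> _.
have [h2 hE] := even_isometry F1 F2 Fe; set h := C F in h2 hE.
have [Y' YY' tail] := exists_tail Y h2 e0.
pose r := Num.sqrt r2.
have r0 : 0 < r by rewrite sqrtr_gt0.
have rr : r ^+ 2 = r2 by rewrite sqr_sqrtr// ltW.
pose g x := r^-1 * (\1_(ann Y Y') x * h x).
have resE : residual T c f g = fun x => (1 - \1_(ann Y Y') x) * h x.
  apply/funext => x; rewrite /residual FE -/h /g -/r2 -/r mulrA divff ?gt_eqF//; ring.
have ma : measurable_fun setT (\1_(ann Y Y') : R -> R).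
  by apply: measurable_indic; exact: measurable_ann.
have a1 x : `|\1_(ann Y Y') x| <= 1 :> R.
  by rewrite indicE; case: (_ \in _); rewrite ?normr1 ?normr0.
have lah : L2 (fun x => \1_(ann Y Y') x * h x).
  by apply: L2_ext (L2Mb h2 ma a1) => x; rewrite mulrC.
have lres : L2 (residual T c f g).
  by rewrite resE; apply: L2_ext (L2B h2 lah) => x; ring.
(* The residual is h off the annulus: its low frequencies are controlled by the choice of m, its
   high ones by the choice of Y'. *)
have resS : ip (residual T c f g) (residual T c f g) <= 2 * e.
  apply: (@le_trans _ _ (intg (fun x => \1_(`[(- Y), Y]) x * h x ^+ 2 + (Y' <= `|x|)%R%:R * h x ^+ 2))).
    have i1 : L1 (fun x => \1_(`[(- Y), Y]) x * h x ^+ 2).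
      apply: L1_ext (L1Mb h2.2 (measurable_indic_itv `[(- Y), Y]) (k := 1) _) => x.
        exact: mulrC.
      by rewrite indicE; case: (_ \in _); rewrite ?normr1 ?normr0.
    have i2 : L1 (fun x => (Y' <= `|x|)%R%:R * h x ^+ 2).
      apply: L1_ext (L1Mb h2.2 (measurable_le_norm Y') (k := 1) _) => x.
        exact: mulrC.
      by case: (Y' <= `|x|); rewrite ?normr1 ?normr0.
    apply: intg_le; [exact: L2_mul|exact: L1D|].
    move=> x; rewrite resE indic_annE indic_itvE in_itv /= -ler_norml.
    have := sqr_ge0 (h x); have [h3|h3] := leP Y `|x|; have [h4|h4] := leP Y' `|x|;
      case: (leP `|x| Y) => h5 /=; rewrite ?subr0 ?subrr ?mul0r ?mul1r ?add0r ?addr0 -?expr2; clear -h3 h4 h5; lra.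
  have i1 : L1 (fun x => \1_(`[(- Y), Y]) x * h x ^+ 2).
    apply: L1_ext (L1Mb h2.2 (measurable_indic_itv `[(- Y), Y]) (k := 1) _) => x.
      exact: mulrC.
    by rewrite indicE; case: (_ \in _); rewrite ?normr1 ?normr0.
  have i2 : L1 (fun x => (Y' <= `|x|)%R%:R * h x ^+ 2).
    apply: L1_ext (L1Mb h2.2 (measurable_le_norm Y') (k := 1) _) => x.
      exact: mulrC.
    by case: (Y' <= `|x|); rewrite ?normr1 ?normr0.
  rewrite intgD//; move: mB tail; rewrite -/F -/h; move: (intg _) (intg _) => p q; lra.
set K := intg _ in mA.
(* The fluctuation q, with values 1 - c and -c, satisfies q^2 = (1 - 2 c) q + c (1 - c); the linear
   term integrates to the small K. *)
have ipF : ip F F = (1 - 2 * c) * K + r2 * ip f f.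
  have i0 : L1 (fun x => f x ^+ 2 * combq c (m.+1%:R * x)) by exact: (L1Mb f2.2 mq q1).
  rewrite (ipxx f) /K -(intgZ (1 - 2 * c) i0) -(intgZ r2 f2.2).
  rewrite -intgD; [|exact: L1Z|exact: (L1Z _ f2.2)].
  apply: intg_ext => x; rewrite /F /combq indic_combE /r2; case: (_ < _) => /=; ring.
have ipT : ip (fun x => \1_T x * f x) (fun x => \1_T x * f x) - c * ip f f = K.
  have i0 : L1 (fun x => \1_T x * f x ^+ 2).
    apply: L1_ext (L1Mb f2.2 mT (k := 1) _) => x; first exact: mulrC.
    by rewrite indicE; case: (_ \in _); rewrite ?normr1 ?normr0.
  rewrite (_ : ip _ _ = intg (fun x => \1_T x * f x ^+ 2)).
    rewrite (ipxx f) -(intgZ c f2.2) -(intgB i0 (L1Z c f2.2)).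
    apply: intg_ext => x.
    have -> : \1_T x * f x ^+ 2 = (\1_T x * f x) * f x by ring.
    by rewrite Tf /combq; ring.
  by apply: intg_ext => x; rewrite indicE; case: (_ \in _) => /=; ring.
(* Pythagoras: r g and the residual have disjoint supports and add up to h. *)
have ipg : ip g g = r2^-1 * (ip F F - ip (residual T c f g) (residual T c f g)).
  have i2 : L1 (fun x => residual T c f g x ^+ 2) by exact: lres.2.
  have i1 : L1 (fun x => h x ^+ 2) by exact: h2.2.
  rewrite -hE !ipxx -(intgB i1 i2) -(intgZ r2^-1 (L1B i1 i2)).
  apply: intg_ext => x; rewrite resE /g indic_annE -rr.
  by case: (_ <= _ < _) => /=; field; exact: lt0r_neq0.
exists T, Y', g; split.
- split.
  + apply: measurableI; first exact: measurable_ann.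
    exact: mcomb.
  + by move=> x; rewrite !TE !indic_annE normrN mulrN comb_oppE.
  + by move=> x [].
  + move=> u v; rewrite (intg_ext (g := fun x => \1_(comb c) (m.+1%:R * x) * (\1_(ann X X') x * \1_(`]u, v[) x))).
      by apply: le_trans (comb_density u v m X0 XX c01) _; rewrite lerD2l.
    by move=> x; rewrite TE; ring.
- split => //.
  + split.
    * by apply: measurable_funM => //; apply: measurable_funM => //; exact: h2.1.
    * by move=> x; rewrite /g !indic_annE normrN /h osc_cosN.
    * exists (r^-1 * intg (fun x => `|F x|)) => x.
      rewrite /g normrM (ger0_norm (ltW _)) ?invr_gt0// ler_wpM2l ?invr_ge0 ?(ltW r0)//.
      rewrite normrM; apply: le_trans (osc_bound cc kc x F1).
      by rewrite ler_piMl.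
  + by move=> x xY; rewrite /g indic_annE (negbTE xY) mul0r mulr0.
- split.
  + by rewrite ipT (le_trans mA)//; lra.
  + have R0 := ip_ge0 (residual T c f g).
    rewrite ipg ipF; clear ipg ipF ipT; move: mA resS R0; move: (ip (residual _ _ _ _) _) (ip f f) => p q.
    move: K => K mA resS R0.
    have -> : r2^-1 * ((1 - 2 * c) * K + r2 * q - p) - q = r2^-1 * ((1 - 2 * c) * K - p).
      by field; rewrite gt_eqF.
    rewrite normrM ger0_norm ?invr_ge0 ?(ltW r20)// mulrC ler_pdivrMr//.
    have -> : d * r2 = 4 * e by rewrite /e; field.
    apply: (le_trans (ler_normB _ _)); rewrite normrM (ger0_norm R0).
    have : `|1 - 2 * c| * `|K| <= 1 * e.
      by apply: ler_pM => //; rewrite ler_norml; lra.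
    lra.
  + by split => //; apply: le_trans resS _; lra.
Unshelve. all: by end_near. Qed.

End Step.

(** * The chain of layers and its Gram matrix *)

Section Chain.
Variable R : realType.
Implicit Types (f g : R -> R) (T : set R).

(** All that thinness needs of periodicity is the last clause, whose error is uniform in the
    window. *)
Definition layer (c eta X X' : R) T : Prop :=
  [/\ measurable T, (forall x, \1_T (- x) = \1_T x :> R), T `<=` ann X X' &
      forall u v : R, intg (fun x => \1_T x * \1_(`]u, v[) x) <=
        c * intg (fun x => \1_(ann X X') x * \1_(`]u, v[) x) + eta].

Definition restr T f : R -> R := fun x => \1_T x * f x.

Definition link (c d : R) T f g : Prop :=
  [/\ `|ip (restr T f) (restr T f) - c * ip f f| <= d,
      `|ip g g - ip f f| <= d &
      L2 (residual T c f g) /\ ip (residual T c f g) (residual T c f g) <= d].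

(** The admissible error [eta] is a function because it has to shrink with the outer radius of the
    annulus, which becomes known only during the recursion. *)
Lemma chain (c : nat -> R) (d : R) (eta : R -> R) f0 :
  (forall i, 0 < c i < 1) -> 0 < d -> (forall x, 0 < eta x) ->
  tame f0 -> supported f0 0 1 ->
  exists (r : nat -> R) (T : nat -> set R) (f : nat -> R -> R), f 0%N = f0 /\
  forall i, [/\ 0 <= r i, r i <= r i.+2, tame (f i) & supported (f i) (r i) (r i.+2)] /\
    layer (c i) (eta (r i.+2)) (r i) (r i.+2) (T i) /\ link (c i) d (T i) (f i) (f i.+1).
Proof.
move=> c01 d0 eta0 bf0 sf0.
(* The state is (r_i, r_{i+1}, r_{i+2}, f_i). The radius r_{i+1} is where layer i-1 ends and where
   f_{i+1} has to start, as both lie on the same side. *)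
pose inv (s : R * R * R * (R -> R)) :=
  [/\ 0 <= s.1.1.1, 0 <= s.1.1.2, s.1.1.1 <= s.1.2, tame s.2 & supported s.2 s.1.1.1 s.1.2].
have /choice[F HF] : forall p : nat * (R * R * R * (R -> R)), exists q : set R * R * (R -> R),
  inv p.2 ->
  [/\ layer (c p.1) (eta p.2.1.2) p.2.1.1.1 p.2.1.2 q.1.1,
     [/\ p.2.1.1.2 < q.1.2, tame q.2 & supported q.2 p.2.1.1.2 q.1.2] &
     link (c p.1) d q.1.1 p.2.2 q.2].
  move=> [i s]; have [H|H] := pselect (inv s); last by exists (set0, 0, fun=> 0).
  case: (H) => X0 P0 XX bf sf.
  have [T [Y' [g [HT Hg HL]]]] := step (c01 i) X0 XX P0 d0 (eta0 s.1.2) bf sf.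
  by exists (T, Y', g).
pose nxt i s := let q := F (i, s) in (s.1.1.2, s.1.2, q.1.2, q.2).
(* Both sides start at radius 0; the first annulus ends at 1, which contains the support of [f0]. *)
pose st := fix st n := if n is n'.+1 then nxt n' (st n') else (0 : R, 0 : R, 1 : R, f0).
have Hst i : inv (st i).
  elim: i => [|i IH]; first by split => //=; rewrite ?lexx ?ler01.
  have [_ [PY bg sg] _] := HF (i, st i) IH; case: IH => X0 P0 XX bf sf.
  by split => //=; [exact: le_trans XX|exact: ltW].
exists (fun i => (st i).1.1.1), (fun i => (F (i, st i)).1.1), (fun i => (st i).2).
split => // i; have [H1 [PY bg sg] H2] := HF (i, st i) (Hst i).
by case: (Hst i) => X0 P0 XX bf sf; split.
Qed.

End Chain.

(** * Approximate orthogonality and the Gram matrix *)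

Section Gram.
Variable R : realType.
Implicit Types (u v e g : R -> R).

Local Notation C := (osc (@cos R)).
Let kc (x : R) := @cos_max R x.
Let cc := @continuous_cos R.

(** Links are used with error [d ^+ 2], so that residuals have norm at most d; the factor sqrt 2
    from u is rounded up to 2. *)
Lemma ip_small u e (d : R) : 0 <= d -> L2 u -> L2 e -> ip u u <= 2 -> ip e e <= d ^+ 2 ->
  `|ip u e| <= 2 * d.
Proof.
move=> d0 lu le_ hu he; apply: (le_trans (ip_norm_le lu le_)).
apply: ler_pM; rewrite ?sqrtr_ge0//.
  rewrite -[leRHS]ger0_norm// -sqrtr_sqr ler_sqrt ?sqr_ge0// (le_trans hu)//; lra.
by rewrite -[leRHS]ger0_norm// -sqrtr_sqr ler_sqrt ?sqr_ge0.
Qed.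

Lemma supported_disjoint u v (X X' Y Y' : R) : supported u X X' -> supported v Y Y' -> X' <= Y ->
  ip u v = 0.
Proof.
move=> su sv XY; rewrite /ip -[RHS](intg0 R); apply: intg_ext => x.
have [h|h] := ltP `|x| X'.
  by rewrite sv ?mulr0// negb_and -ltNge (lt_le_trans h XY).
by rewrite su ?mul0r// negb_and -leNgt orbC h.
Qed.

Variables (a b d : R) (n : nat) (r : nat -> R) (T : nat -> set R) (f : nat -> R -> R).
Variable eta : R -> R.
Hypotheses (a01 : 0 < a < 1) (b01 : 0 < b < 1) (d0 : 0 < d) (d1 : d <= 1).
Hypothesis dn : n.*2%:R * d <= 1.

(** Even layers belong to F, odd ones to E. *)
Definition dens (i : nat) : R := if odd i then a else b.

Hypothesis f0 : ip (f 0%N) (f 0%N) = 1.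
Hypothesis hf : forall i,
  [/\ 0 <= r i, r i <= r i.+2, tame (f i) & supported (f i) (r i) (r i.+2)] /\
    layer (dens i) (eta (r i.+2)) (r i) (r i.+2) (T i) /\
    link (dens i) (d ^+ 2) (T i) (f i) (f i.+1).

Let p i := restr (T i) (f i).
Let sq i : R := Num.sqrt (dens i * (1 - dens i)).

Lemma dens01 i : 0 < dens i < 1.
Proof. by rewrite /dens; case: odd. Qed.

Lemma sq_bounds i : 0 < sq i <= 1.
Proof.
have /andP[c0 c1] := dens01 i; rewrite sqrtr_gt0 mulr_gt0 ?subr_gt0//=.
by rewrite -sqrtr1 ler_sqrt// mulr_ile1 ?subr_ge0 ?ltW//; lra.
Qed.

Lemma f_tame i : tame (f i). Proof. by case: (hf i) => -[]. Qed.

Lemma f_supp i : supported (f i) (r i) (r i.+2). Proof. by case: (hf i) => -[]. Qed.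

Lemma f_L1 i : L1 (f i). Proof. exact: L1_tame (f_tame i) (@f_supp i). Qed.

Lemma f_L2 i : L2 (f i). Proof. exact: L2_tame (f_tame i) (@f_supp i). Qed.

Lemma f_even i : even (f i). Proof. by case: (f_tame i). Qed.

Lemma T_layer i : layer (dens i) (eta (r i.+2)) (r i) (r i.+2) (T i).
Proof. by case: (hf i) => _ []. Qed.

Lemma measurable_T i : measurable (T i). Proof. by case: (T_layer i). Qed.

Lemma T_le1 i x : `|\1_(T i) x| <= 1 :> R.
Proof. by rewrite indicE; case: (_ \in _); rewrite ?normr1 ?normr0. Qed.

Lemma p_tame i : tame (p i).
Proof.
have [mf ef [M fM]] := f_tame i; have [mT eT _ _] := T_layer i; split.
- by apply: measurable_funM => //; exact: measurable_indic.
- by move=> x; rewrite /p /restr eT ef.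
- exists M => x; rewrite /p /restr normrM; apply: le_trans (fM x).
  by rewrite ler_piMl ?T_le1.
Qed.

Lemma p_supp i : supported (p i) (r i) (r i.+2).
Proof. by move=> x /(@f_supp i); rewrite /p /restr => ->; rewrite mulr0. Qed.

Lemma p_L1 i : L1 (p i). Proof. exact: L1_tame (p_tame i) (@p_supp i). Qed.
Lemma p_L2 i : L2 (p i). Proof. exact: L2_tame (p_tame i) (@p_supp i). Qed.
Lemma p_even i : even (p i). Proof. by case: (p_tame i). Qed.

Lemma r_mono i k : r i <= r (i + k.*2).
Proof.
elim: k => [|k IH]; first by rewrite addn0.
by rewrite doubleS !addnS; apply: (le_trans IH); case: (hf (i + k.*2)) => -[].
Qed.

Lemma r_gap i j : (i < j)%N -> odd i = odd j -> r i.+2 <= r j.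
Proof.
move=> ij oij; have ev : ~~ odd (j - i) by rewrite oddB ?(ltnW ij)// oij addbb.
have -> : j = (i.+2 + ((j - i)./2.-1).*2)%N.
  have := odd_double_half (j - i); rewrite (negbTE ev) add0n.
  have : (0 < j - i)%N by rewrite subn_gt0.
  case: (_./2) => [|k] /=; first by move=> + E; rewrite -E.
  by rewrite doubleS => _ E; rewrite !addSn -!addnS E subnKC// ltnW.
exact: r_mono.
Qed.

Lemma ip_disjoint u v i j : supported u (r i) (r i.+2) -> supported v (r j) (r j.+2) ->
  odd i = odd j -> i != j -> ip u v = 0.
Proof.
wlog ij : u v i j / (i < j)%N.
  move=> H su sv oij nij; case: (ltngtP i j) nij => // ij _.
    by apply: (H _ _ i j ij su sv oij); rewrite ltn_eqF.
  by rewrite ipC; apply: (H _ _ j i ij sv su (esym oij)); rewrite ltn_eqF.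
by move=> su sv oij _; apply: supported_disjoint su sv _; exact: r_gap.
Qed.

Lemma ip_ff i : `|ip (f i) (f i) - 1| <= i%:R * d ^+ 2.
Proof.
elim: i => [|i IH]; first by rewrite f0 subrr normr0 mul0r.
have [_ [_ [_ H _]]] := hf i.
rewrite -natr1 mulrDl mul1r.
have -> : ip (f i.+1) (f i.+1) - 1 = (ip (f i.+1) (f i.+1) - ip (f i) (f i)) + (ip (f i) (f i) - 1).
  by ring.
by apply: (le_trans (ler_normD _ _)); rewrite addrC lerD.
Qed.

Lemma ip_ff_small i : (i <= n.*2)%N -> `|ip (f i) (f i) - 1| <= n.*2%:R * d ^+ 2.
Proof.
by move=> i_n; apply: (le_trans (ip_ff i)); rewrite ler_wpM2r ?sqr_ge0// ler_nat.
Qed.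

Lemma d2_small : n.*2%:R * d ^+ 2 <= 1.
Proof.
rewrite expr2 mulrA; apply: le_trans dn; rewrite ler_piMr// mulr_ge0//; exact: ltW.
Qed.

Lemma ip_ff_le2 i : (i <= n.*2)%N -> ip (f i) (f i) <= 2.
Proof.
by move=> /ip_ff_small/(le_trans (ler_norm _)); have := d2_small; lra.
Qed.

Lemma ip_pp i : (i <= n.*2)%N -> `|ip (p i) (p i) - dens i| <= (n.*2%:R + 1) * d ^+ 2.
Proof.
move=> i_n; have [_ [_ [H _ _]]] := hf i; have Hf := ip_ff_small i_n.
have /andP[c0 c1] := dens01 i.
have -> : ip (p i) (p i) - dens i =
  (ip (p i) (p i) - dens i * ip (f i) (f i)) + dens i * (ip (f i) (f i) - 1) by ring.
apply: (le_trans (ler_normD _ _)); rewrite normrM (ger0_norm (ltW c0)).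
have H1 : dens i * `|ip (f i) (f i) - 1| <= 1 * (n.*2%:R * d ^+ 2).
  by apply: ler_pM => //; exact: ltW.
by rewrite mul1r in H1; rewrite mulrDl mul1r addrC; exact: lerD.
Qed.

Lemma ip_pp_le2 i : (i <= n.*2)%N -> ip (p i) (p i) <= 2.
Proof.
move=> i_n; apply: le_trans (ip_ff_le2 i_n); apply: intg_le.
- exact: L2_mul (p_L2 i) (p_L2 i).
- exact: L2_mul (f_L2 i) (f_L2 i).
- move=> x; rewrite /p /restr indicE; case: (_ \in _); rewrite /= ?mul1r// !mul0r.
  by rewrite -expr2 sqr_ge0.
Qed.

Let e i := residual (T i) (dens i) (f i) (f i.+1).

Lemma e_L2 i : L2 (e i). Proof. by case: (hf i) => _ [_ [_ _ []]]. Qed.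

Lemma e_small i : ip (e i) (e i) <= d ^+ 2. Proof. by case: (hf i) => _ [_ [_ _ []]]. Qed.

Let w i := fun x => (\1_(T i) x - dens i) * f i x.

Lemma w_L1 i : L1 (w i).
Proof.
apply: L1_ext (L1B (p_L1 i) (L1Z (dens i) (f_L1 i))) => x.
by rewrite /w /p /restr; ring.
Qed.

Lemma w_L2 i : L2 (w i).
Proof.
apply: L2_ext (L2B (p_L2 i) (L2Z (dens i) (f_L2 i))) => x.
by rewrite /w /p /restr; ring.
Qed.

Lemma w_even i : even (w i).
Proof.
by move=> x; have [_ eT _ _] := T_layer i; rewrite /w eT f_even.
Qed.

Lemma C_wE i x : C (w i) x = sq i * f i.+1 x + e i x.
Proof. by rewrite /e /residual /sq /w; ring. Qed.

(** Splitting 1_T into density and fluctuation: the density keeps C f_i, the fluctuation is carried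
    to f_{i+1}. This recursion generates the whole Gram matrix. *)
Lemma C_pE i x : C (p i) x = dens i * C (f i) x + (sq i * f i.+1 x + e i x).
Proof.
rewrite -C_wE -oscZ; [|exact: cc|exact: kc|exact: f_L1].
rewrite -oscD; [|exact: cc|exact: kc|exact: L1Z (f_L1 i)|exact: w_L1].
by congr (C _ x); apply/funext => y; rewrite /p /w /restr; ring.
Qed.

Lemma C_f_L2 i : L2 (C (f i)).
Proof. by have [] := even_isometry (f_L1 i) (f_L2 i) (@f_even i). Qed.

Lemma ip_C_le2 i : (i <= n.*2)%N -> ip (C (f i)) (C (f i)) <= 2.
Proof.
by move=> i_n; have [_ ->] := even_isometry (f_L1 i) (f_L2 i) (@f_even i); exact: ip_ff_le2.
Qed.

Lemma ip_Cp i g : L2 g ->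
  ip (C (p i)) g = dens i * ip (C (f i)) g + sq i * ip (f i.+1) g + ip (e i) g.
Proof.
move=> lg; have l1 := C_f_L2 i; have l2 := f_L2 i.+1; have l3 := e_L2 i.
rewrite (_ : C (p i) = fun x => dens i * C (f i) x + (sq i * f i.+1 x + e i x)).
  rewrite ipDl//; [|exact: L2Z|by apply: L2D => //; exact: L2Z].
  by rewrite ipDl//; [rewrite !ipZl// addrA|exact: L2Z].
by apply/funext => x; rewrite C_pE.
Qed.

(** Within one layer this is the density clause of the link; distinct layers of equal parity have
    disjoint annuli. *)
Lemma ip_f_w i j : odd i = odd j -> (i <= n.*2)%N -> `|ip (f i) (w j)| <= d ^+ 2.
Proof.
move=> oij i_n; have [<-|nij] := eqVneq i j.
  have [_ [_ [H _ _]]] := hf i; apply: le_trans H; rewrite le_eqVlt; apply/orP; left; apply/eqP.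
  congr (`|_|); rewrite -[restr _ _]/(p i).
  have -> : ip (p i) (p i) = ip (f i) (p i).
    by apply: intg_ext => x; rewrite /p /restr indicE; case: (_ \in _); rewrite /= ?mul1r// !mul0r mulr0.
  rewrite -(ipZr _ (f_L2 i) (f_L2 i)) -ipBr; [|exact: p_L2|exact: L2Z (f_L2 i)|exact: f_L2].
  by apply: intg_ext => x; rewrite /w /p /restr; ring.
rewrite (@ip_disjoint _ _ i j) ?normr0 ?sqr_ge0//; first exact: f_supp.
by move=> x /(@f_supp j); rewrite /w => ->; rewrite mulr0.
Qed.

(* C (f j.+1) is close to a multiple of C (C (w j)) = w j, which is almost orthogonal to f i. *)
Lemma ip_Cf_f i j : odd i = odd j -> (i <= n.*2)%N ->
  sq j * `|ip (C (f i)) (f j.+1)| <= 3 * d.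
Proof.
move=> oij i_n; have /andP[s0 _] := sq_bounds j.
have l1 := C_f_L2 i; have l2 := f_L2 j.+1; have l3 := e_L2 j.
have E : sq j * ip (C (f i)) (f j.+1) = ip (f i) (w j) - ip (C (f i)) (e j).
  rewrite -(even_parseval (f_L1 i) (f_L2 i) (@f_even i) (w_L1 j) (w_L2 j) (@w_even j)).
  rewrite (_ : C (w j) = fun x => sq j * f j.+1 x + e j x).
    rewrite ipDr//; last exact: L2Z.
    by rewrite ipZr//; ring.
  by apply/funext => x; rewrite C_wE.
rewrite -[X in X * _](ger0_norm (ltW s0)) -normrM E; apply: (le_trans (ler_normB _ _)).
have h1 := ip_f_w oij i_n.
have h2 := ip_small (ltW d0) l1 l3 (ip_C_le2 i_n) (e_small j).
have : d ^+ 2 <= d by rewrite expr2 ler_piMr// ltW.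
lra.
Qed.

Definition kron (i j : nat) : R := (i == j)%:R.

(** Unfold C p_{2j} by [C_pE], move the remaining C across, and unfold C p_{2k+1}. Two products
    survive: f_{2j+1} against p_{2k+1}, close to a for j = k, and f_{2k+2} against f_{2j}, close to
    1 for j = k + 1. The quotient in the error bound stems from [ip_Cf_f] and is harmless because d
    is chosen last. *)
Lemma gram (j k : nat) : (j < n)%N -> (k < n)%N ->
  `|ip (C (p j.*2)) (p k.*2.+1) -
    (kron j k * (sq j.*2 * a) + kron j k.+1 * (b * sq k.*2.+1))|
   <= (5 + n.*2%:R *+ 2 + 3 / sq k.*2) * d.
Proof.
move=> jn kn.
have jn2 : (j.*2 <= n.*2)%N by rewrite leq_double ltnW.
have kn2 : (k.*2.+1 <= n.*2)%N by rewrite -ltn_double in kn; exact: leq_trans kn _.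
have dj : dens j.*2 = b by rewrite /dens odd_double.
have dk : dens k.*2.+1 = a by rewrite /dens /= odd_double.
have oj : odd j.*2 = odd k.*2.+2 by rewrite /= !odd_double.
have oj1 : odd j.*2.+1 = odd k.*2.+1 by rewrite /= !odd_double.
have ojk : odd j.*2 = odd k.*2 by rewrite !odd_double.
have dd : d ^+ 2 <= d by rewrite expr2 ler_piMr// ltW.
have n20 : 0 <= n.*2%:R :> R by [].
have x1 : `|ip (C (f k.*2.+1)) (f j.*2)| <= 3 / sq k.*2 * d.
  have /andP[s0 _] := sq_bounds k.*2.
  have := ip_Cf_f ojk jn2; rewrite (ip_osc_cos (f_L1 k.*2.+1) (f_L1 _)) ipC => H.
  by rewrite mulrAC ler_pdivlMr// mulrC.
have x2 : `|ip (f k.*2.+2) (f j.*2) - kron j k.+1| <= n.*2%:R * d.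
  rewrite /kron; have [->|njk] := eqVneq j k.+1.
    apply: (le_trans (ip_ff_small _)); last by rewrite ler_wpM2l.
    by rewrite -doubleS leq_double.
  rewrite (@ip_disjoint _ _ k.*2.+2 j.*2) ?subrr ?normr0 ?mulr_ge0 ?(ltW d0)//;
    [exact: f_supp|exact: f_supp|].
  by rewrite -doubleS; apply: contra_neq njk => /double_inj.
have x3 : `|ip (e k.*2.+1) (f j.*2)| <= 2 * d.
  by rewrite ipC; apply: ip_small (ltW d0) (f_L2 _) (e_L2 _) (ip_ff_le2 jn2) (e_small _).
have x4 : `|ip (f j.*2.+1) (p k.*2.+1) - kron j k * a| <= (n.*2%:R + 1) * d.
  rewrite /kron; have [jk|njk] := eqVneq j k.
    rewrite jk mul1r (_ : ip _ _ = ip (p k.*2.+1) (p k.*2.+1)).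
      rewrite -dk; apply: (le_trans (ip_pp kn2)); rewrite ler_wpM2l// addr_ge0//.
    by apply: intg_ext => x; rewrite /p /restr indicE; case: (_ \in _); rewrite /= ?mul1r// !mul0r mulr0.
  rewrite (@ip_disjoint _ _ j.*2.+1 k.*2.+1) ?mul0r ?subrr ?normr0 ?mulr_ge0 ?addr_ge0 ?(ltW d0)//;
    [exact: f_supp|exact: p_supp|].
  by apply: contra_neq njk => -[] /double_inj.
have x5 : `|ip (e j.*2) (p k.*2.+1)| <= 2 * d.
  by rewrite ipC; apply: ip_small (ltW d0) (p_L2 _) (e_L2 _) (ip_pp_le2 kn2) (e_small _).
rewrite (ip_Cp _ (p_L2 _)).
rewrite (ip_osc_cos (f_L1 j.*2) (p_L1 _)) (ipC (f j.*2)) (ip_Cp _ (f_L2 _)) dj dk.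
move: x1 x2 x3 x4 x5.
move: (ip (C (f k.*2.+1)) _) (ip (f k.*2.+2) _) (ip (e k.*2.+1) _) => y1 y2 y3.
move: (ip (f j.*2.+1) _) (ip (e j.*2) _) (kron j k) (kron j k.+1) => y4 y5 k1 k2 x1 x2 x3 x4 x5.
have -> : b * (a * y1 + sq k.*2.+1 * y2 + y3) + sq j.*2 * y4 + y5 -
    (k1 * (sq j.*2 * a) + k2 * (b * sq k.*2.+1)) =
    b * (a * y1 + sq k.*2.+1 * (y2 - k2) + y3) + sq j.*2 * (y4 - k1 * a) + y5 by ring.
have absorb (s z B : R) : 0 <= s <= 1 -> `|z| <= B -> `|s * z| <= B.
  move=> /andP[s0 s1] zB; rewrite normrM (ger0_norm s0).
  by apply: le_trans zB; rewrite ler_piMl.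
have a1 : 0 <= a <= 1 by case/andP: a01 => ? ?; rewrite !ltW.
have b1 : 0 <= b <= 1 by case/andP: b01 => ? ?; rewrite !ltW.
have sq1 i : 0 <= sq i <= 1 by have /andP[? ->] := sq_bounds i; rewrite ltW.
have -> : (5 + n.*2%:R *+ 2 + 3 / sq k.*2) * d =
    (3 / sq k.*2 * d + n.*2%:R * d + 2 * d) + (n.*2%:R + 1) * d + 2 * d.
  by rewrite mulr2n; move: (3 / _) => z; ring.
apply: (le_trans (ler_normD _ _)); apply: lerD => //.
apply: (le_trans (ler_normD _ _)); apply: lerD; last exact: (absorb _ _ _ (sq1 _)).
apply: (absorb _ _ _ b1).
apply: (le_trans (ler_normD _ _)); apply: lerD => //.
apply: (le_trans (ler_normD _ _)); apply: lerD.
  exact: (absorb _ _ _ a1).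
exact: (absorb _ _ _ (sq1 _)).
Qed.

Definition upper x : R := \sum_(j < n) p j.*2 x.
Definition lower x : R := \sum_(k < n) p k.*2.+1 x.

Lemma upper_L1 : L1 upper. Proof. by apply: L1_sum => j; exact: p_L1. Qed.
Lemma upper_L2 : L2 upper. Proof. by apply: L2_sum => j; exact: p_L2. Qed.
Lemma lower_L2 : L2 lower. Proof. by apply: L2_sum => j; exact: p_L2. Qed.

Lemma upper_even : even upper.
Proof. by move=> x; apply: eq_bigr => j _; exact: p_even. Qed.

Lemma upper_out x : (forall j, (j < n)%N -> ~ T j.*2 x) -> upper x = 0.
Proof.
move=> H; apply: big1 => j _; rewrite /p /restr indicE memNset ?mul0r//.
by apply: H; exact: ltn_ord.
Qed.

Lemma lower_out x : (forall k, (k < n)%N -> ~ T k.*2.+1 x) -> lower x = 0.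
Proof.
move=> H; apply: big1 => j _; rewrite /p /restr indicE memNset ?mul0r//.
by apply: H; exact: ltn_ord.
Qed.

Lemma ip_sum_diag (c : R) (idx : nat -> nat) : injective idx ->
  (forall j, (j < n)%N -> (idx j <= n.*2)%N) ->
  (forall j, dens (idx j) = c) -> (forall i j, odd (idx i) = odd (idx j)) ->
  `|ip (fun x => \sum_(j < n) p (idx j) x) (fun x => \sum_(j < n) p (idx j) x) - n%:R * c| <= n%:R * ((n.*2%:R + 1) * d).
Proof.
move=> inj le_n dc oc; set u := fun x => _.
have lp (j : 'I_n) : L2 (p (idx j)) by exact: p_L2.
have lu : L2 u by exact: L2_sum.
have dd : d ^+ 2 <= d by rewrite expr2 ler_piMr// ltW.
have -> : ip u u = \sum_(j < n) ip (p (idx j)) (p (idx j)).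
  rewrite ip_suml//; apply: eq_bigr => j _; rewrite ip_sumr// (bigD1 j)//= big1 ?addr0//.
  move=> i ij; apply: (@ip_disjoint _ _ (idx j) (idx i)); [exact: p_supp|exact: p_supp|exact: oc|].
  by apply: contra ij => /eqP/inj/val_inj ->.
have -> : n%:R * c = \sum_(j < n) c by rewrite sumr_const card_ord mulr_natl.
rewrite -sumrB; apply: (le_trans (ler_norm_sum _ _ _)).
have -> : n%:R * ((n.*2%:R + 1) * d) = \sum_(j < n) ((n.*2%:R + 1) * d).
  by rewrite sumr_const card_ord mulr_natl.
apply: ler_sum => j _; rewrite -(dc j); apply: (le_trans (ip_pp _)).
  by apply: le_n; exact: ltn_ord.
by rewrite ler_wpM2l// addr_ge0.
Qed.

Lemma ip_upper : `|ip upper upper - n%:R * b| <= n%:R * ((n.*2%:R + 1) * d).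
Proof.
apply: (@ip_sum_diag b (fun j => j.*2)).
- exact: double_inj.
- by move=> j jn; rewrite leq_double ltnW.
- by move=> j; rewrite /dens odd_double.
- by move=> i j; rewrite !odd_double.
Qed.

Lemma ip_lower : `|ip lower lower - n%:R * a| <= n%:R * ((n.*2%:R + 1) * d).
Proof.
apply: (@ip_sum_diag a (fun j => j.*2.+1)).
- by move=> i j [] /double_inj.
- by move=> j jn; rewrite -ltn_double in jn; exact: leq_trans jn _.
- by move=> j; rewrite /dens /= odd_double.
- by move=> i j; rewrite /= !odd_double.
Qed.

Lemma ip_cross : (0 < n)%N ->
  `|ip (C upper) lower - (n%:R * (a * Num.sqrt (b * (1 - b))) +
     n.-1%:R * (b * Num.sqrt (a * (1 - a))))|
   <= n%:R * (n%:R * ((5 + n.*2%:R *+ 2 + 3 / Num.sqrt (b * (1 - b))) * d)).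
Proof.
move=> n0.
set A := Num.sqrt (b * (1 - b)); set B := Num.sqrt (a * (1 - a)).
have sA j : sq j.*2 = A by rewrite /sq /dens odd_double.
have sB j : sq j.*2.+1 = B by rewrite /sq /dens /= odd_double.
have lC (j : 'I_n) : L2 (C (p j.*2)).
  by have [] := even_isometry (p_L1 j.*2) (p_L2 j.*2) (@p_even j.*2).
have -> : ip (C upper) lower = \sum_(j < n) \sum_(k < n) ip (C (p j.*2)) (p k.*2.+1).
  have -> : C upper = fun x => \sum_(j < n) C (p j.*2) x.
    apply/funext => x; rewrite /osc -intg_sum; last first.
      by move=> j; apply: L1_osc; [exact: cc|exact: kc|exact: p_L1].
    by apply: intg_ext => y; rewrite mulr_suml.
  rewrite ip_suml//; last exact: lower_L2.
  by apply: eq_bigr => j _; rewrite ip_sumr// => k; exact: p_L2.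
have -> : n%:R * (a * A) + n.-1%:R * (b * B) =
    \sum_(j < n) \sum_(k < n) (kron j k * (A * a) + kron j k.+1 * (b * B)).
  under eq_bigr do rewrite big_split /= -!mulr_suml.
  rewrite big_split /= -!mulr_suml; congr (_ + _).
    rewrite mulrC (mulrC a) mulrC; congr (_ * _).
    rewrite -[in LHS](card_ord n) -sum1_card natr_sum; apply: eq_bigr => j _.
    rewrite (bigD1 j)//= /kron eqxx big1 ?addr0// => k kj.
    by rewrite eq_sym (negbTE (_ : nat_of_ord k != j)).
  congr (_ * _); rewrite exchange_big /=.
  have [m nm] : exists m, n = m.+1 by case: (n) n0 => // m _; exists m.
  (* Column k has its second entry in row k + 1, so the last column has none: this is the origin of
     [n.-1]. *)
  rewrite nm /= big_ord_recr /= [X in _ + X]big1 ?addr0; last first.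
    by move=> j _; rewrite /kron (ltn_eqF (ltn_ord j)).
  rewrite -[in LHS](card_ord m) -sum1_card natr_sum; apply: eq_bigr => k _.
  rewrite (bigD1 (lift ord0 k))//= /kron /fintype.bump /= add1n eqxx big1 ?addr0// => j.
  by rewrite -val_eqE /= /fintype.bump /= add1n => /negbTE ->.
rewrite -sumrB; apply: (le_trans (ler_norm_sum _ _ _)).
have E z : n%:R * z = \sum_(j < n) z :> R by rewrite sumr_const card_ord mulr_natl.
rewrite E; apply: ler_sum => j _; rewrite -sumrB; apply: (le_trans (ler_norm_sum _ _ _)).
rewrite E; apply: ler_sum => k _.
have := gram (ltn_ord j) (ltn_ord k).
by rewrite !sA sB.
Qed.

End Gram.

(** * Wolff thinness *)

Section Thin.
Variable R : realType.
Local Notation mu := (@lebesgue_measure R).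

Lemma completed_lebesgueE (E : set R) : completed_lebesgue_measure E = mu E.
Proof. by []. Qed.

Lemma borel_lebesgue_measurable (E : set R) : measurable E -> lebesgue_measurable E.
Proof.
move=> mE; rewrite /lebesgue_measurable g_sigma_completed_algebra_genE.
by exists E => //; exists set0; [exact: negligible_set0|rewrite setU0].
Qed.

Lemma rho_gt0 (kappa x : R) : 0 < kappa -> 0 < rho kappa x.
Proof.
move=> k0; rewrite /rho; case: eqVneq => // x0.
by rewrite lt_min ltr01 divr_gt0// normr_gt0.
Qed.

Lemma rho_le1 (kappa x : R) : rho kappa x <= 1.
Proof. by rewrite /rho; case: eqVneq => // x0; rewrite ge_min lexx. Qed.

(** A lower bound for [rho] at every centre whose window can meet the ball of radius X >= 0; windows
    have radius at most 1, whence the summand 1. *)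
Definition rho_min (kappa X : R) : R := Num.min 1 (kappa / (`|X| + 1)).

Lemma rho_min_gt0 (kappa X : R) : 0 < kappa -> 0 < rho_min kappa X.
Proof. by move=> k0; rewrite lt_min ltr01 divr_gt0// ltr_wpDl. Qed.

Lemma rho_min_le (kappa X x : R) : 0 < kappa -> `|x| <= X + 1 -> rho_min kappa X <= rho kappa x.
Proof.
move=> k0 xX; rewrite /rho_min /rho; case: eqVneq => [_|x0]; first by rewrite ge_min lexx.
rewrite le_min ge_min lexx /= ge_min; apply/orP; right.
have h1 : 0 < `|X| + 1 by rewrite ltr_wpDl.
have h2 : 0 < `|x| by rewrite normr_gt0.
rewrite ler_pM2l// lef_pV2 ?posrE//.
by apply: le_trans xX _; rewrite lerD2r ler_norm.
Qed.

(** As the annuli are disjoint, the main terms add up to at most c times the window length; the n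
    errors, each at most s times [rho], are paid from the slack eps - c. *)
Lemma thin_union (kappa eps c s : R) (n : nat) (r : nat -> R) (T : nat -> set R) (idx : nat -> nat) :
  0 < kappa -> 0 < c -> 0 <= s -> n%:R * s <= 2 * (eps - c) ->
  (forall i j, (idx i < idx j)%N -> r (idx i).+2 <= r (idx j)) ->
  injective idx ->
  (forall i, 0 <= r i /\ layer c (s * rho_min kappa (r (idx i).+2)) (r (idx i)) (r (idx i).+2) (T (idx i))) ->
  Wolff_thin eps kappa (\big[setU/set0]_(k < n) T (idx k)).
Proof.
move=> k0 c0 s0 ns gap inj lay.
have mT i : measurable (T (idx i)) by have [_ []] := lay i.
set E := \big[setU/set0]_(k < n) _.
have mE : measurable E by exact: bigsetU_measurable.
split; first exact: borel_lebesgue_measurable.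
move=> x; rewrite completed_lebesgueE /Wolff_interval; set q := rho kappa x.
have q0 : 0 < q by exact: rho_gt0.
have q1 : q <= 1 by exact: rho_le1.
set u := x - q; set v := x + q.
have mI A : measurable A -> measurable_fun setT (\1_A : R -> R).
  by move=> mA; exact: measurable_indic.
have L_I : L1 (\1_(`]u, v[) : R -> R) by exact: L1_itv.
have LA A : measurable A -> L1 (fun x => \1_A x * \1_(`]u, v[) x).
  move=> mA; apply: L1_ext (L1Mb L_I (mI A mA) (k := 1) _) => z; first exact: mulrC.
  by rewrite indicE; case: (_ \in _); rewrite ?normr1 ?normr0.
have -> : mu (E `&` `]u, v[) = (intg (fun x => \1_E x * \1_(`]u, v[) x))%:E.
  rewrite (EFin_intg (LA E mE)).
  under eq_integral do rewrite -[_ * _]/((\1_E \* \1_(`]u, v[)) _) -indicI.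
  by rewrite integral_indic ?setIT//; apply: measurableI.
rewrite lee_fin.
have ineq i : intg (fun x => \1_(T (idx i)) x * \1_(`]u, v[) x) <=
    c * intg (fun x => \1_(ann (r (idx i)) (r (idx i).+2)) x * \1_(`]u, v[) x) + s * q.
  have [_ [_ _ sub H]] := lay i.
  (* Windows centred farther out miss the layer altogether; for the others [rho_min] bounds [rho]
     from below. *)
  have [xX|xX] := leP `|x| (r (idx i).+2 + 1).
    apply: (le_trans (H u v)); rewrite lerD2l ler_wpM2l//; exact: rho_min_le.
  rewrite (_ : intg (fun x => \1_(T _) x * _) = 0).
    by rewrite addr_ge0 ?mulr_ge0 ?(ltW c0) ?(ltW q0)// intg_ge0// => z; rewrite mulr_ge0// indicE; case: (_ \in _).
  rewrite -[RHS](intg0 R); apply: intg_ext => z; rewrite indic_itvE in_itv /= indicE.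
  case: (boolP (u < z < v)) => uzv; last by rewrite mulr0.
  rewrite memNset ?mul0r// => /sub /andP[_ zX].
  have : `|x - z| < 1.
    by move: uzv => /andP[]; rewrite /u /v ltr_norml => ? ?; apply/andP; split; lra.
  by have := ler_normD z (x - z); rewrite (_ : z + (x - z) = x); [lra|ring].
apply: (@le_trans _ _ (\sum_(i < n) intg (fun x => \1_(T (idx i)) x * \1_(`]u, v[) x))).
  rewrite -intg_sum; last by move=> i; apply: LA.
  apply: intg_le; [exact: LA|by apply: L1_sum => i; exact: LA|].
  move=> z; have z0 : 0 <= \1_(`]u, v[) z :> R by rewrite indicE; case: (_ \in _).
  rewrite -mulr_suml ler_wpM2r//.
  rewrite indicE; case: (boolP (z \in E)) => zE; last first.
    by rewrite sumr_ge0// => i _; rewrite indicE; case: (_ \in _).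
  move: zE; rewrite inE /E -(bigcup_mkord n (fun i => T (idx i))) => -[i /= i_n Tz].
  by rewrite (bigD1 (Ordinal i_n))//= indicE mem_set// lerDl sumr_ge0.
apply: (@le_trans _ _ (\sum_(i < n) (c * intg (fun x => \1_(ann (r (idx i)) (r (idx i).+2)) x * \1_(`]u, v[) x) + s * q))).
  by apply: ler_sum => i _; exact: ineq.
rewrite big_split /= -mulr_sumr sumr_const card_ord -mulr_natl.
have mann i : measurable (ann (r (idx i)) (r (idx i).+2)) by exact: measurable_ann.
rewrite -intg_sum; last by move=> i; exact: LA.
have : intg (fun x => \sum_(i < n) (\1_(ann (r (idx i)) (r (idx i).+2)) x * \1_(`]u, v[) x)) <= 2 * q.
  apply: (@le_trans _ _ (intg (\1_(`]u, v[) : R -> R))); last first.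
    rewrite intg_itv; rewrite /u /v; lra.
  apply: intg_le => //; first by apply: L1_sum => i; exact: LA.
  move=> z; rewrite -mulr_suml; have z0 : 0 <= \1_(`]u, v[) z :> R.
    by rewrite indicE; case: (_ \in _).
  rewrite ler_piMl//.
  have [[i zi]|nz] := pselect (exists i : 'I_n, ann (r (idx i)) (r (idx i).+2) z).
    rewrite (bigD1 i)//= big1; first by rewrite addr0 indicE; case: (_ \in _).
    move=> j ji; rewrite indicE memNset// => zj.
    have nij : idx i != idx j by apply: contra ji => /eqP/inj/val_inj ->.
    move: zi zj => /andP[i1 i2] /andP[j1 j2].
    move: nij; rewrite neq_ltn => /orP[] /gap H.
      by have := le_lt_trans (le_trans H j1) i2; rewrite ltxx.
    by have := le_lt_trans (le_trans H i1) j2; rewrite ltxx.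
  rewrite big1 // => i _; rewrite indicE memNset// => zi; apply: nz; by exists i.
move=> H; have : c * intg (fun x => \sum_(i < n) (\1_(ann (r (idx i)) (r (idx i).+2)) x * \1_(`]u, v[) x)) <= c * (2 * q).
  by rewrite ler_pM2l.
have : n%:R * (s * q) <= 2 * (eps - c) * q by rewrite mulrA ler_pM2r.
move: (intg _) => z; lra.
Qed.

End Thin.

(** * Optimisation of the parameters *)

Section Final.
Variable R : realType.
Local Notation C := (osc (@cos R)).

Definition seed : R -> R := \1_(`](- 2^-1), 2^-1[).

Lemma seedE x : seed x = (`|x| < 2^-1)%R%:R.
Proof. by rewrite /seed indic_itvE in_itv /= -ltr_norml. Qed.

Lemma seed_tame : tame seed.
Proof.
split; first exact: measurable_indic_itv.
  by move=> x; rewrite !seedE normrN.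
by exists 1 => x; rewrite seedE; case: (`|x| < 2^-1); rewrite ?normr1 ?normr0.
Qed.

Lemma seed_supported : supported seed 0 1.
Proof.
move=> x; rewrite normr_ge0 /= -leNgt seedE => x1.
by rewrite (_ : (_ < _) = false)//; apply/negbTE; rewrite -leNgt; lra.
Qed.

Lemma ip_seed : ip seed seed = 1.
Proof.
rewrite (_ : ip seed seed = intg seed).
  rewrite intg_itv; lra.
by apply: intg_ext => x; rewrite seedE; case: (`|x| < 2^-1); rewrite /= ?mulr1 ?mulr0.
Qed.

(** The chain tested on [upper] and [lower], with every error still explicit in d; the limits are
    left to [Theta2_ge_sqrt]. The last two smallness conditions keep the squared norms G and Y
    positive. *)
Lemma configuration (kappa eps1 eps2 a b d : R) (n : nat) : 0 < kappa ->
  0 < a < 1 -> 0 < b < 1 -> a < eps1 -> b < eps2 -> (0 < n)%N ->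
  0 < d -> d <= 1 -> n.*2%:R * d <= 1 ->
  (n.*2%:R + 1) * d < a -> (n.*2%:R + 1) * d < b ->
  exists (X G Y : R),
    [/\ [/\ 0 < G, G <= n%:R * (b + (n.*2%:R + 1) * d),
            0 < Y & Y <= n%:R * (a + (n.*2%:R + 1) * d)],
        n%:R * (a * Num.sqrt (b * (1 - b))) + n.-1%:R * (b * Num.sqrt (a * (1 - a))) -
          n%:R * (n%:R * ((5 + n.*2%:R *+ 2 + 3 / Num.sqrt (b * (1 - b))) * d)) <= X &
        ((X / (Num.sqrt G * Num.sqrt Y))%:E <= Theta2 kappa eps1 eps2)%E].
Proof.
move=> k0 a01 b01 ae be n0 d0 d1 nd da db.
have nR : 0 < n%:R :> R by rewrite ltr0n.
(* The smaller of the two slacks, shared equally among the n layers of each side. *)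
pose s := 2 * Num.min (eps1 - a) (eps2 - b) / n%:R.
have s0 : 0 < s by rewrite !mulr_gt0 ?invr_gt0// lt_min !subr_gt0 ae.
have ns : n%:R * s = 2 * Num.min (eps1 - a) (eps2 - b).
  by rewrite /s mulrCA divff ?mulr1// gt_eqF.
have ns1 : n%:R * s <= 2 * (eps1 - a) by rewrite ns ler_pM2l// ge_min lexx.
have ns2 : n%:R * s <= 2 * (eps2 - b) by rewrite ns ler_pM2l// ge_min lexx orbT.
pose eta X := s * rho_min kappa X.
have eta0 X : 0 < eta X by rewrite mulr_gt0// rho_min_gt0.
have d20 : 0 < d ^+ 2 by rewrite exprn_gt0.
have [r [T [f [f0 hf]]]] := chain (dens01 a01 b01) d20 eta0 seed_tame seed_supported.
have {}f0 : ip (f 0%N) (f 0%N) = 1 by rewrite f0 ip_seed.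
exists (ip (C (upper n T f)) (lower n T f)), (ip (upper n T f) (upper n T f)),
  (ip (lower n T f) (lower n T f)).
have hU := ip_upper n a01 b01 d0 d1 f0 hf.
have hL := ip_lower n a01 b01 d0 d1 f0 hf.
have hX := ip_cross a01 b01 d0 d1 nd f0 hf n0.
have U0 : 0 < ip (upper n T f) (upper n T f).
  move: hU; rewrite ler_norml => /andP[+ _].
  have : n%:R * ((n.*2%:R + 1) * d) < n%:R * b by rewrite ltr_pM2l.
  lra.
have L0 : 0 < ip (lower n T f) (lower n T f).
  move: hL; rewrite ler_norml => /andP[+ _].
  have : n%:R * ((n.*2%:R + 1) * d) < n%:R * a by rewrite ltr_pM2l.
  lra.
split.
- split => //.
    by move: hU; rewrite ler_norml mulrDr => /andP[_]; lra.
  by move: hL; rewrite ler_norml mulrDr => /andP[_]; lra.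
- by move: hX; rewrite ler_norml => /andP[+ _]; lra.
pose E := \big[setU/set0]_(k < n) T k.*2.+1.
pose F := \big[setU/set0]_(k < n) T k.*2.
have gap i j : (i < j)%N -> odd i = odd j -> r i.+2 <= r j.
  exact: (r_gap hf).
apply: (@le_trans _ _ (opnorm (Pop E \; Qop F)%relation)).
  apply: opnorm_ge => //.
  - apply: bigsetU_measurable => k _; exact: (measurable_T hf).
  - exact: (upper_L1 _ hf).
  - exact: (upper_L2 _ hf).
  - exact: (upper_even _ hf).
  - move=> x nF; apply: upper_out => j jn Tj; apply: nF.
    by rewrite /F -(bigcup_mkord n (fun j => T j.*2)); exists j.
  - exact: (lower_L2 _ hf).
  - move=> x nE; apply: lower_out => j jn Tj; apply: nE.
    by rewrite /E -(bigcup_mkord n (fun j => T j.*2.+1)); exists j.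
apply: ereal_sup_ubound; exists (E, F) => //=; split.
- apply: (thin_union (c := a) (s := s) (r := r) (idx := fun k => k.*2.+1)) => //.
  + by case/andP: a01.
  + exact: ltW.
  + by move=> i j ij; apply: gap => //=; rewrite !odd_double.
  + by move=> i j [] /double_inj.
  + move=> i; split; first by case: (hf i) => -[].
    by have [_ []] := hf i.*2.+1; rewrite /dens /= odd_double.
- apply: (thin_union (c := b) (s := s) (r := r) (idx := fun k => k.*2)) => //.
  + by case/andP: b01.
  + exact: ltW.
  + by move=> i j ij; apply: gap => //=; rewrite !odd_double.
  + exact: double_inj.
  + move=> i; split; first by case: (hf i) => -[].
    by have [_ []] := hf i.*2; rewrite /dens /= odd_double.
Qed.

Lemma le_of_linear_error (x y M D : R) : 0 < D -> 0 <= M ->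
  (forall d, 0 < d -> d <= D -> x <= y + M * d) -> x <= y.
Proof.
move=> D0 M0 H; rewrite leNgt; apply/negP => yx.
pose d := Num.min D ((x - y) / (2 * (M + 1))).
have p0 : 0 < 2 * (M + 1) by lra.
have d0 : 0 < d by rewrite lt_min D0 divr_gt0// subr_gt0.
have dD : d <= D by rewrite ge_min lexx.
have dE : d * (2 * (M + 1)) <= x - y by rewrite -ler_pdivlMr// ge_min lexx orbT.
have Md : 0 <= M * d by rewrite mulr_ge0// ltW.
have := H d d0 dD; move: dE.
by rewrite (_ : d * (2 * (M + 1)) = 2 * (M * d) + 2 * d); [lra|ring].
Qed.

(** The Archimedean substitute for n -> infinity; B will be the entry that the last column of the
    Gram matrix lacks. *)
Lemma le0_of_nat_bound (x B : R) : (forall m : nat, m.+1%:R * x <= B) -> x <= 0.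
Proof.
move=> H; rewrite leNgt; apply/negP => x0.
have [m Hm] : exists m : nat, B / x < m%:R.
  by exists (Num.truncn (B / x)).+1; exact: truncnS_gt.
have := H m; rewrite leNgt => /negP; apply.
rewrite -ltr_pdivrMr//; apply: (lt_trans Hm); by rewrite ltr_nat.
Qed.

Lemma Theta2_fin_num (kappa eps1 eps2 t : R) :
  (t%:E <= Theta2 kappa eps1 eps2)%E -> Theta2 kappa eps1 eps2 \is a fin_num.
Proof.
move=> H; rewrite fin_numElt (lt_le_trans (ltNyr t) H) /=.
exact: le_lt_trans (Theta2_le1 _ _ _) (ltry 1).
Qed.

(** Letting d -> 0 for fixed n leaves [main], free of errors; growing n then makes the missing entry
    negligible, and division by sqrt(a b) produces the two square roots. *)
Lemma Theta2_ge_sqrt (kappa eps1 eps2 a b : R) : 0 < kappa ->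
  0 < a < 1 -> 0 < b < 1 -> a < eps1 -> b < eps2 ->
  ((Num.sqrt (a * (1 - b)) + Num.sqrt (b * (1 - a)))%:E <= Theta2 kappa eps1 eps2)%E.
Proof.
move=> k0 a01 b01 ae be.
have /andP[a0 a1] := a01; have /andP[b0 b1] := b01.
pose al := a * Num.sqrt (b * (1 - b)); pose be' := b * Num.sqrt (a * (1 - a)).
pose Kn (n : nat) : R := n.*2%:R + 1.
have Kn0 n : 0 < Kn n by rewrite ltr_wpDl.
pose Dn n := Num.min 1 (Num.min a b / (2 * Kn n)).
have Dn0 n : 0 < Dn n by rewrite lt_min ltr01 divr_gt0 ?mulr_gt0// lt_min a0.
have cfg n d : (0 < n)%N -> 0 < d -> d <= Dn n ->
  exists (X G Y : R),
    [/\ [/\ 0 < G, G <= n%:R * (b + (n.*2%:R + 1) * d),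
            0 < Y & Y <= n%:R * (a + (n.*2%:R + 1) * d)],
        n%:R * al + n.-1%:R * be' -
          n%:R * (n%:R * ((5 + n.*2%:R *+ 2 + 3 / Num.sqrt (b * (1 - b))) * d)) <= X &
        ((X / (Num.sqrt G * Num.sqrt Y))%:E <= Theta2 kappa eps1 eps2)%E].
  move=> n0 d0; rewrite le_min => /andP[d1].
  rewrite ler_pdivlMr ?mulr_gt0// le_min => /andP[da db].
  have Kd : Kn n * d <= a / 2 by move: da; rewrite mulrCA mulrC [d * _]mulrC; lra.
  have Kd' : Kn n * d <= b / 2 by move: db; rewrite mulrCA mulrC [d * _]mulrC; lra.
  apply: configuration => //.
  - by move: Kd; rewrite /Kn mulrDl; lra.
  - by apply: le_lt_trans Kd _; lra.
  - by apply: le_lt_trans Kd' _; lra.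
have finT : Theta2 kappa eps1 eps2 \is a fin_num.
  have [X [G [Y [_ _ H]]]] := cfg 1%N _ isT (Dn0 1%N) (lexx _).
  exact: Theta2_fin_num H.
rewrite -(fineK finT) lee_fin; set t := fine _.
have t1 : t <= 1 by rewrite -lee_fin /t fineK//; exact: Theta2_le1.
(* A nonnegative bound can multiply inequalities; the maximum is undone at the end, where the lower
   bound is positive. *)
pose t' := Num.max 0 t.
have t'0 : 0 <= t' by rewrite le_max lexx.
have t'1 : t' <= 1 by rewrite ge_max ler01.
have tt' : t <= t' by rewrite le_max lexx orbT.
pose A := Num.sqrt a; pose B := Num.sqrt b.
have A0 : 0 < A by rewrite sqrtr_gt0.
have B0 : 0 < B by rewrite sqrtr_gt0.
have A2 : A ^+ 2 = a by rewrite sqr_sqrtr// ltW.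
have B2 : B ^+ 2 = b by rewrite sqr_sqrtr// ltW.
have main n : (0 < n)%N -> n%:R * al + n.-1%:R * be' <= n%:R * (t' * (A * B)).
  move=> n0; set N := n%:R : R.
  have N0 : 0 < N by rewrite ltr0n.
  pose P : R := 5 + n.*2%:R *+ 2 + 3 / Num.sqrt (b * (1 - b)).
  have P0 : 0 <= P by rewrite !addr_ge0// ?divr_ge0 ?sqrtr_ge0// mulrn_wge0.
  pose Q := Kn n * (A / B + B / A) / 2.
  have Q0 : 0 <= Q.
    by rewrite divr_ge0// mulr_ge0 ?(ltW (Kn0 n))// addr_ge0// divr_ge0// ltW.
  apply: (@le_of_linear_error _ _ (N * (N * P) + N * Q) (Dn n)) => //.
    have N0' := ltW N0; apply: addr_ge0; apply: mulr_ge0 => //; exact: mulr_ge0.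
  move=> d d0 dD; have [X [G [Y [[G0 GB Y0 YB] HX HT]]]] := cfg n d n0 d0 dD.
  have gy0 : 0 < Num.sqrt G * Num.sqrt Y by rewrite mulr_gt0 ?sqrtr_gt0.
  have X1 : X <= t' * (Num.sqrt G * Num.sqrt Y).
    rewrite -ler_pdivrMr//; apply: le_trans tt'.
    by rewrite -lee_fin /t fineK.
  (* The weights give equality at the limiting values G = n b and Y = n a, and replace square roots
     by an expression linear in d. *)
  have amgm : Num.sqrt G * Num.sqrt Y <= (G * (A / B) + Y * (B / A)) / 2.
    pose g := Num.sqrt G; pose y := Num.sqrt Y.
    have g2 : G = g ^+ 2 by rewrite sqr_sqrtr// ltW.
    have y2 : Y = y ^+ 2 by rewrite sqr_sqrtr// ltW.
    rewrite -/g -/y [in leRHS]g2 [in leRHS]y2 -subr_ge0.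
    have -> : (g ^+ 2 * (A / B) + y ^+ 2 * (B / A)) / 2 - g * y =
       (g * A - y * B) ^+ 2 / (2 * (A * B)).
      by field; rewrite ?gt_eqF.
    by rewrite divr_ge0 ?sqr_ge0// ltW// !mulr_gt0.
  have GY : (G * (A / B) + Y * (B / A)) / 2 <= N * (A * B) + N * Q * d.
    have h1 : G * (A / B) <= N * (b + Kn n * d) * (A / B) by rewrite ler_wpM2r// divr_ge0// ltW.
    have h2 : Y * (B / A) <= N * (a + Kn n * d) * (B / A) by rewrite ler_wpM2r// divr_ge0// ltW.
    have -> : N * (A * B) + N * Q * d =
      (N * (b + Kn n * d) * (A / B) + N * (a + Kn n * d) * (B / A)) / 2.
      by rewrite -A2 -B2 /Q; field; rewrite ?gt_eqF.
    by rewrite ler_pM2r// lerD.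
  have h3 : t' * (Num.sqrt G * Num.sqrt Y) <= N * (t' * (A * B)) + N * Q * d.
    apply: (@le_trans _ _ (t' * (N * (A * B) + N * Q * d))).
      by rewrite ler_wpM2l// (le_trans amgm GY).
    rewrite mulrDr mulrCA lerD2l ler_piMl// mulr_ge0 ?(ltW d0)// mulr_ge0// ltW.
  have -> : N * (t' * (A * B)) + (N * (N * P) + N * Q) * d =
     (N * (t' * (A * B)) + N * Q * d) + N * (N * (P * d)) by ring.
  rewrite -lerBlDr; apply: le_trans HX _; exact: le_trans X1 h3.
pose A1 := Num.sqrt (1 - a); pose B1 := Num.sqrt (1 - b).
have alE : al = A * B * (A * B1).
  by rewrite /al -A2 sqrtrM ?(ltW b0)// -/B -/B1; ring.
have beE : be' = A * B * (B * A1).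
  by rewrite /be' -B2 sqrtrM ?(ltW a0)// -/A -/A1; ring.
have fin : A * B1 + B * A1 <= t'.
  have AB0 : 0 < A * B by rewrite mulr_gt0.
  rewrite -subr_le0 -(pmulr_rle0 _ AB0).
  (* Rearranged, [main] for m + 1 reads (m + 1) A B (A B1 + B A1 - t') <= be'. *)
  apply: (@le0_of_nat_bound _ be') => m.
  have := main m.+1 isT; rewrite /= alE beE -natr1; move: (A * B) => AB; lra.
have Phi0 : 0 < A * B1 + B * A1.
  by rewrite addr_gt0// mulr_gt0// sqrtr_gt0 subr_gt0.
rewrite (sqrtrM _ (ltW a0)) (sqrtrM _ (ltW b0)) -/A -/B -/A1 -/B1.
move: fin; rewrite /t' /Num.max; case: ifP => // _.
by rewrite leNgt Phi0.
Qed.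

(** When e1 + e2 > 1, the second density is lowered to 1 - e1, where the formula takes the value e1
    + (1 - e1) = 1. *)
Lemma Phi_attained (e1 e2 : R) : 0 < e1 < 1 -> 0 < e2 < 1 ->
  exists a b : R, [/\ 0 < a < 1, 0 < b < 1, a <= e1, b <= e2 &
    Phi e1 e2 = Num.sqrt (a * (1 - b)) + Num.sqrt (b * (1 - a))].
Proof.
move=> e10 e20; rewrite /Phi; case: leP => h; first by exists e1, e2.
have /andP[? ?] := e10; have /andP[? ?] := e20.
exists e1, (1 - e1); split; rewrite ?lexx//; [by apply/andP; split; lra|by lra|].
rewrite opprB addrCA subrr addr0 -!expr2 !sqrtr_sqr !ger0_norm ?subr_ge0 ?ltW//; lra.
Qed.

(** Densities strictly below the thresholds are obtained by scaling a and b by t < 1. As t^2 x (1 -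
    y) <= t x (1 - t y), this costs at most a factor t, and t = 1 - d tends to 1. *)
Lemma Theta2_ge_Phi (kappa eps1 eps2 : R) : 0 < kappa -> 0 < eps1 < 1 -> 0 < eps2 < 1 ->
  ((Phi eps1 eps2)%:E <= Theta2 kappa eps1 eps2)%E.
Proof.
move=> k0 e1 e2; have [a [b [a01 b01 ae be ->]]] := Phi_attained e1 e2.
have /andP[a0 a1] := a01; have /andP[b0 b1] := b01.
set S := Num.sqrt _ + _.
have key t : 0 < t < 1 -> ((t * S)%:E <= Theta2 kappa eps1 eps2)%E.
  move=> /andP[t0 t1].
  have ta : t * a < a by rewrite gtr_pMl.
  have tb : t * b < b by rewrite gtr_pMl.
  have ta0 : 0 < t * a by rewrite mulr_gt0.
  have tb0 : 0 < t * b by rewrite mulr_gt0.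
  apply: le_trans (Theta2_ge_sqrt k0 _ _ (lt_le_trans ta ae) (lt_le_trans tb be)); first last.
  - by rewrite tb0 (lt_trans tb).
  - by rewrite ta0 (lt_trans ta).
  have tE : t = Num.sqrt (t ^+ 2) by rewrite sqrtr_sqr ger0_norm// ltW.
  have tt : t ^+ 2 <= t by rewrite expr2 ler_piMr// ltW.
  have aux x y : 0 < x < 1 -> 0 < y < 1 ->
      t * Num.sqrt (x * (1 - y)) <= Num.sqrt (t * x * (1 - t * y)).
    move=> /andP[x0 x1] /andP[y0 y1]; rewrite {1}tE -sqrtrM ?sqr_ge0//.
    have ty : t * y < y by rewrite gtr_pMl.
    have tx : 0 < t * x by rewrite mulr_gt0.
    have y1' : 0 < 1 - y by lra.
    have ty1 : 0 <= 1 - t * y by lra.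
    rewrite ler_sqrt; last by apply: mulr_ge0 => //; exact: ltW.
    apply: (@le_trans _ _ (t * x * (1 - y))).
      by rewrite mulrA (ler_pM2r y1') (ler_pM2r x0).
    by rewrite (ler_pM2l tx); lra.
  by rewrite lee_fin /S mulrDr; apply: lerD; exact: aux.
have half : 0 < (2^-1 : R) < 1 by apply/andP; split; lra.
have finT := Theta2_fin_num (key _ half).
rewrite -(fineK finT) lee_fin; set th := fine _.
have S0 : 0 <= S by rewrite addr_ge0// sqrtr_ge0.
apply: (@le_of_linear_error _ _ S 2^-1) => //.
move=> d d0 d1.
have : (1 - d) * S <= th.
  by rewrite -lee_fin /th fineK//; apply: key; apply/andP; split; lra.
by rewrite mulrBl mul1r mulrC; lra.
Qed.

End Final.

Theorem theorem1p1 (R : realType) (kappa : R) (hkappa : 0 < kappa) :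
  [/\ forall eps1 eps2 : R, 0 < eps1 < 1 -> 0 < eps2 < 1 ->
        ((Phi eps1 eps2)%:E <= Theta2 kappa eps1 eps2)%E,
      forall eps1 eps2 : R, 0 < eps1 < 1 -> 0 < eps2 < 1 ->
        1 <= eps1 + eps2 -> Theta2 kappa eps1 eps2 = 1%E
    & eps_c kappa <= 1 / 2].
Proof.
have lower e1 e2 : 0 < e1 < 1 -> 0 < e2 < 1 -> ((Phi e1 e2)%:E <= Theta2 kappa e1 e2)%E.
  exact: Theta2_ge_Phi.
have one e1 e2 : 0 < e1 < 1 -> 0 < e2 < 1 -> 1 <= e1 + e2 -> Theta2 kappa e1 e2 = 1%E.
  move=> h1 h2 h; apply/eqP; rewrite eq_le Theta2_le1 /=.
  have /andP[? ?] := h1; have /andP[? ?] := h2.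
  apply: le_trans (lower _ _ h1 h2); rewrite lee_fin /Phi; case: (leP (e1 + e2) 1) => // h'.
  (* Only the boundary case e1 + e2 = 1 is left, where [Phi] is still given by the square roots. *)
  have -> : e2 = 1 - e1 by lra.
  by rewrite opprB addrCA subrr addr0 -!expr2 !sqrtr_sqr !ger0_norm; lra.
split => //; rewrite /eps_c.
(* The supremum of the empty set is 0 by convention, so that case is separate. *)
set A := (X in sup X); have [[x Ax]|nA] := pselect (A !=set0); last first.
  have -> : A = set0 by apply/eqP/negPn/negP => /set0P.
  by rewrite sup0; lra.
apply: ge_sup; first by exists x.
move=> e [e01 He]; rewrite leNgt; apply/negP => e2.
by move: He; rewrite /Theta one ?ltxx//; lra.
Qed.
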